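(* Let $(\Omega,d,\mu)$ be a space of homogeneous type and let $L$ be a non-negative, self-adjoint, injective operator on $L^2(\Omega,\mu)$ whose semigroup $\{e^{-tL}\}_{t>0}$ satisfies the Davies-Gaffney estimates. Then both the heat semigroup $\{e^{-tL}\}_{t>0}$ and the Poisson semigroup $\{e^{-t\sqrt{L}}\}_{t>0}$ are strongly continuous on $H^1_L$; that is, for every $f\in H^1_L$, $$\lim_{t\to0^+}\|e^{-tL}f-f\|_{H^1_L}=0\qquad\text{and}\qquad \lim_{t\to0^+}\|e^{-t\sqrt{L}}f-f\|_{H^1_L}=0.$$
   Context: Setting. $(\Omega,d)$ is a metric space with a positive measure $\mu$; $B_d(x,t)=\{y\in\Omega: d(x,y)<t\}$ and $V(x,t)=\mu(B_d(x,t))$. $(\Omega,d,\mu)$ is a space of homogeneous type in the sense of Coifman-Weiss: there is $C>0$ with $\mu(B_d(x,2t))\le C\mu(B_d(x,t))$ for all $x\in\Omega$, $t>0$ (as usual, balls have positive finite measure). $L$ is a non-negative self-adjoint operator on $L^2(\Omega,\mu)$, injective on its domain, and $T_t=e^{-tL}$. Davies-Gaffney estimates: there are constants $C,c>0$ such that for all $t>0$, all open $U_1,U_2\subset\Omega$ and all $f_i\in L^2(\Omega)$ with $\operatorname{supp}f_i\subset U_i$ ($i=1,2$), $$|\langle T_tf_1,f_2\rangle|\le C\exp\left(-\frac{\operatorname{dist}(U_1,U_2)^2}{ct}\right)\|f_1\|_{L^2(\Omega)}\|f_2\|_{L^2(\Omega)}.$$ Hardy space. For $f\in L^2(\Omega)$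 let $$S_hf(x)=\left(\iint_{\Gamma(x)}|t^2LT_{t^2}f(y)|^2\,\frac{d\mu(y)}{V(x,t)}\frac{dt}{t}\right)^{1/2},\qquad \Gamma(x)=\{(y,t)\in\Omega\times(0,\infty): d(x,y)\le t\}.$$ $H^1_L$ is the (abstract) completion of $\{f\in L^2(\Omega):\|S_hf\|_{L^1(\Omega)}<\infty\}$ in the norm $\|f\|_{H^1_L}=\|S_hf\|_{L^1(\Omega)}$. The operators $e^{-tL}$ and $e^{-t\sqrt{L}}$ are defined on $L^2(\Omega)$ by the spectral theorem; on $H^1_L$ each is understood as its unique bounded extension from the dense subspace $\{f\in L^2(\Omega):\|S_hf\|_{L^1(\Omega)}<\infty\}$ (these extensions exist). *)

(* Defs.v *)
From HB Require Import structures.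
From mathcomp Require Import all_boot all_order all_algebra.
From mathcomp Require Import complex.
From mathcomp Require Import all_classical all_reals all_analysis.

Set Implicit Arguments.
Unset Strict Implicit.
Unset Printing Implicit Defensive.

Import Order.TTheory GRing.Theory Num.Theory.
Import numFieldNormedType.Exports.

Local Open Scope classical_set_scope.
Local Open Scope ring_scope.
Local Open Scope complex_scope.
Local Open Scope quotient_scope.

#[short(type="measurableMetricType")]
HB.structure Definition MeasurableMetric d (K : numDomainType) :=
  { M of Measurable d M & Metric K M }.

Section ComplexL2.
Context {d : measure_display} {T : measurableType d} {R : realType}.
Variable mu : {measure set T -> \bar R}.

Definition sq_integrable : {pred T -> R[i]} :=
  fun f => (@complex.Re R \o f \in Lfun mu 2%:E) &&
           (@complex.Im R \o f \in Lfun mu 2%:E).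

Let LfunD (u v : T -> R) : u \in Lfun mu 2%:E -> v \in Lfun mu 2%:E ->
  u + v \in Lfun mu 2%:E.
Proof. by have [_] := Lfun_addr_closed mu (lee1n 2); apply. Qed.

Let LfunZ (a : R) (u : T -> R) : u \in Lfun mu 2%:E -> a *: u \in Lfun mu 2%:E.
Proof.
have [h0 h] := Lfun_submod_closed mu (lee1n 2).
by move=> uL; rewrite -[a *: u]addr0; exact: h.
Qed.

Lemma sq_integrable_submod_closed : submod_closed sq_integrable.
Proof.
split.
  have L0 : (0 : T -> R) \in Lfun mu 2%:E.
    by have [] := Lfun_submod_closed mu (lee1n 2).
  by apply/andP; split; exact: L0.
move=> a f g /andP[fR fI] /andP[gR gI]; apply/andP; split.
- have -> : @complex.Re R \o (a *: f + g) =
    complex.Re a *: (@complex.Re R \o f) +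
    (- complex.Im a *: (@complex.Im R \o f) + (@complex.Re R \o g)).
    apply/funext => x /=; rewrite !fctE /=.
    by case: a (f x) (g x) => [a b] [u v] [u' v'] /=; rewrite addrA -mulNr.
  by rewrite !(LfunD, LfunZ).
- have -> : @complex.Im R \o (a *: f + g) =
    complex.Re a *: (@complex.Im R \o f) +
    (complex.Im a *: (@complex.Re R \o f) + (@complex.Im R \o g)).
    apply/funext => x /=; rewrite !fctE /=.
    by case: a (f x) (g x) => [a b] [u v] [u' v'] /=; rewrite addrA.
  by rewrite !(LfunD, LfunZ).
Qed.

HB.instance Definition _ :=
  GRing.isSubmodClosed.Build _ _ sq_integrable sq_integrable_submod_closed.

Record L2fun := MkL2fun { L2fun_val :> T -> R[i] ; _ : L2fun_val \in sq_integrable }.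
HB.instance Definition _ := [isSub for L2fun_val].
HB.instance Definition _ := [Choice of L2fun by <:].
HB.instance Definition _ := [SubChoice_isSubLmodule of L2fun by <:].

Definition ae_null : {pred L2fun} :=
  fun f => `[< \forall x \ae mu, (f : T -> R[i]) x = 0 >].

Lemma ae_null_submod_closed : submod_closed ae_null.
Proof.
split; first by apply/asboolP; exact: aeW.
move=> a f g /asboolP f0 /asboolP g0; apply/asboolP.
by apply: filterS2 f0 g0 => x fx gx; rewrite -[LHS]/(a * f x + g x) fx gx mulr0 addr0.
Qed.

HB.instance Definition _ :=
  GRing.isSubmodClosed.Build _ _ ae_null ae_null_submod_closed.

Definition L2 := {ideal_quot ae_null}.
HB.instance Definition _ := GRing.Zmodule.on L2.
HB.instance Definition _ := EqQuotient.on L2.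

Lemma L2_piP (f g : L2fun) : \pi_L2 f = \pi_L2 g <-> f - g \in ae_null.
Proof.
by split=> [/eqP|fg]; [|apply/eqP]; rewrite -Quotient.idealrBE.
Qed.

Lemma L2_pi_surj (f : L2) : exists g : L2fun, f = \pi_L2 g.
Proof. by exists (repr f); rewrite reprK. Qed.

Lemma L2_pi_addr (f g : L2fun) : \pi_L2 (f + g) = \pi_L2 f + \pi_L2 g :> L2.
Proof. exact: Quotient.pi_add. Qed.

Definition L2_scale (a : R[i]) (f : L2) : L2 := \pi_L2 (a *: repr f).

Lemma L2_scale_pi (a : R[i]) (f : L2fun) :
  L2_scale a (\pi_L2 f) = \pi_L2 (a *: f).
Proof.
apply/L2_piP; rewrite -scalerBr rpredZ//.
by apply/L2_piP; rewrite reprK.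
Qed.

Let L2_scalerA a b f : L2_scale a (L2_scale b f) = L2_scale (a * b) f.
Proof. by have [g ->] := L2_pi_surj f; rewrite !L2_scale_pi scalerA. Qed.

Let L2_scale1r : left_id 1 L2_scale.
Proof.
by move=> f; have [g ->] := L2_pi_surj f; rewrite !L2_scale_pi scale1r.
Qed.

Let L2_scalerDr : right_distributive L2_scale +%R.
Proof.
move=> a f g; have [f' ->] := L2_pi_surj f; have [g' ->] := L2_pi_surj g.
by rewrite -L2_pi_addr !L2_scale_pi -L2_pi_addr scalerDr.
Qed.

Let L2_scalerDl f : {morph L2_scale^~ f : a b / a + b}.
Proof.
move=> a b; have [g ->] := L2_pi_surj f.
by rewrite !L2_scale_pi -L2_pi_addr scalerDl.
Qed.

HB.instance Definition _ := GRing.Zmodule_isLmodule.Build R[i] L2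
  L2_scalerA L2_scale1r L2_scalerDr L2_scalerDl.

End ComplexL2.

(* An element of L2 is evaluated through a chosen representative; every notion
   below depends on it only up to null sets. *)
Definition L2_to_fun {d} {T : measurableType d} {R : realType}
  {mu : {measure set T -> \bar R}} (f : L2 mu) : T -> R[i] := repr f.
Coercion L2_to_fun : L2 >-> Funclass.

Definition cabs {R : realType} (z : R[i]) : R := complex.Re `|z|.

Section HilbertSpace.
Context {d : measure_display} {T : measurableType d} {R : realType}.
Variable mu : {measure set T -> \bar R}.

Definition cintegral (h : T -> R[i]) : R[i] :=
  (\int[mu]_x complex.Re (h x)) +i* (\int[mu]_x complex.Im (h x)).

Definition L2_inner (f g : L2 mu) : R[i] :=
  cintegral (fun x => f x * (g x)^*).

Definition L2_norm (f : L2 mu) : R := Num.sqrt (\int[mu]_x (cabs (f x) ^+ 2)).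

(* The values of [uop] outside [udom] are irrelevant. *)
Record unbounded_operator := UnboundedOperator {
  udom : set (L2 mu) ;
  uop :> L2 mu -> L2 mu ;
  udom0 : udom 0 ;
  udomP : forall a f g, udom f -> udom g -> udom (a *: f + g) ;
  uopP : forall a f g, udom f -> udom g -> uop (a *: f + g) = a *: uop f + uop g
}.

Definition densely_defined (L : unbounded_operator) : Prop :=
  forall (f : L2 mu) (e : R), 0 < e ->
    exists2 g, udom L g & L2_norm (f - g) < e.

(* The graph of the adjoint of [L] is the graph of [L]. *)
Definition self_adjoint (L : unbounded_operator) : Prop :=
  densely_defined L /\
  forall g h, (forall f, udom L f -> L2_inner (L f) g = L2_inner f h) <->
              (udom L g /\ h = L g).

(* For the order of [R[i]], [0 <= z] means that [z] is real and nonnegative. *)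
Definition nonnegative_operator (L : unbounded_operator) : Prop :=
  forall f, udom L f -> 0 <= L2_inner (L f) f.

Definition injective_operator (L : unbounded_operator) : Prop :=
  forall f g, udom L f -> udom L g -> L f = L g -> f = g.

(* A resolution of the identity E on the Borel sets of the real line.  The
   measures A |-> <E(A) f, f> are determined by the projections; that they are
   measures is the (weak) countable additivity of E. *)
Record spectral_measure := SpectralMeasure {
  sproj : set R -> L2 mu -> L2 mu ;
  sscal : L2 mu -> {measure set (measurableTypeR R) -> \bar R} ;
  sproj_linear : forall A : set (measurableTypeR R), measurable A ->
    linear (sproj A) ;
  sproj_adj : forall A : set (measurableTypeR R), measurable A ->
    forall f g, L2_inner (sproj A f) g = L2_inner f (sproj A g) ;
  sprojI : forall A B : set (measurableTypeR R), measurable A -> measurable B ->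
    forall f, sproj (A `&` B) f = sproj A (sproj B f) ;
  sprojT : forall f, sproj setT f = f ;
  sscalE : forall f (A : set (measurableTypeR R)), measurable A ->
    sscal f A = (complex.Re (L2_inner (sproj A f) f))%:E
}.

Section FunctionalCalculus.
Variable E : spectral_measure.

(* The integral of phi against the complex measure A |-> <E(A) f, g>, obtained
   from the measures <E(A) f, f> by polarization. *)
Definition spectral_form (phi : R -> R) (f g : L2 mu) : R[i] :=
  4%:R^-1 * \sum_(k < 4)
    'i%C ^+ k * (\int[sscal E (f + 'i%C ^+ k *: g)]_x phi x)%:C.

(* phi(L) = \int phi dE, with domain {f | \int |phi|^2 d<E f, f> < oo}. *)
Definition spectral_dom (phi : R -> R) : set (L2 mu) :=
  [set f | (\int[sscal E f]_x (phi x ^+ 2)%:E < +oo)%E].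

Definition spectral_apply (phi : R -> R) (f : L2 mu) : L2 mu :=
  xget 0 [set h | forall g, spectral_dom phi g ->
                    L2_inner h g = spectral_form phi f g].

Definition is_spectral_resolution (L : unbounded_operator) : Prop :=
  udom L = spectral_dom id /\
  forall f, udom L f -> L f = spectral_apply id f.

Definition heat (t : R) : L2 mu -> L2 mu :=
  spectral_apply (fun x => expR (- t * x)).

(* [Num.sqrt] vanishes on negative reals, which are [E]-null if [L] is
   nonnegative. *)
Definition poisson (t : R) : L2 mu -> L2 mu :=
  spectral_apply (fun x => expR (- t * Num.sqrt x)).

End FunctionalCalculus.
End HilbertSpace.

Section HardySpace.
Context {d : measure_display} {R : realType} {Omega : measurableMetricType d R}.
Variable mu : {measure set Omega -> \bar R}.

Definition homogeneous_type : Prop :=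
  [/\ (@open Omega `<=` measurable),
      (forall (x : Omega) (t : R), 0 < t -> (0 < mu (ball x t) < +oo)%E) &
      exists2 C : R, 0 < C & forall (x : Omega) (t : R), 0 < t ->
        (mu (ball x (2 * t)) <= C%:E * mu (ball x t))%E].

Definition ess_support (f : L2 mu) : set Omega :=
  [set x | forall U : set Omega, open U -> U x ->
             ~ (\forall y \ae mu, U y -> f y = 0)].

(* Equal to 0 if one of the sets is empty. *)
Definition set_dist (U1 U2 : set Omega) : R :=
  inf [set mdist p.1 p.2 | p in U1 `*` U2].

Definition davies_gaffney (T_ : R -> L2 mu -> L2 mu) : Prop :=
  exists C c : R, [/\ 0 < C, 0 < c &
    forall t : R, 0 < t ->
    forall U1 U2 : set Omega, open U1 -> open U2 ->
    forall f1 f2 : L2 mu, ess_support f1 `<=` U1 -> ess_support f2 `<=` U2 ->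
      cabs (L2_inner (T_ t f1) f2) <=
        C * expR (- (set_dist U1 U2 ^+ 2 / (c * t))) *
        L2_norm f1 * L2_norm f2].

Section SquareFunction.
Variables (L : unbounded_operator mu) (E : spectral_measure mu).

(* Iterated form of the integral over the cone d(x,y) <= t: the inner integral
   does not depend on the representative chosen for each t. *)
Definition square_fun (f : L2 mu) (x : Omega) : \bar R :=
  sqrte (\int[lebesgue_measure]_(t in `]0%R, +oo[)
           \int[mu]_(y in [set y | (mdist x y <= t)%R])
             (cabs (((t ^+ 2)%:C *: L (heat E (t ^+ 2) f) : L2 mu) y) ^+ 2
              / (fine (mu (ball x t)) * t))%:E)%E.

Definition hardy_enorm (f : L2 mu) : \bar R := (\int[mu]_x square_fun f x)%E.

Definition hardy_dom : set (L2 mu) := [set f | (hardy_enorm f < +oo)%E].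

Definition hardy_norm (f : L2 mu) : R := fine (hardy_enorm f).

End SquareFunction.
End HardySpace.

Section Completion.
Context {d : measure_display} {T : measurableType d} {R : realType}.
Context {mu : {measure set T -> \bar R}} {H : completeNormedModType R[i]}.

(* [H], with [iota], is a completion of the subspace [D] for the norm [N]. *)
Record is_completion (D : set (L2 mu)) (N : L2 mu -> R) (iota : L2 mu -> H) :
    Prop := IsCompletion {
  completion_linear : forall a f g, D f -> D g ->
    iota (a *: f + g) = a *: iota f + iota g ;
  completion_norm : forall f, D f -> `|iota f| = (N f)%:C ;
  completion_dense : dense (iota @` D)
}.

(* The bounded linear operator on [H] extending [P], an operator on [D]; the
   value 0 is used if there is none. *)
Definition bounded_extension (D : set (L2 mu)) (iota : L2 mu -> H)
    (P : L2 mu -> L2 mu) : H -> H :=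
  xget (fun=> 0) [set A | [/\ linear A,
    (exists M : R, forall h, `|A h| <= M%:C * `|h|) &
    forall f, D f -> D (P f) /\ A (iota f) = iota (P f)]].

End Completion.

(* Main.v *)
(* Put F_t = t^2 L e^{-t^2 L} f.  The heat semigroup only shifts the heights of the
   cone: t^2 L e^{-t^2 L} (e^{-sL} f) = (t / tau)^2 F_tau with tau = sqrt (t^2 + s).
   Let rho = sqrt s / 4.  For t >= rho, tau is comparable to t and doubling compares
   the densities at the two heights; for t < rho one averages over the balls of radius
   rho and uses the Cauchy-Schwarz inequality.  This bounds e^{-sL} on the Hardy space
   uniformly in s.  Strong continuity of the heat semigroup on the dense subspace
   follows: the heights outside [2/m, m] contribute little by the same bound, and
   dominated convergence applies to the remaining ones.
   If phi lies in the class generated from the symbols e^{-ux} by averages and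
   pointwise limits, so does phi^n, and so does 1 - sqrt (1 - phi), the limit of the
   iteration y |-> (phi + y^2) / 2.  Hence the class contains the Poisson symbol
   e^{-t sqrt x}, the limit of (1 - sqrt (1 - e^{-(t/n)^2 x}))^n.  The uniform bound,
   and a modulus of continuity that is affine in the symbol, survive averages (by the
   triangle inequality) and limits (by Fatou's lemma). *)
Require Import Defs.
From HB Require Import structures.
From mathcomp Require Import all_boot all_order all_algebra.
From mathcomp Require Import complex finmap.
From mathcomp Require Import all_classical all_reals all_analysis.
From mathcomp Require Import measurable_realfun.
From mathcomp Require Import ring lra.

Set Implicit Arguments.
Unset Strict Implicit.
Unset Printing Implicit Defensive.

Import Order.TTheory GRing.Theory Num.Theory.
Import numFieldNormedType.Exports.
Import HBSimple HBNNSimple.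

Local Open Scope classical_set_scope.
Local Open Scope ring_scope.
Local Open Scope complex_scope.
Local Open Scope quotient_scope.

(** * The space L2 as a real Hilbert space *)

Section RealL2.
Context {d : measure_display} {T : measurableType d} {R : realType}.
Variable mu : {measure set T -> \bar R}.

(** Small heights shape the estimate. For [t] far below [sqrt s], V(x, t) may be much smaller than
    V(x, tau), and doubling alone gives no uniform pointwise bound of the shifted density by the
    original one; only its averages over balls of radius [rho] are controlled. Since the Hardy norm
    integrates a square root, concavity makes this enough. The change of heights has d tau = (t /
    tau) dt, and the factor (t / tau)^4 coming from the squared symbol absorbs both this Jacobian
    and the change of 1 / t into 1 / tau. The Poisson semigroup is usually reached by subordination,
    as an integral of heat operators. The class of symbols used instead asks only for convexity of
    the norm and its lower semicontinuity under L2 convergence. The function 1 - sqrt (1 - z)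
    originates in its power series, whose coefficients are nonnegative and sum to 1: it turns
    e^{-ux} into a mixture of the e^{-kux}. As 1 - sqrt (1 - e^{-a^2}) is close to 1 - a for small
    a, its high powers produce the exponential of a square root. *)

Lemma limn_einf_le_near (u : (\bar R)^nat) (c : \bar R) :
  (\forall n \near \oo, (u n <= c)%E) -> (limn_einf u <= c)%E.
Proof.
move=> [N _ uc]; apply: (le_trans (limn_einf_sup u)).
rewrite limn_esup_lim; apply: lime_le; first exact: is_cvg_esups.
exists N => // n /= Nn; apply: ge_ereal_sup => _ [m /= nm <-].
by apply: uc => /=; exact: leq_trans nm.
Qed.

Lemma fatou_le (D : set T) (f_ : nat -> T -> \bar R) (f : T -> \bar R) (c : \bar R) :
  measurable D -> (forall n, measurable_fun D (f_ n)) -> measurable_fun D f ->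
  (forall n x, D x -> 0 <= f_ n x)%E -> (forall x, D x -> 0 <= f x)%E ->
  {ae mu, forall x, D x -> f_ ^~ x @ \oo --> f x} ->
  (\forall n \near \oo, (\int[mu]_(x in D) f_ n x <= c)%E) ->
  (\int[mu]_(x in D) f x <= c)%E.
Proof.
move=> mD mf_ mf f_0 f0 f_f ic.
have me : measurable_fun D (fun x => limn_einf (f_ ^~ x)).
  rewrite /limn_einf; apply: measurableT_comp => //.
  by apply: measurable_fun_limn_esup => n; exact: measurableT_comp.
rewrite (@ae_eq_integral _ _ _ mu D (fun x => limn_einf (f_ ^~ x)))//.
  apply: le_trans; first exact: fatou.
  exact: limn_einf_le_near.
apply: filterS f_f => x fx Dx.
by have [-> _] := cvg_limn_einf_sup (fx Dx).
Qed.

Lemma Lfun2P (u : T -> R) : u \in Lfun mu 2%:E <->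
  measurable_fun setT u /\ (\int[mu]_x ((u x) ^+ 2)%:E < +oo)%E.
Proof.
split.
  move=> u2; split; last exact/integrable_lty/Lfun2_integrable_sqr.
  by move: u2; rewrite inE => /andP[]; rewrite inE.
move=> [mu_ iu]; rewrite inE; apply/andP; split; rewrite inE//=.
rewrite /finite_norm unlock poweR_lty//.
apply: le_lt_trans iu; apply: ge0_le_integral => //=.
- apply/measurable_EFinP.
  apply/(@measurableT_comp _ _ _ _ _ _ (fun x : R => x `^ 2)%R) => //.
  exact/measurableT_comp.
- by apply/measurable_EFinP; exact: measurable_funX.
- by move=> x _; rewrite lee_fin powR_mulrn// real_normK// num_real.
Qed.

Lemma Lfun2_measurable (u : T -> R) : u \in Lfun mu 2%:E -> measurable_fun setT u.
Proof. by case/Lfun2P. Qed.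

Lemma measurable_sqE (u : T -> R) : measurable_fun setT u ->
  measurable_fun setT (fun x => ((u x) ^+ 2)%:E).
Proof. by move=> m; apply/measurable_EFinP; exact: measurable_funX. Qed.

Let sqD (a b : R) : (a + b) ^+ 2 <= 2 * a ^+ 2 + 2 * b ^+ 2.
Proof. by have := sqr_ge0 (a - b); rewrite sqrrB sqrrD; lra. Qed.

Lemma sq_int_add (u v : T -> R) : measurable_fun setT u -> measurable_fun setT v ->
  (\int[mu]_x ((u x + v x) ^+ 2)%:E <=
   2%:E * \int[mu]_x ((u x) ^+ 2)%:E + 2%:E * \int[mu]_x ((v x) ^+ 2)%:E)%E.
Proof.
move=> mu_ mv.
have s0 (w : T -> R) : forall x, setT x -> (0 <= ((w x) ^+ 2)%:E)%E.
  by move=> x _; rewrite lee_fin sqr_ge0.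
rewrite -!ge0_integralZl//; try exact: measurable_sqE; try exact: s0.
rewrite -ge0_integralD//.
- apply: ge0_le_integral => //=.
  + by move=> x _; rewrite lee_fin sqr_ge0.
  + exact/measurable_sqE/measurable_funD.
  + by apply: emeasurable_funD; apply: measurable_funeM; exact: measurable_sqE.
  + by move=> x _; rewrite -!EFinM -EFinD lee_fin.
- by move=> x _; rewrite mule_ge0// s0.
- by apply: measurable_funeM; exact: measurable_sqE.
- by move=> x _; rewrite mule_ge0// s0.
- by apply: measurable_funeM; exact: measurable_sqE.
Qed.

(** The increments are at most [sqrt M / 2 ^ k], so the telescoping series converges absolutely. *)
Lemma summable_cvg_seq (w : R^nat) (M : R) :
  (forall k, 4 ^+ k * (w k.+1 - w k) ^+ 2 <= M) -> cvgn w.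
Proof.
move=> wM.
have M0 : 0 <= M.
  by apply: le_trans (wM 0%N); rewrite mulr_ge0 ?sqr_ge0// exprn_ge0.
have -> : w = (fun n => w 0%N + series (telescope w) n).
  by apply/funext => n; rewrite -eq_sum_telescope.
apply: is_cvgD; first exact: is_cvg_cst.
apply: normed_cvg.
apply: (@series_le_cvg _ _ (geometric (Num.sqrt M) 2^-1)) => //.
- by move=> n /=.
- by move=> n; rewrite /geometric/= mulr_ge0 ?sqrtr_ge0 ?exprn_ge0 ?invr_ge0.
- move=> n /=; rewrite /telescope.
  have h : 0 <= Num.sqrt M / 2 ^+ n by rewrite divr_ge0 ?sqrtr_ge0 ?exprn_ge0.
  rewrite exprVn -(@ger0_norm _ (Num.sqrt M / _))// -ler_sqr ?nnegrE//.
  rewrite !real_normK ?num_real// expr_div_n sqr_sqrtr//.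
  rewrite ler_pdivlMr ?exprn_gt0//.
  rewrite mulrC exprAC (_ : 2 ^+ 2 = 4 :> R); first exact: wM.
  by rewrite expr2 -natrM.
- apply: is_cvg_geometric_series.
  by rewrite ger0_norm ?invr_ge0// invf_lt1// ltr1n.
Qed.

(** Riesz-Fischer. Along a subsequence with squared increments of integral at most [8^-1 ^ k], the
    sum of [4 ^ k] times these squares is integrable, hence finite almost everywhere, which yields
    almost everywhere convergence. Fatou's lemma then gives L2 convergence of the whole sequence. *)
Lemma Lfun2_complete (u : nat -> T -> R) :
  (forall n, u n \in Lfun mu 2%:E) ->
  (forall e : R, 0 < e -> exists N, forall m n, (N <= m)%N -> (N <= n)%N ->
     (\int[mu]_x ((u m x - u n x) ^+ 2)%:E <= e%:E)%E) ->
  exists2 v, v \in Lfun mu 2%:E &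
    forall e : R, 0 < e -> exists N, forall n, (N <= n)%N ->
     (\int[mu]_x ((u n x - v x) ^+ 2)%:E <= e%:E)%E.
Proof.
move=> uL uC.
have um n := Lfun2_measurable (uL n).
have /choice[N NP] : forall k, exists N, forall m n, (N <= m)%N -> (N <= n)%N ->
    (\int[mu]_x ((u m x - u n x) ^+ 2)%:E <= (8^-1 ^+ k)%:E)%E.
  by move=> k; apply: uC; rewrite exprn_gt0// invr_gt0.
(* The sum dominates [N k], and the summand [k] makes the subsequence tend to infinity. *)
pose p k := (k + \sum_(j < k.+1) N j)%N.
have Np k : (N k <= p k)%N.
  by rewrite /p big_ord_recr/= addnA leq_addl.
have pS k : (N k <= p k.+1)%N.
  by apply: (leq_trans (Np k)); rewrite /p (big_ord_recr k.+1)/= leq_add// leq_addr.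
pose w k := u (p k).
have mw k : measurable_fun setT (w k) by exact: um.
pose g k x := (4 ^+ k * (w k.+1 x - w k x) ^+ 2)%:E.
have mg k : measurable_fun setT (g k).
  rewrite /g; apply/measurable_EFinP; apply: measurable_funM => //.
  by apply: measurable_funX; exact: measurable_funB.
have g0 k x : (0 <= g k x)%E by rewrite lee_fin mulr_ge0 ?sqr_ge0// exprn_ge0.
have ig : (\int[mu]_x \sum_(0 <= k <oo) g k x < +oo)%E.
  rewrite integral_nneseries//.
  apply: (@le_lt_trans _ _ (\sum_(0 <= k <oo) (2^-1 ^+ k)%:E)%E).
    apply: lee_nneseries => [k _ _|k _].
      by apply: integral_ge0 => x _; exact: g0.
    rewrite /g; under eq_integral do rewrite EFinM.
    rewrite ge0_integralZl//; last 2 first.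
    - by apply: measurable_sqE; exact: measurable_funB.
    - by move=> x _; rewrite lee_fin sqr_ge0.
    apply: (@le_trans _ _ ((4 ^+ k)%:E * (8^-1 ^+ k)%:E)%E).
      by rewrite lee_pmul2l ?lte_fin ?exprn_gt0//; apply: NP.
    rewrite -EFinM lee_fin -exprMn; rewrite (_ : 4 * 8^-1 = 2^-1)//.
    by lra.
  suff /cvg_lim -> : (\sum_(0 <= k < n) (2^-1 ^+ k)%:E)%E @[n --> \oo] --> (2 : R)%:E.
  - by rewrite ltry.
  - by [].
  under eq_fun do rewrite sumEFin.
  apply: cvg_EFin; first exact: nearW.
  have := @cvg_geometric_series R 1 2^-1.
  rewrite ger0_norm ?invr_ge0// invf_lt1// ltr1n => /(_ isT).
  rewrite (_ : 1 - 2^-1 = 2^-1); last by lra.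
  rewrite invrK mul1r.
  by rewrite /series/=; under eq_fun do under eq_bigr do rewrite mul1r.
have wcvg : {ae mu, forall x, setT x -> cvgn (w ^~ x)}.
  have : mu.-integrable setT (fun x => \sum_(0 <= k <oo) g k x)%E.
    apply/integrableP; split; first exact: ge0_emeasurable_sum.
    apply: le_lt_trans ig; rewrite le_eqVlt; apply/orP; left; apply/eqP.
    by apply: eq_integral => x _; rewrite gee0_abs// nneseries_ge0.
  move=> /integrable_ae => /(_ measurableT).
  apply: filterS => x /(_ I) h _.
  apply: (@summable_cvg_seq _ (fine (\sum_(0 <= k <oo) g k x)%E)) => k.
  rewrite -lee_fin fineK//.
  apply: (@le_trans _ _ (\sum_(0 <= i < k.+1) g i x)%E); last exact: nneseries_lim_ge.
  by rewrite big_nat_recr//= leeDr// sume_ge0.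
(* The upper limit is measurable on the whole space, whatever happens off the set of convergence. *)
pose v x := fine (limn_esup (fun k => (w k x)%:E)).
have mv : measurable_fun setT v.
  apply: measurableT_comp => //.
  by apply: measurable_fun_limn_esup => n; apply/measurable_EFinP; exact: um.
have wv : {ae mu, forall x, setT x -> w ^~ x @ \oo --> v x}.
  apply: filterS wcvg => x /(_ I) /cvg_ex[l wl] _.
  suff -> : v x = l by [].
  have : (w k x)%:E @[k --> \oo] --> l%:E by apply: cvg_EFin => //; exact: nearW.
  by rewrite /v => /cvg_limn_einf_sup[_ ->].
have uv e : 0 < e -> exists N, forall n, (N <= n)%N ->
     (\int[mu]_x ((u n x - v x) ^+ 2)%:E <= e%:E)%E.
  move=> /uC[M MP]; exists M => n Mn.
  apply: (@fatou_le _ (fun k x => ((u n x - w k x) ^+ 2)%:E)) => //.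
  - by move=> k; apply: measurable_sqE; exact: measurable_funB.
  - by apply: measurable_sqE; exact: measurable_funB.
  - by move=> k x _; rewrite lee_fin sqr_ge0.
  - by move=> x _; rewrite lee_fin sqr_ge0.
  - apply: filterS wv => x /(_ I) wx _.
    apply: cvg_EFin; first exact: nearW.
    by rewrite expr2; under eq_fun do rewrite expr2; apply: cvgM; apply: cvgB => //; exact: cvg_cst.
  - exists M => // k /= Mk; apply: MP => //.
    by apply: (leq_trans Mk); rewrite /p leq_addr.
exists v => //.
have [M MP] := uv 1 ltr01.
apply/Lfun2P; split => //.
have -> : v = (fun x => u M x + - (u M x - v x)).
  by apply/funext => x; rewrite subKr.
apply: le_lt_trans.
  apply: sq_int_add => //; apply: measurableT_comp => //; exact: measurable_funB.
apply: lte_add_pinfty; apply: lte_mul_pinfty => //.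
  by have /Lfun2P[] := uL M.
under eq_integral do rewrite sqrrN.
by rewrite (le_lt_trans (MP _ (leqnn _)))// ltry.
Qed.

End RealL2.

Section L2Space.
Context {d : measure_display} {T : measurableType d} {R : realType}.
Variable mu : {measure set T -> \bar R}.
Implicit Types f g h : L2 mu.

Lemma L2_ae_pi (u : L2fun mu) : \forall x \ae mu, (\pi_(L2 mu) u : L2 mu) x = u x.
Proof.
have /L2_piP/asboolP : \pi_(L2 mu) (repr (\pi_(L2 mu) u)) = \pi_(L2 mu) u by rewrite reprK.
by apply: filterS => x; rewrite -[LHS]/(_ x - _ x) => /eqP; rewrite subr_eq0 => /eqP.
Qed.

Lemma L2_aeD f g : \forall x \ae mu, (f + g : L2 mu) x = f x + g x.
Proof.
have h : f + g = \pi_(L2 mu) (repr f + repr g) by rewrite L2_pi_addr !reprK.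
by have := L2_ae_pi (repr f + repr g); rewrite -h.
Qed.

Lemma L2_aeZ (a : R[i]) f : \forall x \ae mu, (a *: f : L2 mu) x = a * f x.
Proof. exact: L2_ae_pi (a *: repr f). Qed.

Definition reL f (x : T) : R := complex.Re (f x).
Definition imL f (x : T) : R := complex.Im (f x).

Lemma reL_Lfun f : reL f \in Lfun mu 2%:E.
Proof. by have /andP[] := valP (repr f). Qed.

Lemma imL_Lfun f : imL f \in Lfun mu 2%:E.
Proof. by have /andP[] := valP (repr f). Qed.

Lemma measurable_reL f : measurable_fun setT (reL f).
Proof. exact/Lfun2_measurable/reL_Lfun. Qed.

Lemma measurable_imL f : measurable_fun setT (imL f).
Proof. exact/Lfun2_measurable/imL_Lfun. Qed.

Lemma reL_aeD f g : \forall x \ae mu, reL (f + g) x = reL f x + reL g x.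
Proof. by apply: filterS (L2_aeD f g) => x; rewrite /reL => ->; case: (f x) (g x) => ? ? []. Qed.

Lemma imL_aeD f g : \forall x \ae mu, imL (f + g) x = imL f x + imL g x.
Proof. by apply: filterS (L2_aeD f g) => x; rewrite /imL => ->; case: (f x) (g x) => ? ? []. Qed.

Lemma reL_aeZ (a : R[i]) f : \forall x \ae mu,
  reL (a *: f) x = complex.Re a * reL f x - complex.Im a * imL f x.
Proof. by apply: filterS (L2_aeZ a f) => x; rewrite /reL /imL => ->; case: a (f x) => ? ? []. Qed.

Lemma imL_aeZ (a : R[i]) f : \forall x \ae mu,
  imL (a *: f) x = complex.Re a * imL f x + complex.Im a * reL f x.
Proof.
by apply: filterS (L2_aeZ a f) => x; rewrite /reL /imL => ->; case: a (f x) => ? ? [].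
Qed.

Lemma integrable_mul2 (u v : T -> R) : u \in Lfun mu 2%:E -> v \in Lfun mu 2%:E ->
  mu.-integrable setT (fun x => (u x * v x)%:E).
Proof. by move=> uL vL; exact: (Lfun1_integrable mu (u \* v)).1 (Lfun2_mul_Lfun1 uL vL). Qed.

(** The real part of [L2_inner]. It determines the imaginary part, which is [rin f ('i%C *: g)], so
    the Hilbert space arguments are run over the reals. *)
Definition rin f g : R := \int[mu]_x (reL f x * reL g x + imL f x * imL g x).

Lemma rin_integrable f g :
  mu.-integrable setT (fun x => (reL f x * reL g x + imL f x * imL g x)%:E).
Proof.
under eq_fun do rewrite EFinD.
by apply: integrableD => //; apply: integrable_mul2; (exact: reL_Lfun || exact: imL_Lfun).
Qed.

Lemma eq_ae_Rintegral (u v : T -> R) : measurable_fun setT u -> measurable_fun setT v ->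
  (\forall x \ae mu, u x = v x) -> \int[mu]_x u x = \int[mu]_x v x.
Proof.
move=> mu_ mv uv; rewrite /Rintegral; congr fine; apply: ae_eq_integral => //.
- exact/measurable_EFinP.
- exact/measurable_EFinP.
- by apply: filterS uv => x ->.
Qed.

Let mr f g : measurable_fun setT (fun x => reL f x * reL g x + imL f x * imL g x).
Proof. by apply/measurable_EFinP; have /integrableP[] := rin_integrable f g. Qed.

Lemma rinC f g : rin f g = rin g f.
Proof. by rewrite /rin; under eq_Rintegral do rewrite mulrC (mulrC (imL f _)). Qed.

Lemma rinDl f g h : rin (f + g) h = rin f h + rin g h.
Proof.
rewrite /rin -RintegralD//; [|exact: rin_integrable..].
apply: eq_ae_Rintegral; [exact: mr|by apply: measurable_funD; exact: mr|].
by apply: filterS2 (reL_aeD f g) (imL_aeD f g) => x -> ->; ring.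
Qed.

Lemma rinZl (a : R[i]) f h :
  rin (a *: f) h = complex.Re a * rin f h + complex.Im a * rin ('i%C *: f) h.
Proof.
rewrite /rin -!RintegralZl//; [|exact: rin_integrable..].
rewrite -RintegralD//; last 2 first.
- exact: (integrableZl measurableT (complex.Re a) (rin_integrable f h)).
- exact: (integrableZl measurableT (complex.Im a) (rin_integrable _ h)).
apply: eq_ae_Rintegral; [exact: mr|by apply: measurable_funD; apply: measurable_funM => //; exact: mr|].
apply: filterS2 (filterI (reL_aeZ a f) (imL_aeZ a f)) (filterI (reL_aeZ 'i%C f) (imL_aeZ 'i%C f)).
by move=> x [-> ->] [-> ->] /=; ring.
Qed.

Lemma rin_ii f g : rin ('i%C *: f) ('i%C *: g) = rin f g.
Proof.
apply: eq_ae_Rintegral; [exact: mr|exact: mr|].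
apply: filterS2 (filterI (reL_aeZ 'i%C f) (imL_aeZ 'i%C f)) (filterI (reL_aeZ 'i%C g) (imL_aeZ 'i%C g)).
by move=> x [-> ->] [-> ->] /=; ring.
Qed.

Lemma L2_innerE f g : L2_inner f g = rin f g +i* rin f ('i%C *: g).
Proof.
rewrite /L2_inner /cintegral; congr (_ +i* _).
  apply: eq_Rintegral => x _; rewrite /reL /imL.
  by case: (f x) (g x) => ? ? [? ?] /=; ring.
apply: eq_ae_Rintegral; [|exact: mr|].
- rewrite [X in measurable_fun _ X](_ : _ = fun x => imL f x * reL g x - reL f x * imL g x); last first.
    by apply/funext => x; rewrite /reL /imL; case: (f x) (g x) => ? ? [? ?] /=; ring.
  by apply: measurable_funB; apply: measurable_funM;
    (exact: measurable_reL || exact: measurable_imL).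
- apply: filterS (filterI (reL_aeZ 'i%C g) (imL_aeZ 'i%C g)) => x [-> ->] /=.
  by rewrite /reL /imL; case: (f x) (g x) => ? ? [? ?] /=; ring.
Qed.

Lemma rin_ge0 f : 0 <= rin f f.
Proof. by apply: Rintegral_ge0 => x _; rewrite addr_ge0// -expr2 sqr_ge0. Qed.

Definition sqa f x : R := reL f x ^+ 2 + imL f x ^+ 2.

Lemma cabs2E f x : cabs (f x) ^+ 2 = sqa f x.
Proof.
rewrite /sqa /reL /imL /cabs; case: (f x) => a b /=.
by rewrite sqr_sqrtr// addr_ge0 ?sqr_ge0.
Qed.

Lemma sqa_ge0 f x : 0 <= sqa f x.
Proof. by rewrite addr_ge0 ?sqr_ge0. Qed.

Lemma measurable_sqa f : measurable_fun setT (sqa f).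
Proof.
by apply: measurable_funD; apply: measurable_funX; [exact: measurable_reL|exact: measurable_imL].
Qed.

Lemma rin_eq0 f : rin f f = 0 -> f = 0.
Proof.
move=> h.
have : (\int[mu]_x (sqa f x)%:E = 0)%E.
  rewrite -[0%E]/(0%:E) -h /rin /Rintegral fineK; last first.
    exact/integrable_fin_num/rin_integrable.
  by apply: eq_integral => x _; rewrite /sqa !expr2.
move=> h0.
have : ae_eq mu setT (EFin \o sqa f) (cst 0%E).
  apply/ae_eq_integral_abs => //; first by apply/measurable_EFinP; exact: measurable_sqa.
  rewrite -[RHS]h0; apply: eq_integral => x _ /=.
  by rewrite ger0_norm// sqa_ge0.
move=> ae0.
have [u fu] := L2_pi_surj f.
have [v zv] := L2_pi_surj (0 : L2 mu).
rewrite -[f]reprK -[0]reprK; apply/L2_piP; apply/asboolP.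
have z0 : \forall x \ae mu, (0 : L2 mu) x = 0.
  by have := L2_aeZ 0 (0 : L2 mu); rewrite scale0r; apply: filterS => x ->; rewrite mul0r.
apply: filterS2 ae0 z0 => x /(_ I) [] fx0 zx.
rewrite -[LHS]/(f x - (0 : L2 mu) x) zx subr0.
move/eqP: fx0; rewrite /sqa paddr_eq0 ?sqr_ge0// !sqrf_eq0 /reL /imL.
by case: (f x) => a b /= /andP[/eqP -> /eqP ->].
Qed.

Definition massL (A : set T) f : \bar R := (\int[mu]_(x in A) (sqa f x)%:E)%E.

Lemma rin_mass f : ((rin f f)%:E = massL setT f)%E.
Proof.
rewrite /rin /Rintegral fineK; last exact/integrable_fin_num/rin_integrable.
by apply: eq_integral => x _; rewrite /sqa !expr2.
Qed.

Lemma massL_ge0 A f : (0 <= massL A f)%E.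
Proof. by apply: integral_ge0 => x _; rewrite lee_fin sqa_ge0. Qed.

Lemma massL_le A f : measurable A -> (massL A f <= (rin f f)%:E)%E.
Proof.
move=> mA; rewrite rin_mass; apply: ge0_subset_integral => //.
- by apply/measurable_EFinP; exact: measurable_sqa.
- by move=> x _; rewrite lee_fin sqa_ge0.
Qed.

Lemma massL_subset A B f : measurable A -> measurable B -> A `<=` B ->
  (massL A f <= massL B f)%E.
Proof.
move=> mA mB AB; apply: ge0_subset_integral => //.
- by apply: measurable_funTS; apply/measurable_EFinP; exact: measurable_sqa.
- by move=> x _; rewrite lee_fin sqa_ge0.
Qed.

Let ae_massL A f (u : T -> R) : measurable A -> measurable_fun setT u -> (forall x, 0 <= u x) ->
  (\forall x \ae mu, sqa f x = u x) -> massL A f = (\int[mu]_(x in A) (u x)%:E)%E.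
Proof.
move=> mA mu_ u0 h; apply: ae_eq_integral => //.
- by apply: measurable_funTS; apply/measurable_EFinP; exact: measurable_sqa.
- by apply: measurable_funTS; apply/measurable_EFinP.
- by apply: filterS h => x ->.
Qed.

Lemma massLZ A (a : R) f : measurable A -> massL A (a%:C *: f) = ((a ^+ 2)%:E * massL A f)%E.
Proof.
move=> mA; rewrite (@ae_massL _ _ (fun x => a ^+ 2 * sqa f x))//.
- under eq_integral do rewrite EFinM.
  rewrite ge0_integralZl//.
  + by apply: measurable_funTS; apply/measurable_EFinP; exact: measurable_sqa.
  + by move=> x _; rewrite lee_fin sqa_ge0.
  + by rewrite lee_fin sqr_ge0.
- by apply: measurable_funM => //; exact: measurable_sqa.
- by move=> x; rewrite mulr_ge0 ?sqa_ge0 ?sqr_ge0.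
- apply: filterS (filterI (reL_aeZ a%:C f) (imL_aeZ a%:C f)) => x [h1 h2].
  by rewrite /sqa h1 h2 /=; ring.
Qed.

Lemma massL_i A f : measurable A -> massL A ('i%C *: f) = massL A f.
Proof.
move=> mA; rewrite (@ae_massL A _ (sqa f))//.
- exact: measurable_sqa.
- by move=> x; exact: sqa_ge0.
- apply: filterS (filterI (reL_aeZ 'i%C f) (imL_aeZ 'i%C f)) => x [h1 h2].
  by rewrite /sqa h1 h2 /=; ring.
Qed.

(** The weight [e] stays free: optimising it after integration gives the triangle inequality for
    square roots of iterated integrals ([sqrte_triangle]). *)
Lemma massLD A (e : R) f g : measurable A -> 0 < e ->
  (massL A (f + g)%R <= (1 + e)%:E * massL A f + (1 + e^-1)%:E * massL A g)%E.
Proof.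
move=> mA e0.
have ms h : measurable_fun A (fun x => (sqa h x)%:E).
  by apply: measurable_funTS; apply/measurable_EFinP; exact: measurable_sqa.
have s0 h : forall x, A x -> (0 <= (sqa h x)%:E)%E by move=> x _; rewrite lee_fin sqa_ge0.
have c1 : (0 <= (1 + e)%:E)%E by rewrite lee_fin addr_ge0// ltW.
have c2 : (0 <= (1 + e^-1)%:E)%E by rewrite lee_fin addr_ge0// invr_ge0 ltW.
rewrite (@ae_massL _ _ (fun x => (reL f x + reL g x) ^+ 2 + (imL f x + imL g x) ^+ 2))//.
- have Z c h : (0 <= c)%E -> (c * massL A h = \int[mu]_(x in A) (c * (sqa h x)%:E))%E.
    by move=> c0; rewrite -ge0_integralZl//; exact: s0.
  rewrite !Z// -ge0_integralD//; last 4 first.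
  + by move=> x Ax; rewrite mule_ge0// s0.
  + exact: measurable_funeM.
  + by move=> x Ax; rewrite mule_ge0// s0.
  + exact: measurable_funeM.
  apply: ge0_le_integral => //.
  + by move=> x _; rewrite lee_fin addr_ge0 ?sqr_ge0.
  + apply: measurable_funTS; apply/measurable_EFinP.
    apply: measurable_funD; apply: measurable_funX; apply: measurable_funD;
    by (exact: measurable_reL || exact: measurable_imL).
  + by apply: emeasurable_funD; exact: measurable_funeM.
  + move=> x _; rewrite -!EFinM -EFinD lee_fin /sqa.
    have h (a b : R) : (a + b) ^+ 2 <= (1 + e) * a ^+ 2 + (1 + e^-1) * b ^+ 2.
      rewrite -subr_ge0 (_ : _ - _ = e * (a - e^-1 * b) ^+ 2).
        by rewrite mulr_ge0 ?sqr_ge0// ltW.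
      by field; rewrite gt_eqF.
    by have := h (reL f x) (reL g x); have := h (imL f x) (imL g x); lra.
- apply: measurable_funD; apply: measurable_funX; apply: measurable_funD;
  by (exact: measurable_reL || exact: measurable_imL).
- by move=> x; rewrite addr_ge0 ?sqr_ge0.
- by apply: filterS2 (reL_aeD f g) (imL_aeD f g) => x h1 h2; rewrite /sqa h1 h2.
Qed.

End L2Space.

Section L2Hilbert.
Context {d : measure_display} {T : measurableType d} {R : realType}.
Variable mu : {measure set T -> \bar R}.
Implicit Types f g h : L2 mu.

Lemma rinDr f g h : rin f (g + h) = rin f g + rin f h.
Proof. by rewrite rinC rinDl !(rinC f). Qed.

Lemma rinZRl (a : R) f g : rin (a%:C *: f) g = a * rin f g.
Proof. by rewrite rinZl/= mul0r addr0. Qed.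

Lemma rinZRr (a : R) f g : rin f (a%:C *: g) = a * rin f g.
Proof. by rewrite rinC rinZRl rinC. Qed.

Lemma scaleN1L f : - f = (-1)%:C *: f.
Proof. by rewrite -scaleN1r; congr (_ *: _); apply/eqP; rewrite eq_complex/= oppr0 !eqxx. Qed.

Lemma rinNl f g : rin (- f) g = - rin f g.
Proof. by rewrite scaleN1L rinZRl mulN1r. Qed.

Lemma rinNr f g : rin f (- g) = - rin f g.
Proof. by rewrite rinC rinNl rinC. Qed.

Lemma rinBl f g h : rin (f - g) h = rin f h - rin g h.
Proof. by rewrite rinDl rinNl. Qed.

Lemma rinBr f g h : rin f (g - h) = rin f g - rin f h.
Proof. by rewrite rinDr rinNr. Qed.

Lemma ii_N1 : 'i%C * 'i%C = - 1 :> R[i].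
Proof. by apply/eqP; rewrite eq_complex/=; apply/andP; split; apply/eqP; ring. Qed.

Lemma rin_il f g : rin ('i%C *: f) g = - rin f ('i%C *: g).
Proof. by rewrite -[LHS]rin_ii scalerA ii_N1 scaleN1r rinNl. Qed.

Lemma rin_ext f g : (forall h, rin f h = rin g h) -> f = g.
Proof.
by move=> fg; apply/eqP; rewrite -subr_eq0; apply/eqP/rin_eq0; rewrite rinBl fg subrr.
Qed.

Definition nsq f : R := rin f f.

Lemma nsq_ge0 f : 0 <= nsq f. Proof. exact: rin_ge0. Qed.

Lemma nsqD f g : nsq (f + g) = nsq f + 2 * rin f g + nsq g.
Proof. by rewrite /nsq rinDl !rinDr (rinC g f); ring. Qed.

Lemma nsqB f g : nsq (f - g) = nsq f - 2 * rin f g + nsq g.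
Proof. by rewrite /nsq rinBl !rinBr (rinC g f); ring. Qed.

Lemma nsqZ (a : R) f : nsq (a%:C *: f) = a ^+ 2 * nsq f.
Proof. by rewrite /nsq rinZRl rinZRr mulrA expr2. Qed.

Lemma nsqN f : nsq (- f) = nsq f.
Proof. by rewrite /nsq rinNl rinNr opprK. Qed.

(** Expand [nsq (e%:C *: f + g)] and [nsq (e%:C *: f - g)], both nonnegative, and divide by [e].
    This weighted form stands in for the Cauchy-Schwarz inequality and involves no square root. *)
Lemma rin_le f g (e : R) : 0 < e -> `|rin f g| <= e * nsq f + e^-1 * nsq g.
Proof.
move=> e0.
rewrite ler_norml.
have h1 := nsq_ge0 (e%:C *: f + g); have h2 := nsq_ge0 (e%:C *: f - g).
rewrite nsqD nsqZ rinZRl in h1; rewrite nsqB nsqZ rinZRl in h2.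
have ei : 0 < e^-1 by rewrite invr_gt0.
have ee : e^-1 * e = 1 by rewrite mulVf// gt_eqF.
have k1 : 0 <= e^-1 * (e ^+ 2 * nsq f + 2 * (e * rin f g) + nsq g) by rewrite mulr_ge0// ltW.
have k2 : 0 <= e^-1 * (e ^+ 2 * nsq f - 2 * (e * rin f g) + nsq g) by rewrite mulr_ge0// ltW.
have q1 : e^-1 * (e ^+ 2 * nsq f + 2 * (e * rin f g) + nsq g) = e * nsq f + 2 * rin f g + e^-1 * nsq g.
  by field; rewrite gt_eqF.
have q2 : e^-1 * (e ^+ 2 * nsq f - 2 * (e * rin f g) + nsq g) = e * nsq f - 2 * rin f g + e^-1 * nsq g.
  by field; rewrite gt_eqF.
rewrite q1 in k1; rewrite q2 in k2.
have p1 : 0 <= e * nsq f by rewrite mulr_ge0 ?nsq_ge0// ltW.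
have p2 : 0 <= e^-1 * nsq g by rewrite mulr_ge0 ?nsq_ge0// ltW.
by apply/andP; split; lra.
Qed.

Definition L2_lim (f_ : nat -> L2 mu) f : Prop := nsq (f_ n - f) @[n --> \oo] --> 0.

Lemma L2_limP (f_ : nat -> L2 mu) f : L2_lim f_ f <->
  (forall e : R, 0 < e -> \forall n \near \oo, nsq (f_ n - f) <= e).
Proof.
split=> [h e e0|h].
  move/cvgrPdist_le : h => /(_ e e0); apply: filterS => n.
  by rewrite sub0r normrN ger0_norm// nsq_ge0.
apply/cvgrPdist_le => e e0; apply: filterS (h e e0) => n.
by rewrite sub0r normrN ger0_norm// nsq_ge0.
Qed.

Lemma L2_lim_rin (f_ : nat -> L2 mu) f g : L2_lim f_ f ->
  rin (f_ n) g @[n --> \oo] --> rin f g.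
Proof.
move=> fl; apply/cvgrPdist_le => e e0.
(* The weight makes the term in [nsq g] at most [e / 2]; the summand 1 keeps it positive when
   [nsq g] vanishes. *)
have [b b0 hb] : exists2 b, 0 < b & b^-1 * nsq g <= e / 2.
  have b0 : 0 < 2 * nsq g / e + 1.
    by rewrite ltr_wpDl// divr_ge0 ?mulr_ge0 ?nsq_ge0// ltW.
  exists (2 * nsq g / e + 1) => //.
  rewrite mulrC ler_pdivrMr// (_ : e / 2 * _ = nsq g + e / 2); last by field; rewrite gt_eqF.
  by rewrite lerDl divr_ge0// ltW.
have /L2_limP/(_ (e / 2 / b) _) := fl.
rewrite !divr_gt0// => /(_ isT); apply: filterS => n hn.
rewrite distrC -rinBl; apply: (le_trans (rin_le _ _ b0)).
rewrite [leRHS]splitr lerD// mulrC -ler_pdivlMr//.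
Qed.

Lemma L2_ae_mk (u v : T -> R) : u \in Lfun mu 2%:E -> v \in Lfun mu 2%:E ->
  exists f, (\forall x \ae mu, reL f x = u x) /\ (\forall x \ae mu, imL f x = v x).
Proof.
move=> uL vL.
have m : (fun x => u x +i* v x) \in sq_integrable mu.
  by apply/andP; split; [exact: uL|exact: vL].
exists (\pi_(L2 mu) (MkL2fun m)); split.
- by apply: filterS (L2_ae_pi (MkL2fun m)) => x; rewrite /reL => ->.
- by apply: filterS (L2_ae_pi (MkL2fun m)) => x; rewrite /imL => ->.
Qed.

Lemma nsqE f : (nsq f)%:E =
  (\int[mu]_x ((reL f x) ^+ 2)%:E + \int[mu]_x ((imL f x) ^+ 2)%:E)%E.
Proof.
rewrite /nsq rin_mass /massL /sqa; under eq_integral do rewrite EFinD.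
rewrite ge0_integralD//.
- by move=> x _; rewrite lee_fin sqr_ge0.
- by apply: measurable_sqE; exact: measurable_reL.
- by move=> x _; rewrite lee_fin sqr_ge0.
- by apply: measurable_sqE; exact: measurable_imL.
Qed.

Lemma L2_aeB f g : (\forall x \ae mu, reL (f - g) x = reL f x - reL g x) /\
  (\forall x \ae mu, imL (f - g) x = imL f x - imL g x).
Proof.
split.
- apply: filterS2 (reL_aeD f (- g)) (reL_aeZ (-1)%:C g) => x.
  by rewrite -scaleN1L => -> ->/=; ring.
- apply: filterS2 (imL_aeD f (- g)) (imL_aeZ (-1)%:C g) => x.
  by rewrite -scaleN1L => -> ->/=; ring.
Qed.

Lemma L2_complete (f_ : nat -> L2 mu) :
  (forall e : R, 0 < e -> exists N, forall m n, (N <= m)%N -> (N <= n)%N ->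
     nsq (f_ m - f_ n) <= e) ->
  exists f, L2_lim f_ f.
Proof.
move=> fC.
have meas_eq (u v w : T -> R) : measurable_fun setT u -> measurable_fun setT v -> measurable_fun setT w ->
  (\forall x \ae mu, u x = v x - w x) ->
  (\int[mu]_x ((u x) ^+ 2)%:E = \int[mu]_x ((v x - w x) ^+ 2)%:E)%E.
  move=> mu_ mv mw h; apply: ae_eq_integral => //.
  - exact: measurable_sqE.
  - by apply: measurable_sqE; exact: measurable_funB.
  - by apply: filterS h => x ->.
have CR (pr : L2 mu -> T -> R) (prm : forall f, measurable_fun setT (pr f))
   (prB : forall f g, \forall x \ae mu, pr (f - g) x = pr f x - pr g x)
   (prL : forall f, pr f \in Lfun mu 2%:E)
   (prn : forall f, (\int[mu]_x ((pr f x) ^+ 2)%:E <= (nsq f)%:E)%E) :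
   exists2 v, v \in Lfun mu 2%:E &
    forall e : R, 0 < e -> exists N, forall n, (N <= n)%N ->
     (\int[mu]_x ((pr (f_ n) x - v x) ^+ 2)%:E <= e%:E)%E.
  apply: Lfun2_complete => // e /fC[N NP]; exists N => m n Nm Nn.
  rewrite -(@meas_eq (pr (f_ m - f_ n)))//.
  by apply: (le_trans (prn _)); rewrite lee_fin NP.
have s0 (u : T -> R) : (0 <= \int[mu]_x ((u x) ^+ 2)%:E)%E.
  by apply: integral_ge0 => x _; rewrite lee_fin sqr_ge0.
have [|||u uL uP] := CR (@reL _ _ _ mu) (@measurable_reL _ _ _ mu).
- by move=> f g; have [] := L2_aeB f g.
- exact: reL_Lfun.
- by move=> f; rewrite nsqE leeDl.
have [|||v vL vP] := CR (@imL _ _ _ mu) (@measurable_imL _ _ _ mu).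
- by move=> f g; have [] := L2_aeB f g.
- exact: imL_Lfun.
- by move=> f; rewrite nsqE leeDr.
have [f [fu fv]] := L2_ae_mk uL vL.
exists f; apply/L2_limP => e e0.
have e20 : 0 < e / 2 by rewrite divr_gt0.
have [N1 N1P] := uP _ e20; have [N2 N2P] := vP _ e20.
exists (maxn N1 N2) => // n /=; rewrite geq_max => /andP[n1 n2].
rewrite -lee_fin nsqE [in leRHS](splitr e) EFinD.
apply: leeD.
- rewrite (@meas_eq _ (reL (f_ n)) u)//.
  + exact: N1P.
  + exact: measurable_reL.
  + exact: measurable_reL.
  + exact: Lfun2_measurable uL.
  + by have [h _] := L2_aeB (f_ n) f; apply: filterS2 h fu => x -> ->.
- rewrite (@meas_eq _ (imL (f_ n)) v)//.
  + exact: N2P.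
  + exact: measurable_imL.
  + exact: measurable_imL.
  + exact: Lfun2_measurable vL.
  + by have [_ h] := L2_aeB (f_ n) f; apply: filterS2 h fv => x -> ->.
Qed.

End L2Hilbert.

(** * Bounded functional calculus *)

Section BoundedMeasurable.
Context {d : measure_display} {S : measurableType d} {R : realType}.

Definition bmf (phi : S -> R) : Prop :=
  measurable_fun setT phi /\ exists K : R, forall x, `|phi x| <= K.

Lemma bmf_indic (A : set S) : measurable A -> bmf \1_A.
Proof.
move=> mA; split; first exact: measurable_indic.
by exists 1 => x; rewrite indicE; case: (_ \in _); rewrite ?normr0 ?normr1.
Qed.

Lemma bmf_lin (a : R) phi psi : bmf phi -> bmf psi -> bmf (fun x => a * phi x + psi x).
Proof.
move=> [m1 [K1 h1]] [m2 [K2 h2]]; split.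
  by apply: measurable_funD => //; apply: measurable_funM.
exists (`|a| * K1 + K2) => x; apply: (le_trans (ler_normD _ _)).
by rewrite normrM lerD// ler_wpM2l.
Qed.

Lemma bmf_mul phi psi : bmf phi -> bmf psi -> bmf (fun x => phi x * psi x).
Proof.
move=> [m1 [K1 h1]] [m2 [K2 h2]]; split; first exact: measurable_funM.
by exists (K1 * K2) => x; rewrite normrM ler_pM.
Qed.

Lemma bmf_cst (a : R) : bmf (fun=> a).
Proof. by split => //; exists `|a|. Qed.

Lemma bmf_sub phi psi : bmf phi -> bmf psi -> bmf (fun x => phi x - psi x).
Proof.
move=> b1 b2; have := bmf_lin (-1) b2 b1.
by rewrite (_ : (fun _ => _) = (fun x => phi x - psi x))//; apply/funext => x; ring.
Qed.

(** A functional monotone class principle: simple functions are reached by linearity, nonnegative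
    functions as bounded limits of simple ones, and a general function becomes nonnegative after
    adding its bound [K]. *)
Lemma bmf_ind (P : (S -> R) -> Prop) :
  (forall A, measurable A -> P \1_A) ->
  (forall a phi psi, bmf phi -> bmf psi -> P phi -> P psi -> P (fun x => a * phi x + psi x)) ->
  (forall (phi_ : nat -> S -> R) (phi : S -> R) (K : R), (forall n, measurable_fun setT (phi_ n)) ->
    measurable_fun setT phi ->
    (forall n x, `|phi_ n x| <= K) -> (forall x, `|phi x| <= K) ->
    (forall x, phi_ n x @[n --> \oo] --> phi x) -> (forall n, P (phi_ n)) -> P phi) ->
  forall phi, bmf phi -> P phi.
Proof.
move=> P1 Plin Plim.
have Psf (f : {nnsfun S >-> R}) : P f.
  have -> : (f : S -> R) = (fun x => \sum_(i <- fset_set (range f)) (i * \1_(f @^-1` [set i]) x)).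
    by apply/funext => x; rewrite fimfunE fsbig_finite.
  elim: (finmap.enum_fset _) => [|a s ih].
    rewrite (_ : (fun _ => _) = \1_set0); first exact: P1.
    by apply/funext => x; rewrite big_nil indic0.
  rewrite (_ : (fun _ => _) = (fun x => a * \1_(f @^-1` [set a]) x +
     \sum_(i <- s) (i * \1_(f @^-1` [set i]) x))); last first.
    by apply/funext => x; rewrite big_cons.
  have mp i : measurable (f @^-1` [set i]) by [].
  apply: Plin => //; [exact: bmf_indic| |exact: P1].
  elim: {ih} s => [|b s ih].
    by under eq_fun do rewrite big_nil; exact: bmf_cst.
  by under eq_fun do rewrite big_cons; apply: bmf_lin => //; exact: bmf_indic.
have Pnn phi : bmf phi -> (forall x, 0 <= phi x) -> P phi.
  move=> [mphi [K phiK]] phi0.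
  have mphi' : measurable_fun setT (EFin \o phi) by exact/measurable_EFinP.
  have phi0' t : setT t -> (0 <= (phi t)%:E)%E by rewrite lee_fin.
  pose g := nnsfun_approx measurableT mphi'.
  have gle n x : g n x <= phi x.
    by rewrite /g nnsfun_approxE -lee_fin; exact: le_approx.
  have gcvg x : g n x @[n --> \oo] --> phi x.
    have := @cvg_nnsfun_approx _ _ _ _ measurableT _ mphi' phi0' x I.
    by move/fine_cvg.
  apply: (Plim (fun n => g n : S -> R) _ K) => // n x.
  rewrite ger0_norm//; apply: (le_trans (gle n x)).
  by apply: le_trans (phiK x); exact: ler_norm.
move=> phi [mphi [K phiK]].
have P1T : P (cst 1) by rewrite -indicT; exact: P1.
rewrite (_ : phi = (fun x => (- K) * 1 + (phi x + K))); last by apply/funext => x; ring.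
have m1 : measurable_fun setT (fun x => phi x + K) by exact: measurable_funD.
have b1 : bmf (fun x => phi x + K).
  split => //; exists (K + K) => x.
  rewrite (le_trans (ler_normD _ _))// lerD// ger0_norm//.
  by apply: le_trans (phiK x).
apply: Plin => //; first exact: bmf_cst.
apply: Pnn => // x; rewrite -lerBlDr sub0r.
by have := phiK x; rewrite ler_norml => /andP[].
Qed.

End BoundedMeasurable.

Section FiniteMeasureBounded.
Context {d : measure_display} {S : measurableType d} {R : realType}.
Variable m : {measure set S -> \bar R}.
Hypothesis mfin : (m setT < +oo)%E.

Lemma bmf_integrable (phi : S -> R) : bmf phi -> m.-integrable setT (EFin \o phi).
Proof.
move=> [mphi [K hK]]; apply: measurable_bounded_integrable => //.
exists `|K|; split; first exact: num_real.
by move=> x Kx y _; apply: (le_trans (hK y)); apply: ltW; apply: le_lt_trans Kx; exact: ler_norm.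
Qed.

Lemma bmf_Rintegral_cvg (phi_ : nat -> S -> R) (phi : S -> R) (K : R) :
  (forall n, measurable_fun setT (phi_ n)) -> measurable_fun setT phi ->
  (forall n x, `|phi_ n x| <= K) ->
  (forall x, phi_ n x @[n --> \oo] --> phi x) ->
  \int[m]_x phi_ n x @[n --> \oo] --> \int[m]_x phi x.
Proof.
move=> mn mphi hn hc; rewrite /Rintegral; apply: fine_cvg.
have iK : m.-integrable setT (cst K%:E).
  exact: (bmf_integrable (bmf_cst K)).
have [||||| i1 _ i2] := @dominated_convergence _ _ _ m setT measurableT
  (fun n x => (phi_ n x)%:E) (fun x => (phi x)%:E) (cst K%:E).
- by move=> n; apply/measurable_EFinP.
- exact/measurable_EFinP.
- by apply: aeW => x _; apply: cvg_EFin; [exact: nearW|exact: hc].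
- exact: iK.
- by apply: aeW => x n _; rewrite lee_fin.
- by rewrite fineK//; exact: integrable_fin_num.
Qed.

End FiniteMeasureBounded.

(** * The calculus of bounded Borel symbols attached to a resolution of the identity *)

Section SpectralCalculus.
Context {d : measure_display} {T : measurableType d} {R : realType}.
Variable mu : {measure set T -> \bar R}.
Variable E : spectral_measure mu.
Implicit Types f g h : L2 mu.
Local Notation MR := (measurableTypeR R).
Implicit Types phi psi : MR -> R.

Lemma sproj_rin (A : set MR) f g : measurable A -> rin (sproj E A f) g = rin f (sproj E A g).
Proof. by move=> mA; have := sproj_adj E mA f g; rewrite !L2_innerE => -[]. Qed.

Lemma sscal_rin (A : set MR) f : measurable A -> sscal E f A = (rin (sproj E A f) f)%:E.
Proof. by move=> mA; rewrite sscalE// L2_innerE. Qed.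

Lemma sscal_setT f : sscal E f setT = (nsq f)%:E.
Proof. by rewrite sscal_rin// sprojT. Qed.

Lemma sscal_fin f : (sscal E f setT < +oo)%E.
Proof. by rewrite sscal_setT ltry. Qed.

Lemma sprojDl (A : set MR) (a : R[i]) f g : measurable A ->
  sproj E A (a *: f + g) = a *: sproj E A f + sproj E A g.
Proof. by move=> mA; exact: sproj_linear. Qed.

Lemma sprojD (A : set MR) f g : measurable A ->
  sproj E A (f + g) = sproj E A f + sproj E A g.
Proof. by move=> mA; have := sprojDl 1 f g mA; rewrite !scale1r. Qed.

Lemma sproj0 (A : set MR) : measurable A -> sproj E A 0 = 0.
Proof. by move=> mA; have := sprojDl (-1) 0 0 mA; rewrite scaler0 addr0 scaleN1r addNr. Qed.

Lemma sprojZ (A : set MR) (a : R[i]) f : measurable A -> sproj E A (a *: f) = a *: sproj E A f.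
Proof. by move=> mA; have := sprojDl a f 0 mA; rewrite !addr0 sproj0// addr0. Qed.

Lemma sprojN (A : set MR) f : measurable A -> sproj E A (- f) = - sproj E A f.
Proof. by move=> mA; rewrite -scaleN1r sprojZ// scaleN1r. Qed.

Definition sint phi f : R := \int[sscal E f]_x phi x.

(** Real polarization: the integral of [phi] against the signed measure Re <E(.) f, g>. The complex
    four-term polarization [spectral_form] consists of two such forms. *)
Definition bform phi f g : R := 4^-1 * (sint phi (f + g) - sint phi (f - g)).

Lemma spectral_formE phi f g :
  spectral_form E phi f g = bform phi f g +i* bform phi f ('i%C *: g).
Proof.
rewrite /spectral_form !big_ord_recr big_ord0/= add0r expr0 expr1 scale1r mul1r.
rewrite expr2 ii_N1 exprS expr2 ii_N1 mulrN1 !scaleN1r scaleNr mulN1r mulNr.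
rewrite -!/(sint _ _) /bform.
set a := sint _ _; set b := sint _ _; set c := sint _ _; set e := sint _ _.
have -> : (4%:R^-1 : R[i]) = (4^-1)%:C by rewrite fmorphV rmorph_nat.
apply/eqP; rewrite eq_complex/=; apply/andP; split; apply/eqP; ring.
Qed.

Lemma inner_formP phi h f g : L2_inner h g = spectral_form E phi f g <->
  rin h g = bform phi f g /\ rin h ('i%C *: g) = bform phi f ('i%C *: g).
Proof.
by rewrite spectral_formE L2_innerE; split=> [[]|[-> ->]].
Qed.

(** Linearity and continuity under bounded pointwise convergence. A functional with both properties
    is determined by its values on indicators, so that identities between spectral integrals reduce
    to the axioms of the projections ([gfun_eq]). *)
Definition gfun (F : (MR -> R) -> R) : Prop :=
  (forall a phi psi, bmf phi -> bmf psi -> F (fun x => a * phi x + psi x) = a * F phi + F psi) /\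
  (forall (phi_ : nat -> MR -> R) (phi : MR -> R) (K : R),
    (forall n, measurable_fun setT (phi_ n)) ->
    measurable_fun setT phi ->
    (forall n x, `|phi_ n x| <= K) -> (forall x, `|phi x| <= K) ->
    (forall x, phi_ n x @[n --> \oo] --> phi x) -> F (phi_ n) @[n --> \oo] --> F phi).

Lemma gfun_eq F G : gfun F -> gfun G -> (forall A, measurable A -> F \1_A = G \1_A) ->
  forall phi, bmf phi -> F phi = G phi.
Proof.
move=> [Fl Fc] [Gl Gc] FG; apply: bmf_ind => //.
  by move=> a phi psi b1 b2 e1 e2; rewrite Fl// Gl// e1 e2.
move=> phi_ phi K m1 m2 h1 h2 hc eq.
have /cvg_lim <- // := Fc _ _ _ m1 m2 h1 h2 hc.
apply/cvg_lim => //; rewrite (_ : (fun _ => _) = G \o phi_); last exact/funext.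
exact: Gc hc.
Qed.

Lemma gfunD F G : gfun F -> gfun G -> gfun (fun phi => F phi + G phi).
Proof.
move=> [Fl Fc] [Gl Gc]; split=> [a phi psi b1 b2|phi_ phi K m1 m2 h1 h2 hc].
  by rewrite Fl// Gl//; ring.
by apply: cvgD; [apply: Fc hc|apply: Gc hc].
Qed.

Lemma gfunZ (c : R) F : gfun F -> gfun (fun phi => c * F phi).
Proof.
move=> [Fl Fc]; split=> [a phi psi b1 b2|phi_ phi K m1 m2 h1 h2 hc].
  by rewrite Fl//; ring.
by apply: cvgMl_tmp; apply: Fc hc.
Qed.

Lemma gfunM F psi : bmf psi -> gfun F -> gfun (fun phi => F (fun x => phi x * psi x)).
Proof.
move=> bp [Fl Fc]; split=> [a phi1 phi2 b1 b2|phi_ phi K m1 m2 h1 h2 hc].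
  rewrite -Fl; [|exact: bmf_mul..].
  by congr F; apply/funext => x; ring.
have [mp [M hM]] := bp.
apply: (Fc _ _ (K * M)).
- by move=> n; apply: measurable_funM.
- by apply: measurable_funM.
- by move=> n x; rewrite normrM ler_pM.
- by move=> x; rewrite normrM ler_pM.
- by move=> x; apply: cvgMr_tmp; exact: hc.
Qed.

Lemma gfun_sint f : gfun (fun phi => sint phi f).
Proof.
have fin := sscal_fin f.
split=> [a phi psi b1 b2|phi_ phi K m1 m2 h1 h2 hc].
  rewrite /sint RintegralD//; last 2 first.
  - exact: (integrableZl measurableT a (bmf_integrable fin b1)).
  - exact: bmf_integrable.
  by rewrite RintegralZl//; exact: (bmf_integrable fin b1).
exact: (bmf_Rintegral_cvg fin m1 m2 h1 hc).
Qed.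

Lemma gfun_bform f g : gfun (fun phi => bform phi f g).
Proof.
apply: gfunZ; apply: gfunD; first exact: gfun_sint.
have := gfunZ (-1) (gfun_sint (f - g)).
by under eq_fun do rewrite mulN1r.
Qed.

Lemma sint_sqr_cvg0 (phi_ : nat -> MR -> R) (phi : MR -> R) K f :
  (forall n, measurable_fun setT (phi_ n)) -> measurable_fun setT phi ->
  (forall n x, `|phi_ n x| <= K) -> (forall x, `|phi x| <= K) ->
  (forall x, phi_ n x @[n --> \oo] --> phi x) ->
  sint (fun x => (phi_ n x - phi x) ^+ 2) f @[n --> \oo] --> 0.
Proof.
move=> m1 m2 h1 h2 hc.
have <- : sint (fun x => (phi x - phi x) ^+ 2) f = 0.
  rewrite /sint; under eq_Rintegral do rewrite subrr expr0n/=.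
  by rewrite /Rintegral integral0.
apply: ((gfun_sint f).2 _ _ ((K + K) ^+ 2)).
- by move=> n; apply: measurable_funX; exact: measurable_funB.
- by apply: measurable_funX; exact: measurable_funB.
- move=> n x; rewrite normrX lerXn2r ?nnegrE//.
    by rewrite addr_ge0// (le_trans _ (h2 x)).
  by apply: (le_trans (ler_normB _ _)); rewrite lerD.
- by move=> x; rewrite subrr expr0n/= normr0 sqr_ge0.
- move=> x; rewrite !expr2; under eq_fun do rewrite expr2.
  by apply: cvgM; apply: cvgB => //; exact: cvg_cst.
Qed.

Lemma sint_indic (A : set MR) f : measurable A -> sint \1_A f = rin (sproj E A f) f.
Proof.
by move=> mA; rewrite /sint /Rintegral integral_indic// setIT sscal_rin.
Qed.

Lemma bform_indic (A : set MR) f g : measurable A -> bform \1_A f g = rin (sproj E A f) g.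
Proof.
move=> mA; rewrite /bform !sint_indic// !sprojD// sprojN//.
rewrite !(rinDl, rinDr, rinNl, rinNr) (sproj_rin g f)// (rinC g).
by field.
Qed.

Lemma bform_diag phi f : bmf phi -> bform phi f f = sint phi f.
Proof.
move: phi; apply: gfun_eq; [exact: gfun_bform|exact: gfun_sint|].
by move=> A mA; rewrite bform_indic// sint_indic.
Qed.

Lemma bformC phi f g : bmf phi -> bform phi f g = bform phi g f.
Proof.
move: phi; apply: gfun_eq; [exact: gfun_bform..|].
by move=> A mA; rewrite !bform_indic// sproj_rin// rinC.
Qed.

Lemma bform_lin phi (a : R[i]) f h g : bmf phi -> bform phi (a *: f + h) g =
  complex.Re a * bform phi f g + complex.Im a * bform phi ('i%C *: f) g + bform phi h g.
Proof.
move: phi; apply: gfun_eq; first exact: gfun_bform.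
  by apply: gfunD; [apply: gfunD; apply: gfunZ|]; exact: gfun_bform.
by move=> A mA; rewrite !bform_indic// sprojDl// rinDl rinZl sprojZ.
Qed.

Lemma bform_il phi f g : bmf phi -> bform phi ('i%C *: f) g = - bform phi f ('i%C *: g).
Proof.
move=> bp; rewrite -mulN1r; move: phi bp; apply: gfun_eq; first exact: gfun_bform.
  by apply: gfunZ; exact: gfun_bform.
by move=> A mA; rewrite !bform_indic// sprojZ// rin_il mulN1r.
Qed.

Lemma indicM (A B : set MR) : (fun x => \1_A x * \1_B x : R) = \1_(A `&` B).
Proof. by rewrite indicI. Qed.

Lemma bform_proj psi (A : set MR) f g : measurable A -> bmf psi ->
  bform psi (sproj E A f) g = bform (fun x => psi x * \1_A x) f g.
Proof.
move=> mA; move: psi; apply: gfun_eq; first exact: gfun_bform.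
  by apply: (@gfunM (fun phi => bform phi f g)); [exact: bmf_indic|exact: gfun_bform].
move=> B mB; rewrite indicM !bform_indic//; last exact: measurableI.
by rewrite sprojI.
Qed.

(** A weak description of phi(L) through real parts only; complex linearity of [U] is a consequence
    ([reps_linear]). *)
Definition reps phi (U : L2 mu -> L2 mu) : Prop := forall f g, rin (U f) g = bform phi f g.

Lemma reps_linear phi U : bmf phi -> reps phi U -> linear U.
Proof.
move=> bp rU a f h; apply: rin_ext => g.
by rewrite rU bform_lin// rinDl rinZl !rU rin_il rU bform_il.
Qed.

(** Multiplicativity of the calculus. If [phi] is an indicator, the projection is moved onto [g],
    where symmetry of the form and [bform_proj] turn it into a factor of the symbol. *)
Lemma reps_comp phi psi U f g : bmf phi -> bmf psi -> reps psi U ->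
  bform phi (U f) g = bform (fun x => phi x * psi x) f g.
Proof.
move=> bphi bpsi rU; move: phi bphi; apply: gfun_eq; first exact: gfun_bform.
  by apply: (@gfunM (fun phi => bform phi f g)) => //; exact: gfun_bform.
move=> A mA; rewrite bform_indic// sproj_rin// rU bformC// bform_proj// bformC.
  by congr bform; apply/funext => x; rewrite mulrC.
by apply: bmf_mul => //; exact: bmf_indic.
Qed.

Lemma reps_nsq psi U f : bmf psi -> reps psi U -> nsq (U f) = sint (fun x => psi x ^+ 2) f.
Proof.
move=> bpsi rU; rewrite /nsq rU bformC// (reps_comp _ _ bpsi bpsi)// bform_diag//.
exact: bmf_mul.
Qed.

(** At a bounded limit of symbols, [reps_nsq] converts the distance of [U m f] and [U n f] into the
    integral of [(phi_ m - phi_ n) ^+ 2]. The vectors thus form a Cauchy sequence, and the form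
    passes to the limit. *)
Lemma reps_exists phi : bmf phi -> exists U, reps phi U.
Proof.
move: phi; apply: bmf_ind.
- by move=> A mA; exists (sproj E A) => f g; rewrite bform_indic.
- move=> a phi psi b1 b2 [U rU] [V rV]; exists (fun f => a%:C *: U f + V f) => f g.
  by rewrite rinDl rinZRl rU rV (gfun_bform f g).1.
- move=> phi_ phi K m1 m2 h1 h2 hc /choice[U rU].
  have bn n : bmf (phi_ n) by split => //; exists K.
  have bp : bmf phi by split => //; exists K.
  suff /choice[V VP] : forall f, exists h, L2_lim (U ^~ f) h.
    exists V => f g; have := L2_lim_rin (g := g) (VP f).
    move=> /cvg_lim <- //; apply/cvg_lim => //.
    rewrite (_ : (fun _ => _) = (fun n => bform (phi_ n) f g)); last first.
      by apply/funext => n; rewrite rU.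
    exact: (gfun_bform f g).2 hc.
  move=> f; apply: L2_complete => e e0.
  have := sint_sqr_cvg0 f m1 m2 h1 h2 hc.
  move=> /cvgrPdist_le/(_ (e / 4)); rewrite divr_gt0// => /(_ isT)[N _ NP].
  exists N => m n Nm Nn.
  have rB : reps (fun x => phi_ m x - phi_ n x) (fun f => U m f - U n f).
    move=> f1 g1; rewrite rinBl !rU.
    have := (gfun_bform f1 g1).1 (-1) _ _ (bn n) (bn m).
    rewrite mulN1r addrC => <-; congr bform; apply/funext => x; ring.
  rewrite (reps_nsq _ (bmf_sub (bn m) (bn n)) rB).
  have sq2 (k : nat) : bmf (fun x => (phi_ k x - phi x) ^+ 2).
    by apply: bmf_mul; exact: bmf_sub.
  apply: (@le_trans _ _ (2 * sint (fun x => (phi_ m x - phi x) ^+ 2) f +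
                         2 * sint (fun x => (phi_ n x - phi x) ^+ 2) f)).
    have l0 : sint (fun=> 0) f = 0 by rewrite /sint /Rintegral integral0.
    have bz : bmf (fun _ : MR => 0 : R) by exact: bmf_cst.
    have e1 : 2 * sint (fun x => (phi_ n x - phi x) ^+ 2) f =
        sint (fun x => 2 * (phi_ n x - phi x) ^+ 2 + 0) f.
      by rewrite (gfun_sint f).1// l0 addr0.
    rewrite e1 -(gfun_sint f).1//; last exact: bmf_lin.
    apply: le_Rintegral => //.
    + apply: (bmf_integrable (sscal_fin f)); apply: bmf_mul; exact: bmf_sub.
    + by apply: (bmf_integrable (sscal_fin f)); apply: bmf_lin => //; exact: bmf_lin.
    + move=> x _; have := sqr_ge0 ((phi_ m x - phi x) + (phi_ n x - phi x)).
      rewrite addr0; nra.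
  have := NP m Nm; have := NP n Nn.
  rewrite !sub0r !normrN => k1 k2.
  have l1 := le_trans (ler_norm _) k1; have l2 := le_trans (ler_norm _) k2.
  by move: l1 l2; lra.
Qed.

(* phi(L), for bounded Borel phi. *)
Definition fcalc phi : L2 mu -> L2 mu :=
  xget (fun=> 0) [set U | reps phi U].

Lemma fcalcP phi : bmf phi -> reps phi (fcalc phi).
Proof.
move=> /reps_exists[U rU]; rewrite /fcalc.
by case: xgetP => [V -> //|/(_ U)]; case.
Qed.

Lemma fcalcE phi f g : bmf phi -> rin (fcalc phi f) g = bform phi f g.
Proof. by move=> /fcalcP; exact. Qed.

Lemma fcalc_linear phi : bmf phi -> linear (fcalc phi).
Proof. by move=> bp; apply: reps_linear (fcalcP bp). Qed.

Lemma fcalc_nsq phi f : bmf phi -> nsq (fcalc phi f) = sint (fun x => phi x ^+ 2) f.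
Proof. by move=> bp; apply: reps_nsq => //; exact: fcalcP. Qed.

Lemma fcalc_comp phi psi f : bmf phi -> bmf psi ->
  fcalc phi (fcalc psi f) = fcalc (fun x => phi x * psi x) f.
Proof.
move=> b1 b2; apply: rin_ext => g.
rewrite fcalcE// (reps_comp _ _ b1 b2 (fcalcP b2)) fcalcE//.
exact: bmf_mul.
Qed.

Lemma fcalc_lin (a : R) phi psi f : bmf phi -> bmf psi ->
  fcalc (fun x => a * phi x + psi x) f = a%:C *: fcalc phi f + fcalc psi f.
Proof.
move=> b1 b2; apply: rin_ext => g.
by rewrite rinDl rinZRl !fcalcE//; [exact: (gfun_bform f g).1|exact: bmf_lin].
Qed.

Lemma fcalcB phi psi f : bmf phi -> bmf psi ->
  fcalc (fun x => phi x - psi x) f = fcalc phi f - fcalc psi f.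
Proof.
move=> b1 b2; rewrite scaleN1L addrC -fcalc_lin//; congr fcalc.
by apply/funext => x; ring.
Qed.

Lemma fcalc1 f : fcalc (fun=> 1) f = f.
Proof.
apply: rin_ext => g; rewrite fcalcE; last exact: bmf_cst.
by rewrite -[fun=> 1]/(cst 1) -indicT bform_indic// sprojT.
Qed.

Lemma fcalc_cvg (phi_ : nat -> MR -> R) phi K f :
  (forall n, measurable_fun setT (phi_ n)) -> measurable_fun setT phi ->
  (forall n x, `|phi_ n x| <= K) -> (forall x, `|phi x| <= K) ->
  (forall x, phi_ n x @[n --> \oo] --> phi x) ->
  L2_lim (fun n => fcalc (phi_ n) f) (fcalc phi f).
Proof.
move=> m1 m2 h1 h2 hc.
have bn n : bmf (phi_ n) by split => //; exists K.
have bp : bmf phi by split => //; exists K.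
rewrite /L2_lim; under eq_fun do rewrite -fcalcB//.
rewrite (_ : (fun _ => _) = (fun n => sint (fun x => (phi_ n x - phi x) ^+ 2) f)).
  exact: sint_sqr_cvg0 hc.
by apply/funext => n; rewrite fcalc_nsq//; exact: bmf_sub.
Qed.

Lemma fcalc_cst0 f : fcalc (fun=> 0) f = 0.
Proof.
have b1 : bmf ((fun=> 1) : MR -> R) by exact: bmf_cst.
rewrite -[RHS](subrr (fcalc (fun=> 1) f)) -fcalcB//; congr fcalc.
by apply/funext => x; rewrite subrr.
Qed.

Lemma fcalc_scale (a : R) phi f : bmf phi -> fcalc (fun x => a * phi x) f = a%:C *: fcalc phi f.
Proof.
move=> bp; rewrite -[RHS]addr0 -{1}(fcalc_cst0 f) -fcalc_lin//; last exact: bmf_cst.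
by congr fcalc; apply/funext => x; rewrite addr0.
Qed.

Lemma fcalc_avg phi psi f : bmf phi -> bmf psi ->
  fcalc (fun x => (phi x + psi x) / 2) f = (2^-1)%:C *: (fcalc phi f + fcalc psi f).
Proof.
move=> b1 b2; rewrite -[X in _ *: (X + _)]scale1r -(rmorph1 (real_complex R)) -fcalc_lin//.
rewrite -fcalc_scale; last exact: bmf_lin.
by congr fcalc; apply/funext => x; rewrite mul1r mulrC.
Qed.

Lemma fcalcD phi f g : bmf phi ->
  fcalc phi (f + g) = fcalc phi f + fcalc phi g.
Proof. by move=> bp; rewrite -[f]scale1r fcalc_linear// !scale1r. Qed.

Lemma fcalcZ phi a f : bmf phi -> fcalc phi (a *: f) = a *: fcalc phi f.
Proof.
move=> bp; have f0 : fcalc phi 0 = 0.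
  by apply: (@addrI _ (fcalc phi 0)); rewrite -fcalcD// !addr0.
by rewrite -[a *: f]addr0 fcalc_linear// f0 addr0.
Qed.

Lemma fcalc_subr phi f g : bmf phi ->
  fcalc phi (f - g) = fcalc phi f - fcalc phi g.
Proof. by move=> bp; rewrite -scaleN1r fcalcD// fcalcZ// scaleN1r. Qed.

Lemma fcalc_nsq_le phi f : bmf phi -> (forall x, `|phi x| <= 1) ->
  nsq (fcalc phi f) <= nsq f.
Proof.
move=> bp p1; rewrite -{2}(fcalc1 f) !fcalc_nsq//; last exact: bmf_cst.
apply: le_Rintegral => //.
- exact: (bmf_integrable (sscal_fin f) (bmf_mul bp bp)).
- exact: (bmf_integrable (sscal_fin f) (bmf_cst _)).
- by move=> x _; rewrite expr1n -real_normK ?num_real// exprn_ile1.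
Qed.

End SpectralCalculus.

(** * The operator L, positivity of its spectrum, and the symbols of its semigroups *)

Section OperatorCalculus.
Context {d : measure_display} {T : measurableType d} {R : realType}.
Variable mu : {measure set T -> \bar R}.
Variables (L : unbounded_operator mu) (E : spectral_measure mu).
Hypothesis L_sa : self_adjoint L.
Hypothesis L_ge0 : nonnegative_operator L.
Hypothesis E_L : is_spectral_resolution E L.
Implicit Types f g h : L2 mu.
Local Notation MR := (measurableTypeR R).
Implicit Types phi psi : MR -> R.

Lemma L2_normE f : L2_norm f = Num.sqrt (nsq f).
Proof.
rewrite /L2_norm /nsq /rin; congr (Num.sqrt _).
by apply: eq_Rintegral => x _; rewrite cabs2E /sqa !expr2.
Qed.

Lemma dense_orth h : (forall g, udom L g -> rin h g = 0) -> h = 0.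
Proof.
move=> hg; apply: rin_eq0; apply/eqP; rewrite eq_le rin_ge0 andbT.
apply/ler_addgt0Pr => e e0; rewrite add0r.
have se0 : 0 < Num.sqrt (e / 4) by rewrite sqrtr_gt0 divr_gt0.
have [g Lg hge] := L_sa.1 h _ se0.
have : nsq (h - g) < e / 4.
  by move: hge; rewrite L2_normE ltr_sqrt// divr_gt0.
have h2 : (0 : R) < 2^-1 by rewrite invr_gt0.
(* With weight 1/2, the square norm of [h] is at most half of itself plus [2 * nsq (h - g)], and
   [nsq (h - g) < e / 4]. *)
have := rin_le h (h - g) h2; rewrite rinBr (hg g Lg) subr0 invrK -/(nsq h) ger0_norm ?nsq_ge0//.
by lra.
Qed.

Lemma measurable_idMR : measurable_fun setT (fun x : MR => x : R).
Proof. exact: measurable_id. Qed.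

Definition cutoff (n : nat) : set MR := `[- n%:R, n%:R]%classic.

(** The symbol of L cut to a bounded interval; the unbounded operator is reached as a limit of these
    bounded ones. *)
Definition idcut (n : nat) : MR -> R := fun x => x * \1_(cutoff n) x.

Lemma measurable_cutoff n : measurable (cutoff n : set MR).
Proof. exact: measurable_itv. Qed.

Lemma idcut_bound n x : `|idcut n x| <= n%:R.
Proof.
rewrite /idcut indicE; case: (boolP (x \in _)) => [|_]; last by rewrite mulr0 normr0.
by rewrite mulr1 inE /cutoff/= in_itv/= ler_norml.
Qed.

Lemma measurable_idcut n : measurable_fun setT (idcut n).
Proof.
apply: measurable_funM; first exact: measurable_idMR.
by apply: measurable_indic; exact: measurable_cutoff.
Qed.

Lemma bmf_idcut n : bmf (idcut n).
Proof. by split; [exact: measurable_idcut|exists n%:R => x; exact: idcut_bound]. Qed.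

Lemma idcut_le n (x : R) : `|idcut n x| <= `|x|.
Proof.
rewrite /idcut indicE; case: (_ \in _); rewrite ?mulr1// mulr0 normr0//.
Qed.

Lemma ler_normM2r (a b c : R) : `|a| <= `|b| -> `|a * c| <= `|b * c|.
Proof. by move=> ab; rewrite !normrM ler_wpM2r. Qed.

Lemma idcut_near (x : R) : \forall n \near \oo, idcut n x = x.
Proof.
exists (Num.truncn `|x|).+1 => // n /= Nn; rewrite /idcut indicE mem_set ?mulr1//.
rewrite /cutoff/= in_itv/= -ler_norml.
by apply: ltW; apply: (lt_le_trans (truncnS_gt _)); rewrite ler_nat.
Qed.

Lemma idcut_cvg (x : R) : idcut n x @[n --> \oo] --> x.
Proof. by apply: cvg_near_cst; exact: idcut_near. Qed.

Lemma sint_idcut_cvg f : udom L f -> sint E (idcut n) f @[n --> \oo] --> sint E id f.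
Proof.
rewrite E_L.1 => /= fd; rewrite /sint /Rintegral; apply: fine_cvg.
(* The dominating function: [|x| <= 1 + x ^+ 2], integrable because the measure is finite and [f]
   lies in the domain. *)
have i1 : (sscal E f).-integrable setT (fun x : MR => (1 + x ^+ 2)%:E).
  under eq_fun do rewrite EFinD.
  apply: integrableD => //=.
    exact: (bmf_integrable (sscal_fin E f) (bmf_cst 1)).
  apply/integrableP; split.
    by apply/measurable_EFinP; apply: measurable_funX; exact: measurable_idMR.
  apply: le_lt_trans fd; rewrite le_eqVlt; apply/orP; left; apply/eqP.
  by apply: eq_integral => x _ /=; rewrite ger0_norm// sqr_ge0.
have [||||| i2 _ i3] := @dominated_convergence _ _ _ (sscal E f) setT measurableT
  (fun n x => (idcut n x)%:E) (fun x => x%:E) (fun x => (1 + x ^+ 2)%:E).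
- by move=> n; apply/measurable_EFinP; exact: measurable_idcut.
- by apply/measurable_EFinP; exact: measurable_idMR.
- by apply: aeW => x _; apply: cvg_EFin; [exact: nearW|exact: idcut_cvg].
- exact: i1.
- apply: aeW => x n _; rewrite lee_fin; apply: (le_trans (idcut_le n x)).
  by rewrite ler_norml; have := sqr_ge0 (x - 1); have := sqr_ge0 (x + 1); nra.
- by rewrite fineK//; exact: integrable_fin_num.
Qed.

Lemma udom_add f g : udom L f -> udom L g -> udom L (f + g).
Proof. by move=> fd gd; have := udomP 1 fd gd; rewrite scale1r. Qed.

Lemma udom_scale (a : R[i]) f : udom L f -> udom L (a *: f).
Proof. by move=> fd; have := udomP a fd (udom0 L); rewrite addr0. Qed.

(** [spectral_apply] selects some vector with the prescribed inner products against the domain. The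
    limit [h] is such a vector, and density of the domain leaves no other. *)
Lemma L_lim f h : udom L f -> L2_lim (fun n => fcalc E (idcut n) f) h -> L f = h.
Proof.
move=> fd fh; rewrite E_L.2// /spectral_apply.
have key g : udom L g -> rin h g = bform E id f g.
  move=> gd; have /cvg_lim <- // := L2_lim_rin (g := g) fh.
  apply/cvg_lim => //; under eq_fun do rewrite (fcalcE _ _ _ (bmf_idcut _)).
  apply: cvgMl_tmp; apply: cvgB; apply: sint_idcut_cvg.
    exact: udom_add.
  by rewrite -scaleN1r; apply: udom_add => //; exact: udom_scale.
have hS : [set h' | forall g, spectral_dom E id g -> L2_inner h' g = spectral_form E id f g] h.
  move=> g /=; rewrite -E_L.1 => gd; apply/inner_formP.
  by split; apply: key => //; exact: udom_scale.
case: xgetP => [k _ /= kS|/(_ h)]; last by case.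
apply/eqP; rewrite -subr_eq0; apply/eqP; apply: dense_orth => g gd.
have gd' : spectral_dom E id g by rewrite -E_L.1.
have := kS _ gd'; have := hS _ gd'; rewrite /= !inner_formP => -[h1 _] [h2 _].
by rewrite rinBl h1 h2 subrr.
Qed.

(** The second moment of the spectral measure of psi(L) f is the integral of [(x * psi x) ^+ 2]
    against that of [f], hence at most [K ^+ 2 * nsq f]; Fatou's lemma on the truncations makes this
    rigorous and places the vector in the domain. *)
Lemma L_fcalc psi (K : R) f : bmf psi -> (forall x, `|x * psi x| <= K) ->
  udom L (fcalc E psi f) /\ L (fcalc E psi f) = fcalc E (fun x => x * psi x) f.
Proof.
move=> bp hK; have [mp _] := bp.
have fd : udom L (fcalc E psi f).
  rewrite E_L.1 /spectral_dom/=.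
  apply: (@le_lt_trans _ _ (K ^+ 2 * nsq f)%:E); last exact: ltry.
  apply: (@fatou_le _ _ _ _ _ (fun n x => ((idcut n x) ^+ 2)%:E)) => //.
  - by move=> n; apply/measurable_EFinP; apply: measurable_funX; exact: measurable_idcut.
  - by apply/measurable_EFinP; apply: measurable_funX; exact: measurable_idMR.
  - by move=> n x _; rewrite lee_fin sqr_ge0.
  - by move=> x _; rewrite lee_fin sqr_ge0.
  - apply: aeW => x _; apply: cvg_near_cst.
    by apply: filterS (idcut_near x) => n ->.
  - apply: nearW => n.
    have b2 : bmf (fun x => idcut n x ^+ 2) by apply: bmf_mul; exact: bmf_idcut.
    have := integrable_fin_num measurableT (bmf_integrable (sscal_fin E (fcalc E psi f)) b2).
    move=> /fineK <-; rewrite lee_fin.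
    change (sint E (fun x => idcut n x ^+ 2) (fcalc E psi f) <= K ^+ 2 * nsq f).
    rewrite -bform_diag//.
    rewrite (reps_comp _ _ b2 bp (fcalcP E bp)) bformC; last exact: bmf_mul.
    rewrite (reps_comp _ _ (bmf_mul b2 bp) bp (fcalcP E bp)).
    have b3 := bmf_mul (bmf_mul b2 bp) bp.
    rewrite bform_diag//.
    have -> : K ^+ 2 * nsq f = sint E (fun=> K ^+ 2) f.
      rewrite /sint Rintegral_cst// sscal_setT//=.
    apply: le_Rintegral => //.
    + exact: (bmf_integrable (sscal_fin E f) b3).
    + exact: (bmf_integrable (sscal_fin E f) (bmf_cst _)).
    + move=> x _; rewrite (_ : _ * _ = (idcut n x * psi x) ^+ 2); last by ring.
      rewrite -[leLHS]real_normK ?num_real// lerXn2r ?nnegrE//.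
        by apply: le_trans (hK x).
      by apply: le_trans (hK x); exact/ler_normM2r/idcut_le.
split => //; apply: L_lim => //.
under [X in L2_lim X]eq_fun do rewrite (fcalc_comp _ _ (bmf_idcut _) bp).
apply: (@fcalc_cvg _ _ _ _ _ _ _ K) => //.
- by move=> n; apply: measurable_funM => //; exact: measurable_idcut.
- by apply: measurable_funM => //; exact: measurable_idMR.
- by move=> n x; apply: le_trans (hK x); exact/ler_normM2r/idcut_le.
- by move=> x; apply: cvgMr_tmp; exact: idcut_cvg.
Qed.

Lemma Re_ge0 (z : R[i]) : 0 <= z -> 0 <= complex.Re z.
Proof. by rewrite lecE/= => /andP[]. Qed.

(** Let g = E(A)f with A a compact interval of negative numbers. Then <Lg, g> is at most a negative
    multiple of the mass of A, so positivity of L annihilates that mass. Countably many such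
    intervals exhaust the negative half-line. *)
Lemma spectrum_ge0 f : sscal E f `]-oo, 0[%classic = 0%E.
Proof.
pose A n : set MR := `[- n.+1%:R, - n.+1%:R^-1]%classic.
have mA n : measurable (A n) by exact: measurable_itv.
have A0 n : sscal E f (A n) = 0%E.
  have b1 := bmf_indic (R := R) (mA n).
  have hK x : `|x * \1_(A n) x| <= n.+1%:R.
    rewrite indicE; case: (boolP (x \in _)) => [|_]; last by rewrite mulr0 normr0.
    rewrite mulr1 inE /A/= in_itv/= => /andP[h1 h2]; rewrite ler_norml h1/=.
    by apply: (le_trans h2); apply: (@le_trans _ _ 0); rewrite ?oppr_le0 ?invr_ge0.
  have [gd Lg] := L_fcalc f b1 hK.
  have /Re_ge0 := L_ge0 gd.
  have b2 : bmf (fun x : MR => x * \1_(A n) x : R).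
    split; last by exists n.+1%:R.
    by apply: measurable_funM; [exact: measurable_idMR|exact: measurable_indic].
  rewrite L2_innerE/= Lg fcalcE// bformC// (reps_comp _ _ b2 b1 (fcalcP E b1)).
  have b3 := bmf_mul b2 b1.
  rewrite bform_diag// => h.
  have : sint E (fun x => x * \1_(A n) x * \1_(A n) x) f <=
         sint E (fun x => (- n.+1%:R^-1) * \1_(A n) x + 0) f.
    apply: le_Rintegral => //.
    - exact: (bmf_integrable (sscal_fin E f) b3).
    - exact: (bmf_integrable (sscal_fin E f) (bmf_lin _ b1 (bmf_cst 0))).
    - move=> x _; rewrite addr0 -mulrA -expr2 indicE; case: (boolP (x \in _)) => [|_].
        by rewrite expr1n !mulr1 inE /A/= in_itv/= => /andP[].
      by rewrite expr0n/= !mulr0.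
  rewrite (gfun_sint E f).1//; last exact: bmf_cst.
  rewrite [sint _ (fun=> 0) _](_ : _ = 0); last by rewrite /sint /Rintegral integral0.
  rewrite addr0 sint_indic// => /(le_trans h).
  rewrite mulNr oppr_ge0 pmulr_rle0 ?invr_gt0// => h2.
  apply/eqP; rewrite eq_le measure_ge0 andbT sscal_rin// lee_fin.
have : (sscal E f).-negligible (\bigcup_n A n).
  by apply: negligible_bigcup => n; exists (A n); split.
move=> [B [mB B0 sB]]; apply/eqP; rewrite eq_le measure_ge0 andbT -B0.
apply: le_measure; rewrite ?inE//.
apply: subset_trans sB => x /=; rewrite in_itv/= => x0.
(* The index has to exceed both [- x] and its inverse, for the two ends of the interval. *)
exists (Num.truncn (Num.max (- x) (- x)^-1)) => //; rewrite /A/= in_itv/=.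
have := truncnS_gt (Num.max (- x) (- x)^-1); rewrite gt_max => /andP[h1 h2].
rewrite lerNl ltW//= lerNr ltW// invf_plt ?posrE// oppr_gt0//.
Qed.

Lemma spectrum_ae f : {ae sscal E f, forall x : MR, 0 <= x}.
Proof.
exists (`]-oo, 0[%classic : set MR); split; first exact: measurable_itv.
  exact: spectrum_ge0.
by move=> x /= /negP; rewrite -ltNge in_itv.
Qed.

Lemma sint_ae phi psi f : measurable_fun setT phi -> measurable_fun setT psi ->
  (forall x, 0 <= x -> phi x = psi x) -> sint E phi f = sint E psi f.
Proof.
move=> m1 m2 pp; apply: eq_ae_Rintegral => //.
by apply: filterS (spectrum_ae f) => x; exact: pp.
Qed.

Lemma bform_ae phi psi f g : measurable_fun setT phi -> measurable_fun setT psi ->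
  (forall x, 0 <= x -> phi x = psi x) -> bform E phi f g = bform E psi f g.
Proof. by move=> m1 m2 pp; rewrite /bform !(sint_ae _ m1 m2 pp). Qed.

Lemma fcalc_ae phi psi f : bmf phi -> bmf psi ->
  (forall x, 0 <= x -> phi x = psi x) -> fcalc E phi f = fcalc E psi f.
Proof.
move=> b1 b2 pp; apply: rin_ext => g; rewrite !fcalcE//.
by apply: bform_ae => //; [have [] := b1|have [] := b2].
Qed.

(** A symbol may be unbounded on the negative half-line, as the heat symbol is. It is exchanged
    there for a bounded [psi]; its domain is then the whole space, so the inner products determine
    the selected vector. *)
Lemma spectral_applyE phi psi f : measurable_fun setT phi -> bmf psi ->
  (forall x, 0 <= x -> phi x = psi x) -> spectral_apply E phi f = fcalc E psi f.
Proof.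
move=> m1 b2 pp; have [m2 [K hK]] := b2.
have dom g : spectral_dom E phi g.
  rewrite /spectral_dom/=.
  apply: (@le_lt_trans _ _ (\int[sscal E g]_x ((psi x) ^+ 2)%:E)%E).
    rewrite le_eqVlt; apply/orP; left; apply/eqP; apply: ae_eq_integral => //.
    - by apply/measurable_EFinP; apply: measurable_funX.
    - by apply/measurable_EFinP; apply: measurable_funX.
    - by apply: filterS (spectrum_ae g) => x x0 _; rewrite pp.
  exact/integrable_lty/(bmf_integrable (sscal_fin E g))/(bmf_mul b2 b2).
have key k : (forall g, L2_inner k g = spectral_form E phi f g) <-> k = fcalc E psi f.
  split=> [kg|-> g].
    apply: rin_ext => g; have /inner_formP[-> _] := kg g.
    by rewrite fcalcE//; exact: bform_ae.
  by apply/inner_formP; rewrite !fcalcE//; split; apply/esym/bform_ae.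
rewrite /spectral_apply; case: xgetP => [k _ /= kS|/(_ (fcalc E psi f))].
  by apply/key => g; exact: kS.
by case=> /= g _; move: g; apply/key.
Qed.

(** [Num.max x 0] keeps the symbol in [0, 1] on the whole line for nonnegative [t], without changing
    it on [0, +oo), where the spectral measures live. *)
Definition hfun (t : R) : MR -> R := fun x => expR (- t * Num.max x 0).

Lemma measurable_pospart : measurable_fun setT (fun x : MR => Num.max x 0 : R).
Proof. by apply: measurable_maxr => //; exact: measurable_idMR. Qed.

Lemma hfun_bound t x : 0 <= t -> 0 <= hfun t x <= 1.
Proof.
move=> t0; rewrite expR_ge0/= -expR0 ler_expR mulNr oppr_le0 mulr_ge0//.
by rewrite le_max lexx orbT.
Qed.

Lemma measurable_hfun t : measurable_fun setT (hfun t).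
Proof.
apply: measurableT_comp => //; apply: measurable_funM => //.
exact: measurable_pospart.
Qed.

Lemma bmf_hfun t : 0 <= t -> bmf (hfun t).
Proof.
move=> t0; split; first exact: measurable_hfun.
by exists 1 => x; have /andP[h0 h1] := hfun_bound x t0; rewrite ger0_norm.
Qed.

Lemma heatE t f : 0 <= t -> heat E t f = fcalc E (hfun t) f.
Proof.
move=> t0; apply: spectral_applyE; last 2 first.
- exact: bmf_hfun.
- by move=> x x0; rewrite /hfun max_l.
- by apply: measurableT_comp => //; apply: measurable_funM => //; exact: measurable_idMR.
Qed.

Definition pfun (t : R) : MR -> R := fun x => expR (- t * Num.sqrt x).

Lemma bmf_pfun t : 0 <= t -> bmf (pfun t).
Proof.
move=> t0; split.
  apply: measurableT_comp => //; apply: measurable_funM => //.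
  exact: (continuous_measurable_fun (@sqrt_continuous R)).
exists 1 => x; rewrite ger0_norm ?expR_ge0// -expR0 ler_expR mulNr oppr_le0 mulr_ge0//.
Qed.

Lemma poissonE t f : 0 <= t -> poisson E t f = fcalc E (pfun t) f.
Proof.
move=> t0; have bp := bmf_pfun t0.
by apply: spectral_applyE => //; have [] := bp.
Qed.

(* The symbol of t^2 L e^{-t^2 L}. *)
Definition qfun (t : R) : MR -> R := fun x => t ^+ 2 * Num.max x 0 * hfun (t ^+ 2) x.

Lemma qfun_bound t x : 0 <= qfun t x <= 1.
Proof.
have x0 : 0 <= Num.max x 0 by rewrite le_max lexx orbT.
rewrite /qfun /hfun; set u := t ^+ 2 * _.
have u0 : 0 <= u by rewrite mulr_ge0 ?sqr_ge0.
rewrite mulNr -/u expRN mulr_ge0 ?invr_ge0 ?expR_ge0//=.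
rewrite ler_pdivrMr ?expR_gt0// mul1r.
by apply: le_trans (expR_ge1Dx u); rewrite lerDr.
Qed.

Lemma measurable_qfun t : measurable_fun setT (qfun t).
Proof.
apply: measurable_funM; last exact: measurable_hfun.
by apply: measurable_funM => //; exact: measurable_pospart.
Qed.

Lemma bmf_qfun t : bmf (qfun t).
Proof.
split; first exact: measurable_qfun.
by exists 1 => x; have /andP[h0 h1] := qfun_bound t x; rewrite ger0_norm.
Qed.

Lemma L_heatE t f : 0 < t ->
  (t ^+ 2)%:C *: L (heat E (t ^+ 2) f) = fcalc E (qfun t) f.
Proof.
move=> t0; have t20 : 0 < t ^+ 2 by rewrite exprn_gt0.
rewrite heatE ?ltW//.
pose A : set MR := `[0, +oo[%classic.
have mA : measurable A by exact: measurable_itv.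
have bA := bmf_indic (R := R) mA.
(* On negative [x] the symbol [hfun] equals 1, so [x * hfun (t ^+ 2) x] is unbounded there; the
   indicator makes [L_fcalc] applicable. *)
pose psi x := hfun (t ^+ 2) x * \1_A x.
have bpsi : bmf psi by apply: bmf_mul => //; apply: bmf_hfun; exact: ltW.
have psiq x : t ^+ 2 * (x * psi x) = qfun t x.
  rewrite /qfun /psi indicE; case: (boolP (x \in A)) => [|/negP].
    by rewrite inE /A/= in_itv/= andbT => x0; rewrite max_l//; ring.
  rewrite inE /A/= in_itv/= andbT => /negP; rewrite -ltNge => x0.
  by rewrite max_r ?ltW// !mulr0 mul0r.
have hK x : `|x * psi x| <= (t ^+ 2)^-1.
  have -> : x * psi x = (t ^+ 2)^-1 * qfun t x by rewrite -psiq mulKf// gt_eqF.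
  have /andP[q0 q1] := qfun_bound t x.
  have i0 : 0 <= (t ^+ 2)^-1 by rewrite invr_ge0 sqr_ge0.
  by rewrite (ger0_norm (mulr_ge0 i0 q0)); exact: ler_piMr.
have -> : fcalc E (hfun (t ^+ 2)) f = fcalc E psi f.
  apply: fcalc_ae => //; first by apply: bmf_hfun; exact: ltW.
  by move=> x x0; rewrite /psi indicE mem_set ?mulr1// /A/= in_itv/= andbT.
have [_ ->] := L_fcalc f bpsi hK.
have bz : bmf (fun _ : MR => 0 : R) by exact: bmf_cst.
have bx : bmf (fun x : MR => x * psi x : R).
  split; last by exists (t ^+ 2)^-1.
  by apply: measurable_funM; [exact: measurable_idMR|have [] := bpsi].
apply: rin_ext => g; rewrite rinZRl !fcalcE//; last exact: bmf_qfun.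
have := (gfun_bform E f g).1 (t ^+ 2) _ _ bx bz.
rewrite [bform E (fun=> 0) f g](_ : _ = 0); last by rewrite /bform /sint /Rintegral !integral0 subrr mulr0.
by rewrite addr0 => <-; congr bform; apply/funext => x; rewrite addr0 psiq.
Qed.

End OperatorCalculus.

(** * Convex combinations of heat symbols *)

Section ExpMixtures.
Context {R : realType}.
Local Notation MR := (measurableTypeR R).
Implicit Types phi psi : MR -> R.

(* Bounds that are stable under averages and pointwise limits pass from the heat
   symbols to this class, which contains the Poisson symbols. *)
Inductive expmix : (MR -> R) -> Prop :=
| expmix_hfun u : 0 <= u -> expmix (hfun u)
| expmix_avg phi psi : expmix phi -> expmix psi -> expmix (fun x => (phi x + psi x) / 2)
| expmix_lim (phi_ : nat -> MR -> R) phi : (forall n, expmix (phi_ n)) ->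
    (forall x, phi_ n x @[n --> \oo] --> phi x) -> expmix phi.

Lemma expmix1 : expmix (fun=> 1).
Proof.
rewrite (_ : (fun=> 1) = hfun 0); first exact: expmix_hfun.
by apply/funext => x; rewrite /hfun oppr0 mul0r expR0.
Qed.

(** Induction on one factor, then on the other, down to products of two heat symbols, which the
    semigroup law handles. *)
Lemma expmix_mul phi psi : expmix phi -> expmix psi -> expmix (fun x => phi x * psi x).
Proof.
move=> ephi; elim: ephi psi => [u u0|p1 p2 e1 ih1 e2 ih2|p_ p e_ ih hc] psi epsi.
- elim: epsi => [v v0|q1 q2 f1 ih1 f2 ih2|q_ q f_ ih hc].
  + rewrite (_ : (fun _ => _) = hfun (u + v)); first by apply: expmix_hfun; exact: addr_ge0.
    by apply/funext => x; rewrite /hfun -expRD; congr expR; ring.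
  + have := expmix_avg ih1 ih2; congr expmix.
    by apply/funext => x; rewrite mulrA mulrDr.
  + by apply: expmix_lim ih _ => x; apply: cvgMl_tmp; exact: hc.
- have := expmix_avg (ih1 _ epsi) (ih2 _ epsi); congr expmix.
  by apply/funext => x; rewrite -mulrDl mulrAC.
- by apply: (expmix_lim (fun n => ih n _ epsi)) => x; apply: cvgMr_tmp; exact: hc.
Qed.

Lemma expmix_exp phi n : expmix phi -> expmix (fun x => phi x ^+ n).
Proof.
move=> e; elim: n => [|n ih]; first by under eq_fun do rewrite expr0; exact: expmix1.
by under eq_fun do rewrite exprS; exact: expmix_mul.
Qed.

Lemma expmix_bound phi : expmix phi -> measurable_fun setT phi /\ (forall x, 0 <= phi x <= 1).
Proof.
elim=> [u u0|p1 p2 e1 [m1 b1] e2 [m2 b2]|p_ p e_ ih hc].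
- by split; [exact: measurable_hfun|move=> x; exact: hfun_bound].
- split; first by apply: measurable_funM => //; exact: measurable_funD.
  by move=> x; have /andP[] := b1 x; have /andP[] := b2 x; lra.
- split; first by apply: measurable_fun_cvg (fun n => (ih n).1) _ => x _; exact: hc.
  move=> x; apply/andP; split.
    by apply: (cvgr_to_ge (hc x)); apply: nearW => n; have [_ /(_ x)/andP[]] := ih n.
  by apply: (cvgr_to_le (hc x)); apply: nearW => n; have [_ /(_ x)/andP[]] := ih n.
Qed.

Lemma bmf_expmix phi : expmix phi -> bmf phi.
Proof.
move=> /expmix_bound[m b]; split => //; exists 1 => x.
by have /andP[b0 b1] := b x; rewrite ger0_norm.
Qed.

(** The starting value 1 is a heat symbol, so that every iterate stays in the class. The value 0
    would not do: all members of [expmix] equal 1 at the point 0. *)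
Fixpoint sqrt_iter (z : R) (k : nat) : R :=
  if k is k'.+1 then (z + sqrt_iter z k' ^+ 2) / 2 else 1.

(** The iterates decrease within [0, 1], so they converge to a fixed point [l] of the iteration. The
    fixed point equation reads [(1 - l) ^+ 2 = 1 - z], and [l <= 1] selects the root. *)
Lemma sqrt_iter_cvg (z : R) : 0 <= z <= 1 -> sqrt_iter z k @[k --> \oo] --> 1 - Num.sqrt (1 - z).
Proof.
move=> /andP[z0 z1].
have b k : 0 <= sqrt_iter z k <= 1.
  by elim: k => [|k /andP[h0 h1]] /=; [rewrite ler01 lexx|nra].
have d k : sqrt_iter z k.+1 <= sqrt_iter z k.
  elim: k => [|k ih] /=; first by rewrite expr1n; lra.
  have /andP[h0 h1] := b k; have /andP[h2 h3] := b k.+1; rewrite /= in ih h2 h3.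
  by nra.
have dec : nonincreasing_seq (sqrt_iter z) by apply/nonincreasing_seqP.
have cv : cvgn (sqrt_iter z).
  apply: nonincreasing_is_cvgn => //; exists 0 => _ [k _ <-].
  by have /andP[] := b k.
have /cvg_ex[l zl] := cv.
have l1 : l <= 1 by apply: (cvgr_to_le zl); apply: nearW => k; have /andP[] := b k.
have e : l = (z + l ^+ 2) / 2.
  have h1 : sqrt_iter z k.+1 @[k --> \oo] --> l by rewrite (@cvg_shiftS _ (sqrt_iter z)).
  have h2 : sqrt_iter z k.+1 @[k --> \oo] --> (z + l ^+ 2) / 2.
    apply: cvgMr_tmp; apply: cvgD; first exact: cvg_cst.
    by rewrite expr2; under eq_fun do rewrite expr2; exact: cvgM.
  by rewrite -(cvg_lim (@Rhausdorff R) h2) (cvg_lim (@Rhausdorff R) h1).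
suff -> : 1 - Num.sqrt (1 - z) = l by [].
have -> : 1 - z = (1 - l) ^+ 2 by rewrite sqrrB expr1n; move: e; lra.
by rewrite sqrtr_sqr ger0_norm ?subr_ge0// subKr.
Qed.

Lemma expmix_sqrt phi : expmix phi -> expmix (fun x => 1 - Num.sqrt (1 - phi x)).
Proof.
move=> e; apply: (@expmix_lim (fun k x => sqrt_iter (phi x) k)).
- elim=> [|k ih]; first exact: expmix1.
  exact: expmix_avg e (expmix_mul ih ih).
- by move=> x; apply: sqrt_iter_cvg; have [_] := expmix_bound e.
Qed.

Lemma expR_le_inv (y : R) : 0 <= y -> expR (- y) <= (1 + y)^-1.
Proof.
by move=> y0; rewrite expRN lef_pV2 ?posrE ?expR_gt0 ?expR_ge1Dx// ltr_wpDr.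
Qed.

Lemma cvg_div_natS (w : R) : w / n.+1%:R @[n --> \oo] --> 0.
Proof.
rewrite -[X in _ --> X](mulr0 w); apply: cvgMl_tmp; exact: cvg_harmonic.
Qed.

(** With a = w / (n + 1) and b = sqrt (1 - e^{-a^2}), one has a / (1 + a) <= b <= a. Together with
    e^{-b / (1 - b)} <= 1 - b <= e^{-b}, this encloses the power between e^{-w / (1 - a)} and e^{-w
    / (1 + a)}. *)
Lemma poisson_approx (w : R) : 0 <= w ->
  (1 - Num.sqrt (1 - expR (- (w / n.+1%:R) ^+ 2))) ^+ n.+1 @[n --> \oo] --> expR (- w).
Proof.
move=> w0.
pose a n : R := w / n.+1%:R.
have a0 n : 0 <= a n by rewrite divr_ge0.
have acv : a n @[n --> \oo] --> 0 by exact: cvg_div_natS.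
pose b n := Num.sqrt (1 - expR (- (a n) ^+ 2)).
have b0 n : 0 <= b n by exact: sqrtr_ge0.
have ba n : b n <= a n.
  rewrite -[leRHS]ger0_norm// -sqrtr_sqr ler_wsqrtr//.
  by have := expR_ge1Dx (- (a n) ^+ 2); lra.
have b1 n : 0 <= 1 - b n.
  by rewrite subr_ge0 -sqrtr1 ler_wsqrtr.
have ab n : a n / (1 + a n) <= b n.
  have p : 0 <= a n / (1 + a n) by rewrite divr_ge0// addr_ge0.
  rewrite -[leLHS]ger0_norm// -sqrtr_sqr ler_wsqrtr//.
  have h := expR_le_inv (sqr_ge0 (a n)).
  apply: (@le_trans _ _ (1 - (1 + a n ^+ 2)^-1)); last by rewrite lerD2l lerN2.
  have q : 0 < 1 + a n ^+ 2 by rewrite ltr_wpDr ?sqr_ge0.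
  rewrite (_ : 1 - _ = a n ^+ 2 / (1 + a n ^+ 2)); last by field; rewrite gt_eqF.
  rewrite expr_div_n ler_wpM2l ?sqr_ge0// lef_pV2 ?posrE// ?exprn_gt0 ?ltr_wpDr//.
  by have := a0 n; nra.
have aux (c : nat -> R) : c n @[n --> \oo] --> (1 : R) ->
    expR (- (w / c n)) @[n --> \oo] --> expR (- w).
  move=> h; apply: continuous_cvg; first exact: continuous_expR.
  apply: cvgN; rewrite -[in X in _ --> X](divr1 w); apply: cvgMl_tmp.
  by apply: cvgV => //; exact: oner_neq0.
have c1 : (1 : R) @[n --> \oo] --> (1 : R) by exact: cvg_cst.
have e1 : expR (- (w / (1 + a n))) @[n --> \oo] --> expR (- w).
  by apply: aux; rewrite -[in X in _ --> X](addr0 1); apply: cvgD.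
have e2 : expR (- (w / (1 - a n))) @[n --> \oo] --> expR (- w).
  by apply: aux; rewrite -[in X in _ --> X](subr0 1); apply: cvgB.
have na n : n.+1%:R * a n = w by rewrite /a mulrC divfK.
apply: (squeeze_cvgr _ e2 e1).
have : \forall n \near \oo, a n < 1.
  by have /cvgr_lt := acv; apply.
apply: filterS => n an1.
have bn1 : 0 < 1 - b n by rewrite subr_gt0 (le_lt_trans (ba n)).
rewrite -/(a n) -/(b n); apply/andP; split.
- apply: (@le_trans _ _ (expR (- (b n / (1 - b n))) ^+ n.+1)).
    rewrite -expRM_natl ler_expR mulrN lerN2 -(na n) -mulrA ler_wpM2l//.
    apply: ler_pM => //; first by rewrite invr_ge0.
    by rewrite lef_pV2 ?posrE ?subr_gt0//; have := ba n; lra.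
  rewrite lerXn2r ?nnegrE ?expR_ge0//.
  apply: (le_trans (expR_le_inv _)); first by rewrite divr_ge0.
  by rewrite (_ : 1 + _ = (1 - b n)^-1) ?invrK//; field; rewrite gt_eqF.
- apply: (@le_trans _ _ (expR (- b n) ^+ n.+1)).
    by rewrite lerXn2r ?nnegrE ?expR_ge0//; exact: expR_ge1Dx.
  by rewrite -expRM_natl ler_expR mulrN lerN2 -[X in X / _](na n) -mulrA ler_wpM2l.
Qed.

Lemma expmix_pfun (s : R) : 0 <= s -> expmix (pfun s).
Proof.
move=> s0; apply: (@expmix_lim (fun n x =>
  (1 - Num.sqrt (1 - hfun ((s / n.+1%:R) ^+ 2) x)) ^+ n.+1)).
- by move=> n; apply: expmix_exp; apply: expmix_sqrt; apply: expmix_hfun; exact: sqr_ge0.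
- move=> x; rewrite /pfun mulNr.
  have x0 : 0 <= Num.max x 0 by rewrite le_max lexx orbT.
  have -> : Num.sqrt x = Num.sqrt (Num.max x 0).
    by case: (leP 0 x) => [//|h]; rewrite sqrtr0 ltr0_sqrtr.
  have := @poisson_approx (s * Num.sqrt (Num.max x 0)).
  rewrite mulr_ge0 ?sqrtr_ge0// => /(_ isT).
  rewrite (_ : (fun _ => _) = (fun n => (1 - Num.sqrt (1 - hfun ((s / n.+1%:R) ^+ 2) x)) ^+ n.+1))//.
  apply/funext => n; rewrite /hfun; congr ((1 - Num.sqrt (1 - expR _)) ^+ _).
  by rewrite mulNr mulrAC exprMn sqr_sqrtr.
Qed.

End ExpMixtures.

(** * Measurability on spaces of homogeneous type *)

Lemma bigcup_countable_measurable {d : measure_display} {T : measurableType d} {U : choiceType}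
    (S : set U) (F : U -> set T) : countable S -> (forall p, S p -> measurable (F p)) ->
  measurable (\bigcup_(p in S) F p).
Proof.
move=> /countable_injP[f finj] mF.
pose G k : set T := \bigcup_(p in [set p | S p /\ f p = k]) F p.
rewrite (_ : \bigcup_(p in S) F p = \bigcup_k G k); last first.
  apply/seteqP; split=> [x [p Sp Fx]|x [k _ [p [Sp _] Fx]]]; last by exists p.
  by exists (f p) => //; exists p.
apply: bigcup_measurable => k _.
have [[p [Sp fp]]|nk] := pselect (exists p, S p /\ f p = k).
  rewrite (_ : G k = F p); first exact: mF.
  apply/seteqP; split=> [x [q [Sq fq] Fx]|x Fx]; last by exists p.
  by rewrite (_ : p = q)//; apply: finj; rewrite ?inE// fp fq.
rewrite (_ : G k = set0)//; rewrite -subset0 => x [p pk _].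
by apply: nk; exists p.
Qed.

Section Geometry.
Context {d : measure_display} {R : realType} {Omega : measurableMetricType d R}.
Variable mu : {measure set Omega -> \bar R}.
Hypothesis homog : homogeneous_type mu.

Let dist (x y : Omega) : R := mdist x y.

Lemma measurable_ball (x : Omega) (t : R) : measurable (ball x t).
Proof.
have [oM _ _] := homog; apply: oM.
have [t0|t0] := ltP 0 t.
  rewrite openE => y; rewrite ballEmdist/= => xy.
  apply/nbhs_ballP; exists (t - dist x y) => /=; first by rewrite subr_gt0.
  move=> z; rewrite !ballEmdist/= => yz.
  by apply: (le_lt_trans (metric_triangle x y z)); rewrite -ltrBrDl.
rewrite (_ : ball x t = set0); first exact: open0.
rewrite -subset0 => y; rewrite ballEmdist/= => yt.
by have := lt_le_trans yt t0; rewrite ltNge mdist_ge0.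
Qed.

Lemma mu_ball_gt0 (x : Omega) (t : R) : 0 < t -> (0 < mu (ball x t))%E.
Proof. by move=> t0; have [_ /(_ x t t0)/andP[]] := homog. Qed.

Lemma mu_ball_lty (x : Omega) (t : R) : (mu (ball x t) < +oo)%E.
Proof.
have [_ h _] := homog.
have m0 : 0 < Num.max t 1 by rewrite lt_max ltr01 orbT.
have /andP[_ ] := h x _ m0; apply: le_lt_trans.
apply: le_measure; rewrite ?inE; [exact: measurable_ball..|].
by apply: le_ball; rewrite le_max lexx.
Qed.

Lemma bigcup_ball (x : Omega) : \bigcup_n ball x n%:R = setT.
Proof.
rewrite -subTset => y _; exists (Num.truncn (dist x y)).+1 => //.
by rewrite ballEmdist/=; exact: truncnS_gt.
Qed.

Lemma sigma_finite_mu : sigma_finite setT mu.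
Proof.
exists (fun n => ball (point : Omega) n%:R); first by rewrite bigcup_ball.
by move=> n; split; [exact: measurable_ball|exact: mu_ball_lty].
Qed.

(** The measure [mu] packaged with its sigma-finiteness, for measurability of sections and Tonelli's
    theorem; the balls of integer radius about [point] are the witness. *)
Definition sfmeas : {sigma_finite_measure set Omega -> \bar R} :=
  HB.pack (Measure.sort mu)
    (@isSFinite.Build _ _ _ mu (sfinite_measure_sigma_finite sigma_finite_mu))
    (@isSigmaFinite.Build _ _ _ mu sigma_finite_mu).

Lemma sfmeasE : sfmeas = mu :> {measure set Omega -> \bar R}.
Proof. exact: eq_measure. Qed.

(** A packing argument: the balls of radius [e] are disjoint, lie in the ball of radius [r + e],
    whose measure is finite, and each takes at least [c] of it. *)
Lemma disjoint_ball_finite (S : set Omega) (x : Omega) (r e c : R) : 0 < e -> 0 < c ->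
  (forall p q, S p -> S q -> p <> q -> 2 * e <= dist p q) ->
  finite_set [set p | S p /\ ball x r p /\ (c%:E <= mu (ball p e))%E].
Proof.
move=> e0 c0 sep; apply: contrapT => inf.
pose M := fine (mu (ball x (r + e))).
have [B BS Bn] := infinite_set_fset (Num.truncn (M / c)).+1 inf.
have tB : trivIset [set` B] (fun p : Omega => ball p e).
  move=> p q Bp Bq [z []]; rewrite !ballEmdist/= => pz qz; apply: contrapT => pq.
  have [Sp _] := BS _ Bp; have [Sq _] := BS _ Bq.
  have := sep _ _ Sp Sq pq; apply/negP; rewrite -ltNge mulrDl !mul1r.
  by apply: (le_lt_trans (metric_triangle p z q)); rewrite ltrD// metric_sym.
have : (mu (\bigcup_(p in [set` B]) ball p e) <= M%:E)%E.
  rewrite /M fineK ?ge0_fin_numE ?mu_ball_lty//.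
  apply: le_measure; rewrite ?inE.
  - by apply: fin_bigcup_measurable => // p _; exact: measurable_ball.
  - exact: measurable_ball.
  - move=> z [p Bp]; rewrite !ballEmdist/= => pz.
    have [_ [+ _]] := BS _ Bp; rewrite ballEmdist/= => xp.
    by apply: (le_lt_trans (metric_triangle x p z)); rewrite ltrD.
rewrite measure_fin_bigcup//; last by move=> p _; exact: measurable_ball.
rewrite -fsbig_seq//.
apply/negP; rewrite -ltNge.
apply: (@lt_le_trans _ _ (\sum_(p <- B) c%:E)%E); last first.
  rewrite big_seq [leRHS]big_seq; apply: lee_sum => p Bp.
  by have [_ []] := BS _ Bp.
rewrite sumEFin lte_fin big_const_seq count_predT iter_addr_0 -mulr_natr.
rewrite -ltr_pdivrMl// mulrC; apply: (lt_le_trans (truncnS_gt _)).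
by rewrite ler_nat.
Qed.

(** As balls have positive measure, the points fall into countably many classes, according to their
    distance from a base point and a lower bound 1 / (k + 1) for the measure of their [e]-ball. Each
    class is finite by packing. *)
Lemma separated_countable (S : set Omega) (e : R) : 0 < e ->
  (forall p q, S p -> S q -> p <> q -> 2 * e <= dist p q) -> countable S.
Proof.
move=> e0 sep.
pose S' (nk : nat * nat) := [set p | S p /\ ball (point : Omega) nk.1%:R p /\
  ((nk.2.+1%:R^-1)%:E <= mu (ball p e))%E].
rewrite (_ : S = \bigcup_nk S' nk).
  apply: bigcup_countable => // nk _; apply: finite_set_countable.
  by apply: disjoint_ball_finite => //; rewrite invr_gt0.
apply/seteqP; split=> [p Sp|p [nk _ []]//].
have [n _ np] : (\bigcup_n ball (point : Omega) n%:R) p by rewrite bigcup_ball.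
have m0 := mu_ball_gt0 p e0.
have mf : mu (ball p e) \is a fin_num by rewrite ge0_fin_numE ?mu_ball_lty.
pose v := fine (mu (ball p e)).
have v0 : 0 < v by rewrite fine_gt0// m0 mu_ball_lty.
exists (n, Num.truncn v^-1) => //; split => //; split => //=.
rewrite -(fineK mf) lee_fin -/v -[leRHS]invrK lef_pV2 ?posrE ?invr_gt0//.
exact/ltW/truncnS_gt.
Qed.

(** A maximal [e]-separated set, given by Zorn's lemma, meets every ball of radius [e] and is
    countable by separation. *)
Lemma separable (e : R) : 0 < e -> exists2 S : set Omega, countable S &
  forall x, exists2 p, S p & dist p x < e.
Proof.
move=> e0.
pose P (S : set Omega) := forall p q, S p -> S q -> p <> q -> e <= dist p q.
have [|S [PS Smax]] := @Zorn_bigcup Omega P.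
  move=> F FP Ftot p q [A FA Ap] [B FB Bq].
  have [AB|BA] := Ftot _ _ FA FB.
    by apply: (FP _ FB) => //; exact: AB.
  by apply: (FP _ FA) => //; exact: BA.
exists S.
  apply: (@separated_countable _ (e / 2)); first by rewrite divr_gt0.
  by move=> p q Sp Sq pq; rewrite mulrC divfK//; exact: PS.
move=> x; apply: contrapT => nx.
have far p : S p -> e <= dist p x.
  by move=> Sp; rewrite leNgt; apply/negP => px; apply: nx; exists p.
have Sx : ~ S x.
  by move=> /far; rewrite /dist mdistxx leNgt e0.
apply: (Smax (x |` S)).
  split; first by move=> y Sy; right.
  by move=> /(_ x) h; apply: Sx; apply: h; left.
move=> p q [->|Sp] [->|Sq] //; last exact: PS.
- by move=> _; rewrite /dist metric_sym; exact: far.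
- by move=> _; exact: far.
Qed.

(** Countable nets write {dist < c} as a countable union of products of balls, which belong to the
    product sigma-algebra. *)
Lemma measurable_dist : measurable_fun setT (fun p : Omega * Omega => dist p.1 p.2).
Proof.
move=> mT; apply: (measurability _ (RGenInftyO.measurableE R)) => //.
move=> _ [_ [c ->] <-]; rewrite setTI.
have /choice[S SP] : forall n : nat, exists S : set Omega, countable S /\
    forall x, exists2 p, S p & dist p x < n.+1%:R^-1.
  by move=> n; have [|S ? ?] := @separable n.+1%:R^-1; [rewrite invr_gt0|exists S].
rewrite (_ : _ @^-1` _ = \bigcup_n \bigcup_(p in S n)
   (ball p n.+1%:R^-1 `*` ball p (c - n.+1%:R^-1))).
  apply: bigcup_measurable => n _; apply: bigcup_countable_measurable.
    by have [] := SP n.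
  by move=> p _; apply: measurableX; exact: measurable_ball.
apply/seteqP; split=> [[x y]/=|[x y] [n _ [p Sp]]/=].
  rewrite in_itv/= => xy.
  (* This gives 2 / (n + 1) <= c - dist(x, y): one copy of 1 / (n + 1) pays for moving from x to p,
     the other for the reduced radius around p. *)
  pose n := Num.truncn (2 / (c - dist x y)).
  have [p Sp px] := (SP n).2 x.
  exists n => //; exists p => //; split => /=; rewrite ballEmdist//=.
  have n2 : 2 * n.+1%:R^-1 <= c - dist x y.
    rewrite ler_pdivrMr// mulrC -ler_pdivrMr ?subr_gt0//.
    exact/ltW/truncnS_gt.
  apply: (le_lt_trans (metric_triangle p x y)).
  by move: px n2; rewrite /dist; move: (mdist p x) (mdist x y) (n.+1%:R^-1) => a b i; lra.
rewrite !ballEmdist/= in_itv/= => -[px py].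
apply: (le_lt_trans (metric_triangle x p y)).
by rewrite (metric_sym x p); move: px py; move: (mdist p x) (mdist p y) (n.+1%:R^-1) => a b i; lra.
Qed.

End Geometry.

(** * Masses and cone densities as functions of position and height *)

Section MassContinuity.
Context {d : measure_display} {T : measurableType d} {R : realType}.
Variable mu : {measure set T -> \bar R}.
Implicit Types f g : L2 mu.

Lemma massL_fin (A : set T) f : measurable A -> massL A f \is a fin_num.
Proof.
move=> mA; rewrite ge0_fin_numE ?massL_ge0//.
by apply: (le_lt_trans (massL_le f mA)); exact: ltry.
Qed.

(** [massLD], used in both directions, bounds each mass by [1 + s] times the other plus a multiple
    of [nsq (f_ n - f)]; [s] is fixed before [n]. *)
Lemma massL_cvg (A : set T) (f_ : nat -> L2 mu) f : measurable A -> L2_lim f_ f ->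
  massL A (f_ n) @[n --> \oo] --> massL A f.
Proof.
move=> mA ff.
pose a := fine (massL A f).
have a0 : 0 <= a by rewrite fine_ge0// massL_ge0.
pose b n := fine (massL A (f_ n)).
pose c n := nsq (f_ n - f).
have c0 n : 0 <= c n by exact: nsq_ge0.
have ea : massL A f = a%:E by rewrite fineK// massL_fin.
have eb n : massL A (f_ n) = (b n)%:E by rewrite fineK// massL_fin.
have h1 e n : 0 < e -> b n <= (1 + e) * a + (1 + e^-1) * c n.
  move=> e0; rewrite -lee_fin EFinD !EFinM -eb -ea.
  rewrite -[X in massL A X](subrK f (f_ n)) addrC.
  apply: (le_trans (massLD _ _ mA e0)); rewrite leeD2l// lee_wpmul2l//.
    by rewrite lee_fin addr_ge0// invr_ge0 ltW.
  exact: massL_le.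
have h2 e n : 0 < e -> a <= (1 + e) * b n + (1 + e^-1) * c n.
  move=> e0; rewrite -lee_fin EFinD !EFinM -eb -ea.
  rewrite -[X in massL A X](subrK (f_ n) f) addrC.
  apply: (le_trans (massLD _ _ mA e0)); rewrite leeD2l// lee_wpmul2l//.
    by rewrite lee_fin addr_ge0// invr_ge0 ltW.
  by apply: (le_trans (massL_le _ mA)); rewrite lee_fin /c -nsqN opprB.
rewrite ea; under eq_fun do rewrite eb; apply: cvg_EFin; first exact: nearW.
apply/cvgrPdist_le => e e0.
(* Once [c n <= 1], both masses are at most [2 * a + 2], so the terms with factor [s] cost at most
   [e / 2]. *)
pose s := e / (2 * (2 * a + 2)).
have q0 : 0 < 2 * (2 * a + 2) by rewrite mulr_gt0// ltr_wpDl// mulr_ge0.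
have s0 : 0 < s by rewrite divr_gt0.
have es : s * (2 * a + 2) = e / 2 by rewrite /s; field; rewrite gt_eqF// ltr_wpDl// mulr_ge0.
have si : 0 < 1 + s^-1 by rewrite addr_gt0// invr_gt0.
have /L2_limP ff' := ff.
have m0 : 0 < Num.min 1 (e / 2 / (1 + s^-1)) by rewrite lt_min ltr01 !divr_gt0.
apply: filterS (ff' _ m0) => n; rewrite -/(c n) le_min => /andP[cn1 cn2].
have b2 : b n <= 2 * a + 2.
  by have := h1 1 n ltr01; rewrite invr1; lra.
have k1 := h1 s n s0; have k2 := h2 s n s0.
have cs : (1 + s^-1) * c n <= e / 2 by rewrite mulrC -ler_pdivlMr.
have sb : s * b n <= s * (2 * a + 2) by rewrite ler_wpM2l// ltW.
have sa : s * a <= s * (2 * a + 2) by rewrite ler_wpM2l ?ltW//; lra.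
move: k1 k2 cs; rewrite /=; move: (_ * c n) => X k1 k2 cs.
by rewrite ler_norml; apply/andP; split; lra.
Qed.

End MassContinuity.

Section ConeMeasurability.
Context {d : measure_display} {R : realType} {Omega : measurableMetricType d R}.
Variable mu : {measure set Omega -> \bar R}.
Hypothesis homog : homogeneous_type mu.
Local Notation MR := (measurableTypeR R).

Definition vol (x : Omega) (t : R) : R := fine (mu (ball x t)).

Definition cball (x : Omega) (t : R) : set Omega := [set y | mdist x y <= t].

Lemma measurable_triple_dist :
  measurable_fun setT (fun p : (Omega * MR) * Omega => mdist p.1.1 p.2 - p.1.2 : R).
Proof.
apply: measurable_funB.
  have h := measurable_dist homog.
  have m1 : measurable_fun setT (fun p : (Omega * MR) * Omega => p.1.1) by exact: measurableT_comp.
  have m2 : measurable_fun setT (fun p : (Omega * MR) * Omega => p.2) by exact: measurable_snd.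
  exact: (measurableT_comp h (measurable_fun_pair m1 m2)).
exact: measurableT_comp.
Qed.

Lemma measurable_cball x t : measurable (cball x t).
Proof.
have mf := measurableT_comp measurable_triple_dist
  (@pair1_measurable _ _ _ _ ((x, t) : Omega * MR)).
have := mf measurableT `]-oo, 0%R]%classic (measurable_itv _).
rewrite setTI (_ : _ @^-1` _ = cball x t)//.
by apply/seteqP; split=> y /=; rewrite in_itv/= subr_le0.
Qed.

Lemma measurable_vol : measurable_fun setT (fun p : Omega * MR => vol p.1 p.2).
Proof.
pose A := [set p : (Omega * MR) * Omega | mdist p.1.1 p.2 - p.1.2 < 0].
have mA : measurable A.
  have := measurable_triple_dist measurableT (measurable_itv `]-oo, 0%R[).
  by rewrite setTI.
have := measurable_fun_xsection (sfmeas homog) mA.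
rewrite (_ : _ \o _ = fun p : Omega * MR => mu (ball p.1 p.2)).
  by move=> h; exact: measurableT_comp.
apply/funext => -[x t] /=; congr (mu _).
apply/seteqP; split=> y /=; rewrite /xsection/= inE /A/= ballEmdist/= subr_lt0//.
Qed.

Lemma measurable_mass (f : L2 mu) :
  measurable_fun setT (fun p : Omega * MR => massL (cball p.1 p.2) f).
Proof.
pose A := [set p : (Omega * MR) * Omega | mdist p.1.1 p.2 - p.1.2 <= 0].
have mA : measurable A.
  have := measurable_triple_dist measurableT (measurable_itv `]-oo, 0%R]).
  by rewrite setTI.
pose G (p : (Omega * MR) * Omega) : \bar R := (\1_A p * sqa f p.2)%:E.
have mG : measurable_fun setT G.
  apply/measurable_EFinP; apply: measurable_funM; first exact: measurable_indic.
  by apply: measurableT_comp => //; exact: measurable_sqa.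
have G0 p : (0 <= G p)%E by rewrite lee_fin mulr_ge0 ?sqa_ge0// indicE.
have := @measurable_fun_fubini_tonelli_F _ _ _ _ _ (sfmeas homog) G mG G0.
rewrite /fubini_F sfmeasE; congr measurable_fun.
apply/funext => -[x t] /=; rewrite /massL [RHS]integral_mkcond.
apply: eq_integral => y _; rewrite /G patchE indicE /=.
have -> : ((x, t, y) \in A) = (y \in cball x t).
  by apply/idP/idP; rewrite !inE /A /cball/= subr_le0.
by case: ifPn => _; rewrite ?mul1r// mul0r.
Qed.

Lemma measurable_fun_patch {d' : measure_display} {S : measurableType d'}
    (j : S -> int) (G : int -> S -> \bar R) :
  (forall i, measurable [set p | j p = i]) ->
  (forall i, measurable_fun setT (G i)) -> measurable_fun setT (fun p => G (j p) p).
Proof.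
move=> mj mG _ B mB; rewrite setTI.
rewrite (_ : _ @^-1` _ = \bigcup_i ([set p | j p = i] `&` G i @^-1` B)).
  apply: countable_bigcupT_measurable => // i.
  by apply: measurableI => //; rewrite -[_ @^-1` _]setTI; exact: mG.
by apply/seteqP; split=> [p Bp|p [i _ [<- //]]]; exists (j p).
Qed.

(** Representatives of the classes [F t] are chosen separately for each [t], so [(F t) y] need not
    be jointly measurable. The mass depends on the class alone: replacing [t] by a rational with
    denominator [k + 1] freezes [F] on countably many slabs, and L2 continuity gives the limit in
    [k]. *)
Lemma measurable_mass_family (F : R -> L2 mu) :
  (forall (u : nat -> R) t, u n @[n --> \oo] --> t -> L2_lim (fun n => F (u n)) (F t)) ->
  measurable_fun setT (fun p : Omega * MR => massL (cball p.1 p.2) (F p.2)).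
Proof.
move=> Fc.
pose u (k : nat) (t : R) : R := (Num.floor (k.+1%:R * t))%:~R / k.+1%:R.
have ut t : u k t @[k --> \oo] --> t.
  apply: (@squeeze_cvgr _ _ _ _ (fun k => t - 1 / k.+1%:R) (fun k => t)).
  - apply: nearW => k; have k0 : (0 : R) < k.+1%:R by [].
    rewrite /u ler_pdivrMr// (mulrC t) floor_le andbT.
    rewrite lerBlDr -mulrDl ler_pdivlMr// mulrC.
    have := floorD1_gt (k.+1%:R * t); rewrite intrD; exact: ltW.
  - rewrite -[in X in _ --> X](subr0 t); apply: cvgB; first exact: cvg_cst.
    exact: cvg_div_natS.
  - exact: cvg_cst.
apply: (@emeasurable_fun_cvg _ _ _ _ (fun k (p : Omega * MR) => massL (cball p.1 p.2) (F (u k p.2)))).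
- move=> k.
  apply: (@measurable_fun_patch _ _ (fun p : Omega * MR => Num.floor (k.+1%:R * p.2))
     (fun i p => massL (cball p.1 p.2) (F (i%:~R / k.+1%:R)))) => i; last exact: measurable_mass.
  rewrite (_ : [set p | _] = (fun p : Omega * MR => k.+1%:R * p.2 : R) @^-1` `[i%:~R, (i + 1)%:~R[%classic).
    rewrite -[_ @^-1` _]setTI; apply: (@measurable_funM _ _ _ _ (cst _) snd) => //.
  apply/seteqP; split=> [[x t]/= <-|[x t]/=]; rewrite in_itv/=.
    by rewrite floor_le floorD1_gt.
  by move=> h; apply/eqP; rewrite floor_eq.
- move=> [x t] _ /=; apply: massL_cvg; first exact: measurable_cball.
  exact: (Fc (fun k => u k t)).
Qed.

(** The inner integral of [square_fun] at height [t], with the factor 1 / (V(x, t) t) taken out of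
    it. *)
Definition dens (f : L2 mu) (x : Omega) (t : R) : \bar R :=
  (massL (cball x t) f * ((vol x t * t)^-1)%:E)%E.

Lemma vol_t_ge0 x t : 0 <= vol x t * t.
Proof.
have [t0|t0] := leP 0 t; first by rewrite mulr_ge0// fine_ge0.
rewrite /vol (_ : ball x t = set0) ?measure0 ?mul0r//.
rewrite -subset0 => y; rewrite ballEmdist/= => yt.
by have := lt_trans yt t0; rewrite ltNge mdist_ge0.
Qed.

Lemma dens_ge0 f x t : (0 <= dens f x t)%E.
Proof. by rewrite mule_ge0 ?massL_ge0// lee_fin invr_ge0 vol_t_ge0. Qed.

Lemma measurable_dens_family (F : R -> L2 mu) :
  (forall (u : nat -> R) t, u n @[n --> \oo] --> t -> L2_lim (fun n => F (u n)) (F t)) ->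
  measurable_fun setT (fun p : Omega * MR => dens (F p.2) p.1 p.2).
Proof.
move=> Fc; apply: emeasurable_funM; first exact: measurable_mass_family.
apply/measurable_EFinP.
(* For nonnegative reals, including 0, the inverse agrees with the power -1, a measurable map of the
   line. *)
rewrite (_ : (fun _ => _) = (fun p : Omega * MR => (vol p.1 p.2 * p.2) `^ (- 1))).
  apply: (measurableT_comp (measurable_powR _)) => //.
  by apply: measurable_funM; [exact: measurable_vol|exact: measurable_snd].
by apply/funext => p; rewrite powR_inv1// vol_t_ge0.
Qed.

End ConeMeasurability.

(** * The change of heights and averages over balls *)

Section TimeChange.
Context {R : realType}.
Local Notation MR := (measurableTypeR R).
Local Notation leb := (@lebesgue_measure R).
Variable s : R.
Hypothesis s0 : 0 < s.

Definition tau (t : R) : R := Num.sqrt (t ^+ 2 + s).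

Lemma tau2 t : tau t ^+ 2 = t ^+ 2 + s.
Proof. by rewrite sqr_sqrtr// addr_ge0 ?sqr_ge0// ltW. Qed.

Lemma tau_gt0 t : 0 < tau t.
Proof. by rewrite sqrtr_gt0 ltr_wpDl// sqr_ge0. Qed.

Lemma tau_ge t : t <= tau t.
Proof.
have := tau2 t; have := tau_gt0 t; have := s0; have := @sqr_ge0 _ t.
move: (tau t) => u; have [h|h] := leP t u => //; nra.
Qed.

Lemma is_derive_tau (t : R) : is_derive t 1 tau (t / tau t).
Proof.
have h : 0 < t ^+ 2 + s by rewrite ltr_wpDl// sqr_ge0.
have d1 : is_derive t 1 (fun x : R => x ^+ 2 + s) (2 * t).
  by apply: is_derive_eq; rewrite /GRing.scale/=; ring.
have := is_derive1_sqrt h => d2.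
have := @is_derive1_comp _ Num.sqrt (fun x : R => x ^+ 2 + s) t _ _ d2 d1.
rewrite -/(tau t); congr is_derive; rewrite invfM.
by have := gt_eqF (tau_gt0 t); move: (tau t) => u /negbT u0; field.
Qed.

Lemma continuous_tau : continuous tau.
Proof.
move=> t; apply: differentiable_continuous; apply/derivable1_diffP.
by have [] := is_derive_tau t.
Qed.

Lemma continuous_rho : continuous (fun t : R => t / tau t).
Proof.
move=> t; apply: cvgM; first exact: cvg_id.
by apply: cvgV; [rewrite gt_eqF// tau_gt0|exact: continuous_tau].
Qed.

Lemma measurable_tau : measurable_fun setT (tau : MR -> R).
Proof. exact: (continuous_measurable_fun continuous_tau). Qed.

Lemma measurable_rho : measurable_fun setT (fun t : MR => t / tau t : R).
Proof. exact: (continuous_measurable_fun continuous_rho). Qed.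

(** The image under [tau] of the measure (t / tau) dt = d tau on the positive half-line. *)
Let Phi (A : set MR) : \bar R :=
  (\int[leb]_(t in `]0%R, +oo[) (\1_A (tau t) * (t / tau t))%:E)%E.

Let mPhi (A : set MR) : measurable A ->
  measurable_fun setT (fun t : MR => (\1_A (tau t) * (t / tau t))%:E).
Proof.
move=> mA; apply/measurable_EFinP; apply: measurable_funM; last exact: measurable_rho.
exact: (measurableT_comp (measurable_indic mA) measurable_tau).
Qed.

Let Phi0 (A : set MR) (t : MR) : `]0%R, +oo[%classic t -> (0 <= (\1_A (tau t) * (t / tau t))%:E)%E.
Proof.
rewrite /= in_itv/= andbT => t0; rewrite lee_fin mulr_ge0 ?indicE//.
by rewrite divr_ge0 ?ltW ?tau_gt0.
Qed.

(** The range of [tau] on positive heights starts at [sqrt s], which explains [a']. The heights sent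
    into ]a, b] lie in [al, be], and the fundamental theorem of calculus gives tau be - tau al = b -
    a'. *)
Let Phi_itv (a b : R) : a < b -> (Phi `]a, b]%classic <= (b - a)%:E)%E.
Proof.
move=> ab; have [bs|sb] := leP b (Num.sqrt s).
  rewrite /Phi integral0_eq ?lee_fin ?subr_ge0 1?ltW// => t; rewrite /= in_itv/= andbT => t0.
  rewrite indicE memNset ?mul0r//= in_itv/= => /andP[_ tb].
  have : Num.sqrt s < tau t by rewrite ltr_sqrt ?ltrDr ?exprn_gt0// addr_gt0// exprn_gt0.
  by rewrite ltNge (le_trans tb bs).
pose a' := Num.max a (Num.sqrt s).
have a'b : a' < b by rewrite gt_max ab sb.
have a's : Num.sqrt s <= a' by rewrite le_max lexx orbT.
have a'0 : 0 <= a' by apply: le_trans a's; exact: sqrtr_ge0.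
have ss : Num.sqrt s ^+ 2 = s by rewrite sqr_sqrtr// ltW.
have b0 : 0 < b by exact: le_lt_trans a'b.
have as2 : s <= a' ^+ 2 by rewrite -ss ler_sqr// nnegrE sqrtr_ge0.
have ab2 : a' ^+ 2 < b ^+ 2 by rewrite ltr_sqr// nnegrE ltW.
pose al := Num.sqrt (a' ^+ 2 - s); pose be := Num.sqrt (b ^+ 2 - s).
have al2 : al ^+ 2 = a' ^+ 2 - s by rewrite sqr_sqrtr// subr_ge0.
have be2 : be ^+ 2 = b ^+ 2 - s by rewrite sqr_sqrtr// subr_ge0 (le_trans as2)// ltW.
have albe : al < be by rewrite ltr_sqrt ?ltrD2r// subr_gt0 (le_lt_trans as2).
have ta : tau al = a' by rewrite /tau al2 subrK sqrtr_sqr ger0_norm.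
have tb : tau be = b by rewrite /tau be2 subrK sqrtr_sqr ger0_norm// ltW.
apply: (@le_trans _ _ (\int[leb]_(t in `[al, be]) (t / tau t)%:E)%E).
  rewrite /Phi integral_mkcond [leRHS]integral_mkcond; apply: ge0_le_integral => //.
  - by move=> t _; apply: erestrict_ge0 => u; exact: Phi0.
  - apply/(measurable_restrictT _ _).1 => //.
    by apply: measurable_funTS; apply: mPhi; exact: measurable_itv.
  - apply/(measurable_restrictT _ _).1 => //.
    by apply: measurable_funTS; apply/measurable_EFinP; exact: measurable_rho.
  - move=> t _; rewrite !patchE.
    have al0 : 0 <= al by exact: sqrtr_ge0.
    have [tp|tp] := boolP (t \in `]0, +oo[%classic); last first.
      case: ifPn => // th; rewrite lee_fin divr_ge0 ?(ltW (tau_gt0 _))//.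
      by move: th; rewrite inE/= in_itv/= => /andP[h _]; exact: le_trans h.
    move: tp; rewrite inE/= in_itv/= andbT => t0.
    rewrite indicE; have [tab|tab] := boolP (tau t \in `]a, b]%classic); last first.
      rewrite mul0r; case: ifPn => // th; rewrite lee_fin divr_ge0 ?(ltW (tau_gt0 _))//.
      exact: ltW.
    rewrite mul1r mem_set//= in_itv/=.
    move: tab; rewrite inE/= in_itv/= => /andP[at_ tb_].
    have sta : a' <= tau t.
      by rewrite ge_max (ltW at_)/= ler_wsqrtr// lerDr sqr_ge0.
    rewrite -(ler_sqr (x := al)) ?nnegrE ?(ltW t0)// al2 lerBlDr -tau2.
    rewrite ler_sqr ?nnegrE ?(ltW (tau_gt0 _))// sta/=.
    rewrite -(ler_sqr (y := be)) ?nnegrE ?(ltW t0) ?sqrtr_ge0// be2 lerBrDr -tau2.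
    by rewrite ler_sqr ?nnegrE ?(ltW (tau_gt0 _))// ltW.
rewrite (@continuous_FTC2 _ _ tau)//.
- by rewrite ta tb -EFinB lee_fin lerD2l lerN2 le_max lexx.
- by apply: continuous_subspaceT; exact: continuous_rho.
- split.
  + by move=> x _; have [] := is_derive_tau x.
  + by apply: cvg_at_right_filter; exact: continuous_tau.
  + by apply: cvg_at_left_filter; exact: continuous_tau.
- by move=> x _; rewrite derive1E; have [_] := is_derive_tau x.
Qed.

(** Lebesgue measure is an infimum over countable covers by half-open intervals. Countable
    subadditivity of [Phi] and the bound on intervals therefore settle every measurable set. *)
Let Phi_le (A : set MR) : measurable A -> (Phi A <= leb A)%E.
Proof.
move=> mA; rewrite /lebesgue_measure /lebesgue_stieltjes_measure /measure_extension /mu_ext.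
apply: le_ereal_inf_tmp => _ [F [mF AF] <-].
have mF' k : measurable (F k : set MR) by exact: sub_sigma_algebra.
apply: (@le_trans _ _ (\sum_(0 <= k <oo) Phi (F k))%E).
  rewrite /Phi -integral_nneseries//; last 2 first.
  - by move=> k; apply: measurable_funTS; exact: mPhi.
  - by move=> k t t0; exact: Phi0.
  apply: ge0_le_integral => //.
  - by move=> t tp; exact: Phi0.
  - by apply: measurable_funTS; exact: mPhi.
  - apply: ge0_emeasurable_sum => [k t tp _|k _]; first exact: Phi0.
    by apply: measurable_funTS; exact: mPhi.
  - move=> t tp.
    have nn k : (0 <= (\1_(F k) (tau t) * (t / tau t))%:E)%E by exact: Phi0.
    have [At|At] := boolP (tau t \in A); last first.
      by rewrite indicE (negbTE At) mul0r nneseries_ge0.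
    move: (At); rewrite inE => /AF[k _ Fkt].
    rewrite (_ : \1_A (tau t) = \1_(F k) (tau t)); last by rewrite !indicE At mem_set.
    apply: (@le_trans _ _ (\sum_(0 <= i < k.+1) (\1_(F i) (tau t) * (t / tau t))%:E)%E).
      by rewrite big_nat_recr//= leeDr// sume_ge0.
    exact: nneseries_lim_ge.
apply: lee_nneseries => k _.
  by move=> _; apply: integral_ge0 => t; exact: Phi0.
have /ocitvP[->|[[a b]/= ab ->]] := mF k.
  have -> : Phi set0 = 0%E by rewrite /Phi integral0_eq// => t _; rewrite indic0 mul0r.
  by have := wlength0 (@idfun R) => /= ->.
by rewrite wlength_itv_bnd ?(ltW ab)//; exact: Phi_itv.
Qed.

(** A one-sided change of variables, as an upper bound requires: [Phi_le] is the case of indicators,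
    simple functions follow by linearity, and Fatou's lemma gives the general case. *)
Lemma time_change_le (w : MR -> \bar R) : measurable_fun setT w -> (forall t, 0 <= w t)%E ->
  (\int[leb]_(t in `]0%R, +oo[) (w (tau t) * (t / tau t)%:E) <= \int[leb]_t w t)%E.
Proof.
move=> mw w0.
have mI : measurable (`]0, +oo[%classic : set MR) by exact: measurable_itv.
have r0 t : `]0%R, +oo[%classic t -> (0 <= (t / tau t)%:E)%E.
  by rewrite /= in_itv/= andbT => t0; rewrite lee_fin divr_ge0 ?ltW ?tau_gt0.
have sf (g : {nnsfun MR >-> R}) : (\int[leb]_(t in `]0%R, +oo[) ((g (tau t))%:E * (t / tau t)%:E)
    <= \int[leb]_t (g t)%:E)%E.
  have gE t : (g t)%:E = (\sum_(i <- finmap.enum_fset (fset_set (range g)))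
      (i%:E * (\1_(g @^-1` [set i]) t)%:E))%E.
    by rewrite fimfunE fsbig_finite// -sumEFin.
  have ip i t : (0 <= i%:E * (\1_(g @^-1` [set i]) t : R)%:E)%E.
    have [i0|i0] := leP 0 i; first by rewrite -EFinM lee_fin mulr_ge0// indicE.
    rewrite preimage_nnfun0// indic0 mule0//.
  have mi i : measurable (g @^-1` [set i]) by [].
  rewrite [leRHS](eq_integral _ _ (fun t _ => gE t)) ge0_integral_sum//; last first.
    by move=> i; apply: measurable_funeM; apply/measurable_EFinP; exact: measurable_indic.
  rewrite (eq_integral (fun t : MR => \sum_(i <- finmap.enum_fset (fset_set (range g)))
      (i%:E * (\1_(g @^-1` [set i]) (tau t) * (t / tau t))%:E))%E); last first.
    move=> t; rewrite inE => tp; rewrite gE ge0_sume_distrl//.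
    by apply: eq_bigr => i _; rewrite -muleA -EFinM.
  rewrite ge0_integral_sum//; last 2 first.
  - by move=> i; apply: measurable_funeM; apply: measurable_funTS; exact: mPhi.
  - by move=> i t tp; rewrite EFinM muleA mule_ge0// r0.
  apply: lee_sum => i _.
  have [i0|i0] := leP 0 i; last first.
    rewrite preimage_nnfun0//.
    by rewrite integral0_eq ?integral0_eq// => t _; rewrite indic0 ?mul0r mule0.
  rewrite !ge0_integralZl//; last 3 first.
  - by apply/measurable_EFinP; exact: measurable_indic.
  - by apply: measurable_funTS; exact: mPhi.
  - by move=> t; exact: Phi0.
  by rewrite integral_indic// setIT lee_wpmul2l//; exact: Phi_le.
pose g := nnsfun_approx measurableT mw.
have w0' t : setT t -> (0 <= w t)%E by [].
apply: (@fatou_le _ MR R leb `]0, +oo[%classic (fun n (t : MR) => (g n (tau t))%:E * (t / tau t)%:E)%E) => //.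
- move=> n; apply: measurable_funTS; apply: emeasurable_funM; apply/measurable_EFinP.
    exact: (measurableT_comp (measurable_funPT (g n)) measurable_tau).
  exact: measurable_rho.
- apply: measurable_funTS; apply: emeasurable_funM.
    exact: (measurableT_comp mw measurable_tau).
  by apply/measurable_EFinP; exact: measurable_rho.
- by move=> n t tp; apply: mule_ge0; [rewrite lee_fin|exact: r0].
- by move=> t tp; apply: mule_ge0; [exact: w0|exact: r0].
- apply: aeW => t tp; apply: cvgeZr => //.
  exact: (@cvg_nnsfun_approx _ _ _ _ measurableT _ mw w0').
- apply: nearW => n; apply: (le_trans (sf _)); apply: ge0_le_integral => //.
  + by move=> t _; rewrite lee_fin.
  + exact/measurable_EFinP.
  + by move=> t _; rewrite /g nnsfun_approxE; exact: le_approx.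
Qed.

End TimeChange.

(** * Inequalities for square roots of extended reals *)

Section SqrtE.
Context {R : realType}.
Implicit Types x y : \bar R.
Local Open Scope ereal_scope.

(* The weight e is nearly sqrt b / sqrt a; delta keeps it positive and finite. *)
Lemma sqrte_triangle x a b : 0 <= a -> 0 <= b ->
  (forall e, (0 < e)%R -> x <= (1 + e)%:E * a + (1 + e^-1)%:E * b) ->
  sqrte x <= sqrte a + sqrte b.
Proof.
case: a => [a| |]//; case: b => [b| |]//=; rewrite ?leey// !lee_fin => a0 b0 h.
have sa := sqr_sqrtr a0; have sb := sqr_sqrtr b0.
have pa := sqrtr_ge0 a; have pb := sqrtr_ge0 b.
have xr e : (0 < e)%R -> x <= ((1 + e) * a + (1 + e^-1) * b)%:E by move/h.
case: x {h} xr => [x| |] h /=; first last.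
- by rewrite lee_fin addr_ge0.
- by have := h _ ltr01.
rewrite -EFinD; apply/lee_addgt0Pr => e e0; rewrite -EFinD lee_fin.
have d0 : (0 < e / 2)%R by rewrite divr_gt0.
move: (Num.sqrt a) (Num.sqrt b) sa sb pa pb => r q sa sb r0 q0.
set dl := (e / 2)%R in d0.
have dE : (e = dl + dl)%R by rewrite /dl; field.
have rd : (0 < r + dl)%R by rewrite ltr_wpDl.
have qd : (0 < q + dl)%R by rewrite ltr_wpDl.
have := h _ (divr_gt0 qd rd); rewrite lee_fin => hx.
rewrite -[leRHS]ger0_norm; last by rewrite !addr_ge0// ltW.
rewrite -sqrtr_sqr ler_wsqrtr//; apply: (le_trans hx).
rewrite -sa -sb invf_div dE.
have -> : ((1 + (q + dl) / (r + dl)) * r ^+ 2 = (r + q + (dl + dl)) * (r * (r / (r + dl))))%R.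
  by field; rewrite gt_eqF.
have -> : ((1 + (r + dl) / (q + dl)) * q ^+ 2 = (r + q + (dl + dl)) * (q * (q / (q + dl))))%R.
  by field; rewrite gt_eqF.
rewrite -mulrDr expr2; apply: ler_wpM2l; first by rewrite !addr_ge0// ltW.
apply: (@le_trans _ _ (r + q)%R); last by rewrite lerDl addr_ge0// ltW.
by apply: lerD; apply: ler_piMr => //; rewrite ler_pdivrMr// mul1r lerDl ltW.
Qed.

Lemma sqrte_scale (c : R) x : (0 <= c)%R ->
  sqrte ((c ^+ 2)%:E * x) = c%:E * sqrte x.
Proof.
by move=> c0; rewrite sqrteM ?lee_fin ?sqr_ge0//= sqrtr_sqr ger0_norm.
Qed.

Lemma sqrteD_le x y : 0 <= x -> 0 <= y -> sqrte (x + y) <= sqrte x + sqrte y.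
Proof.
move=> x0 y0; apply: sqrte_triangle => // e e0.
by apply: leeD; rewrite lee_pemull// lee_fin lerDl ?invr_ge0 ltW.
Qed.

Lemma sqrte_scale_le (c : R) x : (1 <= c)%R -> 0 <= x -> sqrte (c%:E * x) <= c%:E * sqrte x.
Proof.
move=> c1 x0; have c0 : (0 <= c)%R by exact: le_trans c1.
rewrite -sqrte_scale// lee_sqrt ?mule_ge0 ?lee_fin ?sqr_ge0//.
by rewrite lee_wpmul2r// lee_fin expr2 ler_peMl.
Qed.

(** Linearises the square root at the price of a free weight; this is how a square root is averaged
    over a ball in [sqrt_average]. *)
Lemma sqrte_amgm x (e : R) : (0 < e)%R -> 0 <= x -> sqrte x <= e%:E + (e^-1)%:E * x.
Proof.
move=> e0; case: x => [a| |]//=; last by rewrite gt0_muley ?lte_fin ?invr_gt0// addey// leey.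
rewrite !lee_fin => a0; have sa := sqr_sqrtr a0; have pa := sqrtr_ge0 a.
rewrite -{2}sa; move: (Num.sqrt a) pa {sa} => r r0.
rewrite -subr_ge0 (_ : _ - _ = e^-1 * (e ^+ 2 - e * r + r ^+ 2))%R; last first.
  by field; rewrite gt_eqF.
by rewrite mulr_ge0 ?invr_ge0 ?(ltW e0)//; nra.
Qed.

Lemma measurable_sqrte {d} {T : measurableType d} (f : T -> \bar R) (D : set T) :
  (forall t, 0 <= f t) -> measurable_fun D f -> measurable_fun D (fun t => sqrte (f t)).
Proof.
move=> f0 mf; rewrite (_ : (fun _ => _) = (fun t => f t `^ 2^-1)).
  by apply: (measurableT_comp (measurable_poweR _)).
by apply/funext => t /=; rewrite poweR12_sqrt.
Qed.

End SqrtE.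

Lemma massLZl {d} {T : measurableType d} {R : realType} (mu : {measure set T -> \bar R})
    (A : set T) (f : L2 mu) (c : R) : measurable A -> 0 <= c ->
  (c%:E * massL A f = \int[mu]_(x in A) (c * sqa f x)%:E)%E.
Proof.
move=> mA c0; rewrite /massL -ge0_integralZl//.
- by apply: measurable_funTS; apply/measurable_EFinP; exact: measurable_sqa.
- by move=> y _; rewrite lee_fin sqa_ge0.
Qed.

(** * Exchange of integrals with respect to the doubling measure *)

Section Tonelli.
Context {d : measure_display} {R : realType} {Omega : measurableMetricType d R}.
Variable mu : {measure set Omega -> \bar R}.
Hypothesis homog : homogeneous_type mu.
Local Open Scope ereal_scope.

Let sfE (h : Omega -> \bar R) : \int[sfmeas homog]_x h x = \int[mu]_x h x.
Proof. by apply: eq_measure_integral. Qed.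

Section Product.
Context {d' : measure_display} {S : measurableType d'}.

Lemma measurable_int_mul (f : S * Omega -> \bar R) : measurable_fun setT f ->
  (forall p, 0 <= f p) -> measurable_fun setT (fun x => \int[mu]_y f (x, y)).
Proof.
move=> mf f0.
have := @measurable_fun_fubini_tonelli_F _ _ _ _ _ (sfmeas homog) f mf f0.
by congr measurable_fun; apply/funext => x; exact: sfE.
Qed.

Lemma measurable_int_mur (f : Omega * S -> \bar R) : measurable_fun setT f ->
  (forall p, 0 <= f p) -> measurable_fun setT (fun y => \int[mu]_x f (x, y)).
Proof.
move=> mf f0.
have := @measurable_fun_fubini_tonelli_G _ _ _ _ _ (sfmeas homog) f mf f0.
by congr measurable_fun; apply/funext => x; exact: sfE.
Qed.

Lemma tonelli_mu_sf (m : {sigma_finite_measure set S -> \bar R}) (f : Omega * S -> \bar R) :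
  measurable_fun setT f -> (forall p, 0 <= f p) ->
  \int[mu]_x \int[m]_y f (x, y) = \int[m]_y \int[mu]_x f (x, y).
Proof.
move=> mf f0; have := @fubini_tonelli _ _ _ _ _ (sfmeas homog) m f mf f0.
by rewrite sfE => ->; apply: eq_integral => y _; exact: sfE.
Qed.

End Product.

Lemma tonelli_mu_mu (f : Omega * Omega -> \bar R) :
  measurable_fun setT f -> (forall p, 0 <= f p) ->
  \int[mu]_x \int[mu]_y f (x, y) = \int[mu]_y \int[mu]_x f (x, y).
Proof.
move=> mf f0; have := @tonelli_mu_sf _ _ (sfmeas homog) f mf f0.
rewrite sfE => <-; apply: eq_integral => x _; exact/esym/sfE.
Qed.

End Tonelli.

(** * Averages over balls under the doubling condition *)

Section HeatEstimate.
Context {d : measure_display} {R : realType} {Omega : measurableMetricType d R}.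
Variable mu : {measure set Omega -> \bar R}.
Hypothesis homog : homogeneous_type mu.
Local Notation MR := (measurableTypeR R).
Local Notation leb := (@lebesgue_measure R).
Variable D : R.
Hypothesis D1 : 1 <= D.
Hypothesis dbl : forall (x : Omega) (t : R), 0 < t -> vol mu x (2 * t) <= D * vol mu x t.

Let D0 : 0 <= D. Proof. exact: le_trans D1. Qed.

Lemma mu_ballE (x : Omega) (t : R) : mu (ball x t) = (vol mu x t)%:E.
Proof. by rewrite fineK// ge0_fin_numE ?mu_ball_lty. Qed.

Lemma vol_gt0 (x : Omega) (t : R) : 0 < t -> 0 < vol mu x t.
Proof. by move=> t0; rewrite -lte_fin -mu_ballE mu_ball_gt0. Qed.

Lemma vol_ge0 (x : Omega) (t : R) : 0 <= vol mu x t.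
Proof. by rewrite fine_ge0. Qed.

Lemma vol_le (x y : Omega) (a b : R) : mdist y x + a <= b -> vol mu x a <= vol mu y b.
Proof.
move=> h; rewrite -lee_fin -!mu_ballE; apply: le_measure; rewrite ?inE;
  [exact: (measurable_ball homog)..|].
move=> z; rewrite !ballEmdist/= => xz; apply: lt_le_trans h.
by apply: (le_lt_trans (metric_triangle y x z)); rewrite ltrD2l.
Qed.

Lemma vol4 (x : Omega) (t t' : R) : 0 < t -> t' <= 4 * t -> vol mu x t' <= D ^+ 2 * vol mu x t.
Proof.
move=> t0 tt; apply: (@le_trans _ _ (vol mu x (2 * (2 * t)))).
  by apply: vol_le; rewrite mdistxx add0r mulrA -natrM.
apply: (le_trans (dbl _ _)); first by rewrite mulr_gt0.
by rewrite expr2 -mulrA ler_wpM2l// dbl.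
Qed.

Lemma vol8 (x : Omega) (t t' : R) : 0 < t -> t' <= 8 * t -> vol mu x t' <= D ^+ 3 * vol mu x t.
Proof.
move=> t0 tt; apply: (@le_trans _ _ (vol mu x (2 * (4 * t)))).
  by apply: vol_le; rewrite mdistxx add0r mulrA -natrM.
apply: (le_trans (dbl _ _)); first by rewrite mulr_gt0.
by rewrite exprS -mulrA ler_wpM2l// vol4.
Qed.

Lemma measurable_set_dist (A : set (Omega * Omega)) (P : R -> bool) :
  measurable [set r : MR | P r] -> A = [set p | P (mdist p.1 p.2)] -> measurable A.
Proof.
move=> mP ->; have := measurable_dist homog measurableT mP.
by rewrite setTI.
Qed.

(** After Tonelli, the weight of |f(y)|^2 is the integral of 1 / V(x, t) over points x at distance
    at most t from y. These lie in B(y, 2t), and V(y, 2t) <= V(x, 4t) <= D^2 V(x, t), so the weight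
    is at most D^2. As [t <= rho], only y within 2 rho of z contribute. *)
Lemma massL_average (f : L2 mu) (z : Omega) (rho t : R) : 0 < t -> t <= rho ->
  (\int[mu]_(x in ball z rho) (massL (cball x t) f * ((vol mu x t)^-1)%:E)
    <= (D ^+ 2)%:E * massL (cball z (2 * rho)) f)%E.
Proof.
move=> t0 trho.
have mB : measurable (ball z rho) by exact: (measurable_ball homog).
pose A := [set p : Omega * Omega | mdist p.1 p.2 <= t].
have mA : measurable A.
  apply: (@measurable_set_dist _ (fun r => r <= t)) => //.
  by rewrite -set_itvNyc; exact: measurable_itv.
pose k (p : Omega * Omega) : R := \1_(ball z rho) p.1 * \1_A p * (vol mu p.1 t)^-1 * sqa f p.2.
have k0 p : 0 <= k p.
  by rewrite !mulr_ge0 ?indicE ?invr_ge0 ?vol_ge0 ?sqa_ge0.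
have mvol : measurable_fun setT (fun x : Omega => (vol mu x t)^-1).
  rewrite (_ : (fun _ => _) = (fun x => vol mu x t `^ (-1))); last first.
    by apply/funext => x; rewrite powR_inv1// vol_ge0.
  apply: (measurableT_comp (measurable_powR _)).
  exact: (measurable_fun_pair1 t (measurable_vol homog)).
have mk : measurable_fun setT (EFin \o k).
  apply/measurable_EFinP; apply: measurable_funM; [apply: measurable_funM;[apply: measurable_funM|]|].
  - exact: (measurableT_comp (measurable_indic mB)).
  - exact: measurable_indic.
  - exact: (measurableT_comp mvol).
  - by apply: measurableT_comp => //; exact: measurable_sqa.
have e1 : (\int[mu]_(x in ball z rho) (massL (cball x t) f * ((vol mu x t)^-1)%:E) =
  \int[mu]_x \int[mu]_y (k (x, y))%:E)%E.
  rewrite integral_mkcond; apply: eq_integral => x _; rewrite patchE.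
  case: ifPn => xz; last first.
    by rewrite integral0_eq// => y _; rewrite /k/= indicE (negbTE xz) !mul0r.
  rewrite muleC massLZl ?invr_ge0 ?vol_ge0//; last exact: (measurable_cball homog).
  rewrite integral_mkcond; apply: eq_integral => y _; rewrite patchE /k/= indicE xz mul1r.
  rewrite indicE (_ : ((x, y) \in A) = (y \in cball x t)); last by apply/idP/idP; rewrite !inE.
  by case: ifPn => _; rewrite ?mul1r ?mul0r.
have e2 : (\int[mu]_x \int[mu]_y (k (x, y))%:E = \int[mu]_y \int[mu]_x (k (x, y))%:E)%E.
  by apply: (tonelli_mu_mu homog mk) => p; rewrite lee_fin.
rewrite e1 e2 (massLZl f (measurable_cball homog z (2 * rho)) (exprn_ge0 2 D0)).
rewrite [leRHS]integral_mkcond; apply: ge0_le_integral.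
- exact: measurableT.
- by move=> y _; apply: integral_ge0 => x _; rewrite lee_fin.
- by apply: (measurable_int_mur homog mk) => p; rewrite lee_fin.
- apply/(measurable_restrictT _ _).1; first exact: (measurable_cball homog).
  by apply: measurable_funTS; apply/measurable_EFinP; apply: measurable_funM => //; exact: measurable_sqa.
- move=> y _; rewrite patchE.
  have mBy : measurable (ball y (2 * t)) by exact: (measurable_ball homog).
  have vy : 0 < vol mu y (2 * t) by apply: vol_gt0; rewrite mulr_gt0.
  case: ifPn => yz; last first.
    rewrite integral0_eq// => x _; rewrite /k /= indicE.
    case: (boolP (x \in (ball z rho : set Omega))) => [|_]; last by rewrite !mul0r.
    rewrite inE ballEmdist/= mul1r indicE => zx.
    case: (boolP (_ \in A)) => [|_]; last by rewrite !mul0r.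
    rewrite inE /A/= => xy; move/negP: yz; case; rewrite inE /cball/=.
    by have := metric_triangle z x y; lra.
  (* Doubling the radius fits the closed ball of radius [t] into an open one, whose measure is
     [vol]. *)
  apply: (@le_trans _ _ (\int[mu]_x ((D ^+ 2 * (vol mu y (2 * t))^-1 * sqa f y)%:E * (\1_(ball y (2 * t)) x)%:E))%E).
    apply: ge0_le_integral.
    + exact: measurableT.
    + by move=> x _; rewrite lee_fin.
    + exact: (measurableT_comp mk (@pair2_measurable _ _ _ _ y)).
    + by apply: measurable_funeM; apply/measurable_EFinP; exact: measurable_indic.
    + move=> x _; rewrite -EFinM lee_fin /k/= [leRHS]mulrAC ler_wpM2r ?sqa_ge0//.
      have [xy|xy] := boolP ((x, y) \in A); last first.
        by rewrite [\1_A _]indicE (negbTE xy) mulr0 mul0r !mulr_ge0 ?exprn_ge0 ?invr_ge0 ?vol_ge0 ?indicE.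
      move: (xy); rewrite inE /A/= => xyt.
      have yx : x \in (ball y (2 * t) : set Omega) by rewrite inE ballEmdist/= metric_sym; lra.
      rewrite [\1_A _]indicE xy mulr1 [\1_(ball y _) _]indicE yx mulr1.
      apply: (@le_trans _ _ (vol mu x t)^-1).
        by rewrite ler_piMl ?invr_ge0 ?vol_ge0// indicE; case: (_ \in _).
      have vx := vol_gt0 x t0.
      rewrite -ler_pdivrMl ?exprn_gt0 ?(lt_le_trans ltr01 D1)// -invfM lef_pV2 ?posrE ?mulr_gt0 ?exprn_gt0 ?(lt_le_trans ltr01 D1)//.
      apply: (@le_trans _ _ (vol mu x (4 * t))); last exact: vol4.
      by apply: vol_le; lra.
  rewrite ge0_integralZl//; last 2 first.
  + by apply/measurable_EFinP; exact: measurable_indic.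
  + by rewrite lee_fin !mulr_ge0 ?exprn_ge0 ?invr_ge0 ?vol_ge0 ?sqa_ge0.
  rewrite integral_indic// setIT mu_ballE -!EFinM lee_fin mulrAC -(mulrA (D ^+ 2)) mulVf ?gt_eqF//.
  by rewrite mulr1.
Qed.

End HeatEstimate.

Section BallAverage.
Context {d : measure_display} {R : realType} {Omega : measurableMetricType d R}.
Variable mu : {measure set Omega -> \bar R}.
Hypothesis homog : homogeneous_type mu.
Variable D : R.
Hypothesis D1 : 1 <= D.
Hypothesis dbl : forall (x : Omega) (t : R), 0 < t -> vol mu x (2 * t) <= D * vol mu x t.

Lemma measurable_inv_vol (t : R) : measurable_fun setT (fun x : Omega => (vol mu x t)^-1).
Proof.
rewrite (_ : (fun _ => _) = (fun x => vol mu x t `^ (-1))); last first.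
  by apply/funext => x; rewrite powR_inv1// vol_ge0.
apply: (measurableT_comp (measurable_powR _)).
exact: (measurable_fun_pair1 t (measurable_vol homog)).
Qed.

Lemma measurable_ball_rel (t : R) : measurable [set p : Omega * Omega | mdist p.1 p.2 < t].
Proof.
apply: (@measurable_set_dist _ _ _ mu homog _ (fun r => r < t)) => //.
by rewrite -set_itvNyo; exact: measurable_itv.
Qed.

Lemma inv_vol_average (x : Omega) (rho : R) : 0 < rho ->
  ((D^-1)%:E <= \int[mu]_(z in ball x rho) ((vol mu z rho)^-1)%:E)%E.
Proof.
move=> rho0.
have mB : measurable (ball x rho) by exact: (measurable_ball homog).
have Dp : 0 < D by exact: lt_le_trans D1.
have vx := vol_gt0 homog x rho0.
apply: (@le_trans _ _ (\int[mu]_(z in ball x rho) ((D * vol mu x rho)^-1)%:E)%E).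
  rewrite integral_cst// mu_ballE// -EFinM lee_fin invfM -mulrA mulVf ?mulr1//.
  by rewrite gt_eqF.
apply: ge0_le_integral; first exact: mB.
- by move=> z _; rewrite lee_fin invr_ge0 mulr_ge0// ltW.
- exact: measurable_cst.
- by apply: measurable_funTS; apply/measurable_EFinP; exact: measurable_inv_vol.
- move=> z; rewrite ballEmdist/= => xz.
  have vz := vol_gt0 homog z rho0.
  rewrite lee_fin lef_pV2 ?posrE ?mulr_gt0//.
  apply: (@le_trans _ _ (vol mu x (2 * rho))); last exact: dbl.
  by apply: (vol_le homog); lra.
Qed.

(** After Tonelli, the weight of [h x] is the integral of 1 / V(z, rho) over z in B(x, rho), which
    doubling bounds below by 1 / D. *)
Lemma le_ball_average (h : Omega -> \bar R) (rho : R) : 0 < rho ->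
  measurable_fun setT h -> (forall x, 0 <= h x)%E ->
  (\int[mu]_x h x <= D%:E * \int[mu]_z (((vol mu z rho)^-1)%:E * \int[mu]_(x in ball z rho) h x))%E.
Proof.
move=> rho0 mh h0.
have Dp : 0 < D by exact: lt_le_trans D1.
pose A := [set p : Omega * Omega | mdist p.1 p.2 < rho].
have mA : measurable A by exact: measurable_ball_rel.
pose k (p : Omega * Omega) : \bar R := ((\1_A p * (vol mu p.1 rho)^-1)%:E * h p.2)%E.
have w0 p : 0 <= \1_A p * (vol mu p.1 rho)^-1 :> R by rewrite mulr_ge0 ?invr_ge0 ?vol_ge0// indicE.
have k0 p : (0 <= k p)%E by apply: mule_ge0 => //; rewrite lee_fin.
have mw : measurable_fun setT (fun p => \1_A p * (vol mu p.1 rho)^-1).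
  apply: measurable_funM; first exact: measurable_indic.
  exact: (measurableT_comp (measurable_inv_vol rho)).
have mk : measurable_fun setT k.
  apply: emeasurable_funM; first exact/measurable_EFinP.
  exact: measurableT_comp.
have e1 : (\int[mu]_z (((vol mu z rho)^-1)%:E * \int[mu]_(x in ball z rho) h x) =
    \int[mu]_z \int[mu]_x k (z, x))%E.
  apply: eq_integral => z _.
  rewrite -ge0_integralZl; first last.
  - by rewrite lee_fin invr_ge0 vol_ge0.
  - by move=> x _; exact: h0.
  - exact: measurable_funTS.
  - exact: (measurable_ball homog).
  rewrite integral_mkcond; apply: eq_integral => x _; rewrite patchE /k/=.
  rewrite indicE (_ : ((z, x) \in A) = (x \in (ball z rho : set Omega))); last first.
    by apply/idP/idP; rewrite !inE ballEmdist.
  by case: ifPn => _; rewrite ?mul1r// mul0r mul0e.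
rewrite e1 (tonelli_mu_mu homog mk k0) -ge0_integralZl; first last.
- by rewrite lee_fin ltW.
- by move=> x _; apply: integral_ge0.
- exact: (measurable_int_mur homog mk k0).
- exact: measurableT.
apply: ge0_le_integral; first exact: measurableT.
- by move=> x _.
- exact: mh.
- by apply: measurable_funeM; exact: (measurable_int_mur homog mk k0).
move=> x _.
have -> : (\int[mu]_z k (z, x) = h x * \int[mu]_(z in ball x rho) ((vol mu z rho)^-1)%:E)%E.
  rewrite -ge0_integralZl; first last.
  - exact: h0.
  - by move=> z _; rewrite lee_fin invr_ge0 vol_ge0.
  - by apply: measurable_funTS; apply/measurable_EFinP; exact: measurable_inv_vol.
  - exact: (measurable_ball homog).
  rewrite [RHS]integral_mkcond; apply: eq_integral => z _; rewrite patchE /k/=.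
  rewrite indicE (_ : ((z, x) \in A) = (z \in (ball x rho : set Omega))); last first.
    by apply/idP/idP; rewrite !inE ballEmdist/= metric_sym.
  by case: ifPn => _; rewrite ?mul1r ?mul0r ?mul0e// muleC.
rewrite muleCA -[leLHS]mule1; apply: lee_wpmul2l; first exact: h0.
apply: (@le_trans _ _ (D%:E * (D^-1)%:E)%E).
  by rewrite -EFinM mulfV// gt_eqF.
by apply: lee_wpmul2l; [rewrite lee_fin ltW|exact: inv_vol_average].
Qed.

(** Jensen's inequality on the ball, with 1 + C in place of sqrt C: [sqrte_amgm] is integrated with
    a weight close to the square root of [q]. *)
Lemma sqrt_average (h : Omega -> \bar R) (z : Omega) (rho C : R) (q : \bar R) :
  0 < rho -> 0 <= C -> measurable_fun setT h -> (forall x, 0 <= h x)%E -> (0 <= q)%E ->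
  (\int[mu]_(x in ball z rho) h x <= (C * vol mu z rho)%:E * q)%E ->
  (\int[mu]_(x in ball z rho) sqrte (h x) <= (vol mu z rho)%:E * ((1 + C)%:E * sqrte q))%E.
Proof.
move=> rho0 C0 mh h0 q0 hq.
have vz := vol_gt0 homog z rho0.
have mB : measurable (ball z rho) by exact: (measurable_ball homog).
case: q q0 hq => [k| |]//; last first.
  by move=> _ _; rewrite /= !gt0_muley ?lte_fin ?leey// ltr_wpDr.
rewrite lee_fin => k0 hq /=.
apply/lee_addgt0Pr => eta eta0.
have sk := sqr_sqrtr k0; have pk := sqrtr_ge0 k.
(* The second term keeps the weight positive when [k] is 0 and contributes just [eta] after
   integration over the ball. *)
pose e := Num.sqrt k + eta / vol mu z rho.
have e0 : 0 < e by rewrite ltr_wpDl// divr_gt0.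
apply: (@le_trans _ _ (\int[mu]_(x in ball z rho) (e%:E + (e^-1)%:E * h x))%E).
  apply: ge0_le_integral; first exact: mB.
  - by move=> x _; exact: sqrte_ge0.
  - by apply: measurable_funTS; exact: measurable_sqrte.
  - by apply: emeasurable_funD => //; apply: measurable_funeM; exact: measurable_funTS.
  - by move=> x _; exact: sqrte_amgm.
rewrite ge0_integralD; first last.
- by apply: measurable_funeM; exact: measurable_funTS.
- by move=> x _; apply: mule_ge0 => //; rewrite lee_fin invr_ge0 ltW.
- exact: measurable_cst.
- by move=> x _; rewrite lee_fin ltW.
- exact: mB.
rewrite integral_cst// mu_ballE// ge0_integralZl; first last.
- by rewrite lee_fin invr_ge0 ltW.
- by move=> x _; exact: h0.
- exact: measurable_funTS.
- exact: mB.
apply: (@le_trans _ _ (e%:E * (vol mu z rho)%:E + (e^-1)%:E * ((C * vol mu z rho)%:E * k%:E))%E).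
  by rewrite leeD2l// lee_wpmul2l// lee_fin invr_ge0 ltW.
rewrite -!EFinM -!EFinD lee_fin.
have ke : e^-1 * k <= Num.sqrt k.
  by rewrite mulrC ler_pdivrMr// -{1}sk expr2 ler_wpM2l// lerDl divr_ge0// ltW.
have -> : e * vol mu z rho = vol mu z rho * Num.sqrt k + eta.
  by rewrite /e mulrDl divfK ?gt_eqF// mulrC.
have -> : e^-1 * (C * vol mu z rho * k) = (C * vol mu z rho) * (e^-1 * k) by ring.
have : C * vol mu z rho * (e^-1 * k) <= C * vol mu z rho * Num.sqrt k.
  by rewrite ler_wpM2l// mulr_ge0// ltW.
by move: (e^-1 * k) => w; lra.
Qed.

End BallAverage.

Lemma measurable_window (d : measure_display) (R : realType) (T : measurableType d)
    (B : set (measurableTypeR R)) (H : T -> R -> \bar R) : measurable B ->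
  (forall x t, 0 <= H x t)%E ->
  measurable_fun setT (fun p : T * measurableTypeR R => H p.1 p.2) ->
  measurable_fun setT (fun x => \int[@lebesgue_measure R]_(t in B) H x t)%E.
Proof.
move=> mB H0 mH.
pose k (p : T * measurableTypeR R) : \bar R := ((\1_B p.2)%:E * H p.1 p.2)%E.
have mk : measurable_fun setT k.
  apply: emeasurable_funM => //; apply/measurable_EFinP.
  exact: (measurableT_comp (measurable_indic mB) measurable_snd).
have k0 p : (0 <= k p)%E by apply: mule_ge0 => //; rewrite lee_fin indicE.
have := @measurable_fun_fubini_tonelli_F _ _ _ _ _ (@lebesgue_measure R) k mk k0.
congr measurable_fun; apply/funext => x; rewrite /fubini_F [RHS]integral_mkcond.
apply: eq_integral => t _; rewrite patchE /k/= indicE.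
by case: ifPn => _; rewrite ?mul1e// mul0e.
Qed.

(** * The effect of a shift of heights on the restricted square function *)

Section HeatShift.
Context {d : measure_display} {R : realType} {Omega : measurableMetricType d R}.
Variable mu : {measure set Omega -> \bar R}.
Hypothesis homog : homogeneous_type mu.
Local Notation MR := (measurableTypeR R).
Local Notation leb := (@lebesgue_measure R).
Variable D : R.
Hypothesis D1 : 1 <= D.
Hypothesis dbl : forall (x : Omega) (t : R), 0 < t -> vol mu x (2 * t) <= D * vol mu x t.
Variable F : R -> L2 mu.
Hypothesis Fc : forall (u : nat -> R) t, u n @[n --> \oo] --> t -> L2_lim (fun n => F (u n)) (F t).
Variable rho : R.
Hypothesis rho0 : 0 < rho.

Let Dp : 0 < D. Proof. exact: lt_le_trans D1. Qed.

(** With this scale, tau >= 4 rho always; tau^2 <= 17 t^2 if t >= rho, and tau^2 <= 17 rho^2 if t <=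
    rho. Hence the factor 8 in [vol8] serves both ranges. *)
Let s : R := 16 * rho ^+ 2.

Let s0 : 0 < s. Proof. by rewrite mulr_gt0// exprn_gt0. Qed.

Let ta := tau s.

(* For F t = t^2 L e^{-t^2 L} f and s = 16 rho^2 this is the density dens attached
   to e^{-sL} f: at height t, t^2 L e^{-t^2 L} e^{-sL} f = (t / tau)^2 F tau. *)
Definition shift_dens (x : Omega) (t : R) : \bar R :=
  (((t / tau (16 * rho ^+ 2) t) ^+ 4)%:E * dens (F (tau (16 * rho ^+ 2) t)) x t)%E.

Local Notation G := shift_dens.

Let q (x : Omega) (t : R) : \bar R := dens (F t) x t.

Lemma shift_dens_ge0 x t : (0 <= G x t)%E.
Proof. by apply: mule_ge0; [rewrite lee_fin exprn_even_ge0|exact: dens_ge0]. Qed.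

Let ta_gt0 t : 0 < ta t. Proof. exact: tau_gt0. Qed.

(** The closed ball grows with the height, so the mass increases; doubling compares V(x, tau) with
    V(x, t); and (t / tau)^4 / t <= (t / tau) / tau because t <= tau. *)
Lemma shift_dens_up x t : rho <= t ->
  (G x t <= (D ^+ 3)%:E * (q x (ta t) * (t / ta t)%:E))%E.
Proof.
move=> rt; have t0 : 0 < t by exact: lt_le_trans rt.
have tt : t <= ta t by exact: tau_ge.
have vt := vol_gt0 homog x t0; have vta := vol_gt0 homog x (ta_gt0 t).
have t8 : ta t <= 8 * t.
  rewrite -ler_sqr ?nnegrE ?mulr_ge0 ?(ltW t0) ?(ltW (ta_gt0 _))// tau2// /s.
  by move: rt rho0; nra.
have v8 : vol mu x (ta t) <= D ^+ 3 * vol mu x t by exact: (vol8 homog D1 dbl).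
rewrite /G /q /dens -/s -/ta.
rewrite muleCA [leRHS]muleCA -!muleA -!EFinM; apply: lee_pmul.
- exact: massL_ge0.
- by rewrite lee_fin mulr_ge0 ?exprn_even_ge0// invr_ge0 vol_t_ge0.
- apply: massL_subset; [exact: (measurable_cball homog)..|].
  by move=> y; rewrite /cball/= => h; exact: le_trans tt.
rewrite lee_fin.
have D30 : 0 < D ^+ 3 by rewrite exprn_gt0.
move: (D ^+ 3) D30 v8 => C C0; move: (vol mu x (ta t)) vta => w w0.
move: (vol mu x t) (ta t) (ta_gt0 t) vt tt => v T T0 v0 tT v8.
rewrite -subr_ge0 (_ : _ - _ = t / (w * v * T ^+ 4) * (C * v * T ^+ 2 - t ^+ 2 * w)); last first.
  by field; rewrite !gt_eqF.
apply: mulr_ge0; first by rewrite divr_ge0 ?mulr_ge0 ?exprn_ge0// ltW.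
rewrite subr_ge0; apply: (@le_trans _ _ (T ^+ 2 * w)).
  by rewrite ler_wpM2r ?(ltW w0)// ler_sqr ?nnegrE// ltW.
by rewrite mulrC ler_wpM2r// sqr_ge0.
Qed.

(* Averaging the mass of B(x, t) over x in B(z, rho) yields the mass of
   B(z, 2 rho), which is contained in B(z, tau) as tau >= 4 rho. *)
Lemma shift_dens_low z t : 0 < t -> t <= rho ->
  (\int[mu]_(x in ball z rho) G x t <=
   (D ^+ 5 * vol mu z rho)%:E * (q z (ta t) * (t / ta t)%:E))%E.
Proof.
move=> t0 tr.
have mB : measurable (ball z rho) by exact: (measurable_ball homog).
have ta2 : 2 * rho <= ta t.
  rewrite -ler_sqr ?nnegrE ?mulr_ge0 ?(ltW rho0) ?(ltW (ta_gt0 _))// tau2// /s.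
  by move: t0 rho0; nra.
have ta8 : ta t <= 8 * rho.
  rewrite -ler_sqr ?nnegrE ?mulr_ge0 ?(ltW rho0) ?(ltW (ta_gt0 _))// tau2// /s.
  by move: t0 tr rho0; nra.
have vr := vol_gt0 homog z rho0; have vta := vol_gt0 homog z (ta_gt0 t).
have v8 : vol mu z (ta t) <= D ^+ 3 * vol mu z rho by exact: (vol8 homog D1 dbl).
pose c := (t / ta t) ^+ 4 / t.
have c0 : 0 <= c by rewrite divr_ge0 ?exprn_even_ge0// ltW.
apply: (@le_trans _ _ (c%:E * ((D ^+ 2)%:E * massL (cball z (2 * rho)) (F (ta t))))%E).
  have := massL_average homog D1 dbl (F (ta t)) z t0 tr.
  have mm : measurable_fun (ball z rho : set Omega)
      (fun x => massL (cball x t) (F (ta t)) * ((vol mu x t)^-1)%:E)%E.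
    apply: measurable_funTS; apply: emeasurable_funM.
      exact: (measurable_fun_pair1 (t : MR) (measurable_mass homog (F (ta t)))).
    by apply/measurable_EFinP; exact: (measurable_inv_vol homog).
  have mm0 x : (ball z rho : set Omega) x ->
      (0 <= massL (cball x t) (F (ta t)) * ((vol mu x t)^-1)%:E)%E.
    by move=> _; apply: mule_ge0; [exact: massL_ge0|rewrite lee_fin invr_ge0 vol_ge0].
  move=> /(lee_wpmul2l (_ : (0 <= c%:E)%E)); rewrite lee_fin => /(_ c0).
  apply: le_trans; rewrite -ge0_integralZl//.
  rewrite le_eqVlt; apply/orP; left; apply/eqP; apply: eq_integral => x _.
  rewrite /G /dens -/s -/ta muleCA [RHS]muleCA -!EFinM; congr (_ * _%:E)%E.
  by rewrite /c invfM; ring.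
apply: (@le_trans _ _ ((c * D ^+ 2)%:E * massL (cball z (ta t)) (F (ta t)))%E).
  rewrite muleA -EFinM; apply: lee_wpmul2l; first by rewrite lee_fin mulr_ge0// sqr_ge0.
  apply: massL_subset; [exact: (measurable_cball homog)..|].
  by move=> y; rewrite /cball/= => h; exact: le_trans ta2.
rewrite /q /dens -!muleA -!EFinM muleC [leRHS]muleCA -EFinM.
apply: lee_wpmul2l; first exact: massL_ge0.
rewrite lee_fin /c.
have Dp' := Dp.
move: (vol mu z (ta t)) vta v8 => w w0.
move: (vol mu z rho) (ta t) (ta_gt0 t) vr ta2 => v T T0 v0 T2 v8.
have tT : t <= T by move: T2 rho0 tr; lra.
rewrite -subr_ge0 (_ : _ - _ = (D ^+ 2 * t / (T ^+ 4 * w)) * (D ^+ 3 * v * T ^+ 2 - t ^+ 2 * w)); last first.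
  by field; rewrite !gt_eqF.
apply: mulr_ge0; first by rewrite divr_ge0 ?mulr_ge0 ?exprn_ge0// ltW.
rewrite subr_ge0; apply: (@le_trans _ _ (T ^+ 2 * w)).
  by rewrite ler_wpM2r ?(ltW w0)// ler_sqr ?nnegrE// ltW.
by rewrite mulrC ler_wpM2r// sqr_ge0.
Qed.

Lemma measurable_q : measurable_fun setT (fun p : Omega * MR => q p.1 p.2).
Proof. exact: (measurable_dens_family homog Fc). Qed.

Lemma measurable_shift_dens : measurable_fun setT (fun p : Omega * MR => G p.1 p.2).
Proof.
apply: emeasurable_funM.
  apply/measurable_EFinP; apply: measurable_funX.
  exact: (measurableT_comp (measurable_rho s0) measurable_snd).
have Fc' (u : nat -> R) t : u n @[n --> \oo] --> t -> L2_lim (fun n => F (ta (u n))) (F (ta t)).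
  move=> ut; apply: (Fc (u := fun n => ta (u n))).
  by apply: continuous_cvg => //; exact: (continuous_tau s0).
exact: (@measurable_dens_family _ _ _ _ homog (fun t => F (ta t)) Fc').
Qed.

Variable J : set MR.
Hypothesis mJ : measurable J.

Definition shift_window : set MR := [set t | 0 < t /\ J (tau (16 * rho ^+ 2) t)].

Local Notation A := shift_window.

Lemma measurable_shift_window : measurable A.
Proof.
have -> : A = `]0, +oo[%classic `&` (ta @^-1` J).
  by apply/seteqP; split=> t /=; rewrite in_itv/= andbT.
apply: measurableI; first exact: measurable_itv.
by rewrite -[_ @^-1` _]setTI; exact: (measurable_tau s0).
Qed.

Let QJ x : \bar R := (\int[leb]_(t in J) q x t)%E.

Let QJ0 x : (0 <= QJ x)%E.
Proof. by apply: integral_ge0 => t _; exact: dens_ge0. Qed.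

(** Extending the density by zero off [J] makes [time_change_le] applicable and confines the new
    heights to [J]. *)
Let shift_time x (B : set MR) : measurable B -> B `<=` A ->
  (\int[leb]_(t in B) (q x (ta t) * (t / ta t)%:E) <= QJ x)%E.
Proof.
move=> mB BA.
have mq : measurable_fun setT (q x : MR -> \bar R).
  exact: (measurable_fun_pair2 x measurable_q).
pose w : MR -> \bar R := (q x : MR -> \bar R) \_ J.
have w0 t : (0 <= w t)%E by apply: erestrict_ge0 => u _; exact: dens_ge0.
have mw : measurable_fun setT w.
  exact: ((measurable_restrictT _ mJ).1 (measurable_funTS mq)).
have mwt : measurable_fun setT (fun t : MR => (w (ta t) * (t / ta t)%:E)%E).
  apply: emeasurable_funM; first exact: (measurableT_comp mw (measurable_tau s0)).
  by apply/measurable_EFinP; exact: (measurable_rho s0).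
have -> : QJ x = (\int[leb]_t w t)%E by rewrite /QJ integral_mkcond.
apply: le_trans (time_change_le s0 mw w0).
rewrite (_ : (\int[leb]_(t in B) _)%E = (\int[leb]_(t in B) (w (ta t) * (t / ta t)%:E))%E); last first.
  apply: eq_integral => t; rewrite inE => /BA[_ Jt].
  by rewrite /w patchE mem_set.
apply: ge0_subset_integral.
- exact: mB.
- exact: measurable_itv.
- exact: measurable_funTS.
- move=> t; rewrite /= in_itv/= andbT => t0; apply: mule_ge0; first exact: w0.
  by rewrite lee_fin divr_ge0// ltW.
- by move=> t /BA[t0 _]; rewrite /= in_itv/= andbT.
Qed.

Let low : set MR := A `&` `]-oo, rho]%classic.
Let up : set MR := A `&` `]rho, +oo[%classic.

Let mlow : measurable low.
Proof. by apply: measurableI; [exact: measurable_shift_window|exact: measurable_itv]. Qed.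

Let mup : measurable up.
Proof. by apply: measurableI; [exact: measurable_shift_window|exact: measurable_itv]. Qed.

Let mG x : measurable_fun setT (G x : MR -> \bar R).
Proof. exact: (measurable_fun_pair2 x measurable_shift_dens). Qed.

Let mqx x : measurable_fun setT (fun t : MR => (q x (ta t) * (t / ta t)%:E)%E).
Proof.
have mq : measurable_fun setT (q x : MR -> \bar R).
  exact: (measurable_fun_pair2 x measurable_q).
apply: emeasurable_funM; first exact: (measurableT_comp mq (measurable_tau s0)).
by apply/measurable_EFinP; exact: (measurable_rho s0).
Qed.

Let qx0 x t : 0 < t -> (0 <= q x (ta t) * (t / ta t)%:E)%E.
Proof.
by move=> t0; apply: mule_ge0; [exact: dens_ge0|rewrite lee_fin divr_ge0// ltW].
Qed.

Lemma shift_up x : (\int[leb]_(t in up) G x t <= (D ^+ 3)%:E * QJ x)%E.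
Proof.
apply: (@le_trans _ _ (\int[leb]_(t in up) ((D ^+ 3)%:E * (q x (ta t) * (t / ta t)%:E)))%E).
  apply: ge0_le_integral; first exact: mup.
  - by move=> t _; exact: shift_dens_ge0.
  - exact: measurable_funTS.
  - by apply: measurable_funTS; exact: measurable_funeM.
  - by move=> t [_ /=]; rewrite in_itv/= andbT => rt; apply: shift_dens_up; exact: ltW.
rewrite ge0_integralZl; first last.
- by rewrite lee_fin exprn_ge0// ltW.
- by move=> t [[t0 _] _]; exact: qx0.
- exact: measurable_funTS.
- exact: mup.
apply: lee_wpmul2l; first by rewrite lee_fin exprn_ge0// ltW.
by apply: shift_time => // t [].
Qed.

Let Low x : \bar R := (\int[leb]_(t in low) G x t)%E.

Let Low0 x : (0 <= Low x)%E.
Proof. by apply: integral_ge0 => t _; exact: shift_dens_ge0. Qed.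

Lemma shift_low_average z :
  (\int[mu]_(x in ball z rho) Low x <= (D ^+ 5 * vol mu z rho)%:E * QJ z)%E.
Proof.
have mB : measurable (ball z rho) by exact: (measurable_ball homog).
have C0 : 0 <= D ^+ 5 * vol mu z rho by rewrite mulr_ge0 ?vol_ge0// exprn_ge0// ltW.
pose k (p : Omega * MR) : \bar R := ((\1_(ball z rho) p.1 * \1_low p.2)%:E * G p.1 p.2)%E.
have mk : measurable_fun setT k.
  apply: emeasurable_funM; last exact: measurable_shift_dens.
  apply/measurable_EFinP; apply: measurable_funM.
    exact: (measurableT_comp (measurable_indic mB) measurable_fst).
  exact: (measurableT_comp (measurable_indic mlow) measurable_snd).
have k0 p : (0 <= k p)%E.
  by apply: mule_ge0; [rewrite lee_fin mulr_ge0// indicE|exact: shift_dens_ge0].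
have -> : (\int[mu]_(x in ball z rho) Low x = \int[mu]_x \int[leb]_t k (x, t))%E.
  rewrite integral_mkcond; apply: eq_integral => x _; rewrite patchE; case: ifPn => xz.
    rewrite /Low integral_mkcond; apply: eq_integral => t _; rewrite patchE /k/=.
    by rewrite [\1_(ball _ _) _]indicE xz mul1r indicE; case: ifPn => _; rewrite ?mul1e ?mul0e.
  by rewrite integral0_eq// => t _; rewrite /k/= indicE (negbTE xz) mul0r mul0e.
rewrite (tonelli_mu_sf homog leb mk k0).
apply: (@le_trans _ _ (\int[leb]_(t in low) ((D ^+ 5 * vol mu z rho)%:E * (q z (ta t) * (t / ta t)%:E)))%E).
  rewrite [leRHS]integral_mkcond; apply: ge0_le_integral; first exact: measurableT.
  - by move=> t _; apply: integral_ge0.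
  - exact: (measurable_int_mur homog mk k0).
  - exact: ((measurable_restrictT _ mlow).1 (measurable_funTS (measurable_funeM _ (mqx z)))).
  - move=> t _; rewrite patchE; case: ifPn => tl; last first.
      by rewrite integral0_eq// => x _; rewrite /k/= [\1_low _]indicE (negbTE tl) mulr0 mul0e.
    move: (tl); rewrite inE => -[[t0 _] /=]; rewrite in_itv/= => tr.
    apply: le_trans (shift_dens_low z t0 tr).
    rewrite [leRHS]integral_mkcond le_eqVlt; apply/orP; left; apply/eqP.
    apply: eq_integral => x _; rewrite patchE /k/= [\1_low _]indicE tl mulr1 indicE.
    by case: ifPn => _; rewrite ?mul1e ?mul0e.
rewrite ge0_integralZl; first last.
- by rewrite lee_fin.
- by move=> t [[t0 _] _]; exact: qx0.
- exact: measurable_funTS.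
- exact: mlow.
apply: lee_wpmul2l; first by rewrite lee_fin.
by apply: shift_time => // t [].
Qed.

(** The pointwise bound for heights above [rho] costs D^3. Below [rho] only averages over balls are
    controlled: D is the price of replacing an integral by the integral of its averages, 1 + D^5
    that of taking the square root out of an average. *)
Lemma shift_window_le :
  (\int[mu]_x sqrte (\int[leb]_(t in A) G x t) <=
   (D ^+ 3 + D * (1 + D ^+ 5))%:E * \int[mu]_x sqrte (\int[leb]_(t in J) q x t))%E.
Proof.
have mQJ : measurable_fun setT QJ.
  by apply: measurable_window => //; [move=> x t; exact: dens_ge0|exact: measurable_q].
have mLow : measurable_fun setT Low.
  by apply: measurable_window => //; [exact: shift_dens_ge0|exact: measurable_shift_dens].
have msQ : measurable_fun setT (fun x => sqrte (QJ x)) by exact: measurable_sqrte.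
have msL : measurable_fun setT (fun x => sqrte (Low x)) by exact: measurable_sqrte.
have D30 : 0 <= D ^+ 3 by rewrite exprn_ge0// ltW.
have D50 : 0 <= D ^+ 5 by rewrite exprn_ge0// ltW.
apply: (@le_trans _ _ (\int[mu]_x (sqrte (Low x) + (D ^+ 3)%:E * sqrte (QJ x)))%E).
  apply: ge0_le_integral; first exact: measurableT.
  - by move=> x _; exact: sqrte_ge0.
  - apply: measurable_sqrte.
      by move=> x; apply: integral_ge0 => t _; exact: shift_dens_ge0.
    by apply: measurable_window; [exact: measurable_shift_window|exact: shift_dens_ge0|exact: measurable_shift_dens].
  - by apply: emeasurable_funD => //; exact: measurable_funeM.
  - move=> x _.
    have -> : A = low `|` up.
      rewrite -setIUr -[LHS]setIT; congr (_ `&` _).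
      by apply/seteqP; split=> t // _; have [tr|tr] := leP t rho; [left|right]; rewrite /= in_itv/= ?andbT.
    rewrite ge0_integral_setU; first last.
    - rewrite disj_set2E; apply/eqP; rewrite -subset0 => t [[_ /=] + [_ /=]].
      by rewrite !in_itv/= andbT => tr; rewrite ltNge tr.
    - by move=> t _; exact: shift_dens_ge0.
    - exact: measurable_funTS.
    - exact: mup.
    - exact: mlow.
    apply: (le_trans (sqrteD_le _ _)).
    - exact: Low0.
    - by apply: integral_ge0 => t _; exact: shift_dens_ge0.
    rewrite leeD2l//; apply: (@le_trans _ _ (sqrte ((D ^+ 3)%:E * QJ x))%E).
      by rewrite lee_sqrt ?shift_up//; apply: mule_ge0; [rewrite lee_fin|exact: QJ0].
    by apply: sqrte_scale_le; [exact: exprn_ege1|exact: QJ0].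
rewrite ge0_integralD; first last.
- exact: measurable_funeM.
- by move=> x _; apply: mule_ge0; [rewrite lee_fin|exact: sqrte_ge0].
- exact: msL.
- by move=> x _; exact: sqrte_ge0.
- exact: measurableT.
rewrite ge0_integralZl; first last.
- by rewrite lee_fin.
- by move=> x _; exact: sqrte_ge0.
- exact: msQ.
- exact: measurableT.
rewrite [X in (_ <= X%:E * _)%E]addrC EFinD ge0_muleDl ?lee_fin//; last first.
  by rewrite mulr_ge0 ?addr_ge0// ltW.
rewrite leeD2r//.
apply: (le_trans (le_ball_average homog D1 dbl rho0 msL (fun x => sqrte_ge0 _))).
rewrite EFinM -muleA; apply: lee_wpmul2l; first by rewrite lee_fin ltW.
rewrite -ge0_integralZl; first last.
- by rewrite lee_fin addr_ge0.
- by move=> x _; exact: sqrte_ge0.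
- exact: msQ.
- exact: measurableT.
apply: ge0_le_integral; first exact: measurableT.
- move=> z _; apply: mule_ge0; first by rewrite lee_fin invr_ge0 vol_ge0.
  by apply: integral_ge0 => x _; exact: sqrte_ge0.
- apply: emeasurable_funM; first by apply/measurable_EFinP; exact: (measurable_inv_vol homog).
  pose B := [set p : Omega * Omega | mdist p.1 p.2 < rho].
  have mB : measurable B by exact: (measurable_ball_rel homog).
  pose k (p : Omega * Omega) : \bar R := ((\1_B p)%:E * sqrte (Low p.2))%E.
  have mk : measurable_fun setT k.
    apply: emeasurable_funM; first by apply/measurable_EFinP; exact: measurable_indic.
    exact: (measurableT_comp msL measurable_snd).
  have k0 p : (0 <= k p)%E by apply: mule_ge0; [rewrite lee_fin indicE|exact: sqrte_ge0].
  have := measurable_int_mul homog mk k0.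
  congr measurable_fun; apply/funext => z; rewrite [RHS]integral_mkcond.
  apply: eq_integral => x _; rewrite patchE /k/= indicE.
  rewrite (_ : ((z, x) \in B) = (x \in (ball z rho : set Omega))); last first.
    by apply/idP/idP; rewrite !inE ballEmdist.
  by case: ifPn => _; rewrite ?mul1e ?mul0e.
- exact: measurable_funeM.
- move=> z _.
  have vz := vol_gt0 homog z rho0.
  have := sqrt_average homog rho0 D50 mLow Low0 (QJ0 z) (shift_low_average z).
  move=> /(lee_wpmul2l (_ : (0 <= ((vol mu z rho)^-1)%:E)%E)).
  rewrite lee_fin invr_ge0 vol_ge0 => /(_ isT) h; apply: (le_trans h).
  by rewrite muleA -EFinM mulVf ?gt_eqF// mul1e.
Qed.

End HeatShift.

(** * The Hardy norm and the heat semigroup *)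

Section SqrtLimits.
Local Open Scope ereal_scope.
Context {R : realType}.

Lemma limn_einfE (u : (\bar R)^nat) : limn_einf u = ereal_sup (range (einfs u)).
Proof. by rewrite limn_einf_lim; apply: cvg_lim => //; exact: cvg_einfs_sup. Qed.

(** Links the two applications of Fatou's lemma in [cone_norm_lim]. Both sides are squared, so that
    monotonicity of the root suffices. *)
Lemma limn_einf_sqrte (u : (\bar R)^nat) : (forall n, 0 <= u n) ->
  sqrte (limn_einf u) <= limn_einf (fun n => sqrte (u n)).
Proof.
move=> u0; set l := limn_einf (fun n => sqrte (u n)).
have l0 : 0 <= l.
  apply: (@le_trans _ _ (einfs (fun n => sqrte (u n)) 0%N)).
    by apply: le_ereal_inf_tmp => _ [k _ <-]; exact: sqrte_ge0.
  by rewrite /l limn_einfE; apply: ereal_sup_ubound; exists 0%N.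
rewrite -[leRHS]gee0_abs// -sqrte_sqr lee_sqrt; last exact: expe_ge0.
rewrite limn_einfE; apply: ge_ereal_sup => _ [n _ <-].
have e0 : 0 <= einfs u n by apply: le_ereal_inf_tmp => _ [k _ <-].
have h : sqrte (einfs u n) <= l.
  apply: (@le_trans _ _ (einfs (fun n => sqrte (u n)) n)).
    apply: le_ereal_inf_tmp => _ [k /= nk <-]; rewrite lee_sqrt//.
    by apply: ereal_inf_lbound; exists k.
  by rewrite /l limn_einfE; apply: ereal_sup_ubound; exists n.
by rewrite -[leLHS]sqr_sqrte// !expe2; apply: lee_pmul => //; exact: sqrte_ge0.
Qed.

End SqrtLimits.

(** * The Hardy norm with heights restricted to a window *)

Section HardyFunctional.
Context {d : measure_display} {R : realType} {Omega : measurableMetricType d R}.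
Variable mu : {measure set Omega -> \bar R}.
Hypothesis homog : homogeneous_type mu.
Variable E : spectral_measure mu.
Local Notation MR := (measurableTypeR R).
Local Notation leb := (@lebesgue_measure R).

Lemma doubling_constant : exists2 D : R, 1 <= D &
  forall (x : Omega) (t : R), 0 < t -> vol mu x (2 * t) <= D * vol mu x t.
Proof.
have [_ _ [C C0 h]] := homog; exists (Num.max 1 C); first by rewrite le_max lexx.
move=> x t t0; have := h x t t0.
rewrite !(mu_ballE homog) -EFinM lee_fin => /le_trans; apply.
by apply: ler_wpM2r; [exact: vol_ge0|rewrite le_max lexx orbT].
Qed.

Lemma continuous_qfun (x : MR) : continuous (fun t : R => qfun t x).
Proof.
move=> t; rewrite /qfun /hfun.
have ct2 : (fun t : R => t ^+ 2) @ t --> t ^+ 2 by exact: exprn_continuous.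
apply: cvgM.
  by apply: cvgMr_tmp.
apply: continuous_comp; last exact: continuous_expR.
by apply: cvgMr_tmp; exact: cvgN.
Qed.

Lemma fcalc_qfun_cvg (f : L2 mu) (u : nat -> R) t : u n @[n --> \oo] --> t ->
  L2_lim (fun n => fcalc E (qfun (u n)) f) (fcalc E (qfun t) f).
Proof.
move=> ut; apply: (@fcalc_cvg _ _ _ _ E _ _ 1).
- by move=> n; exact: measurable_qfun.
- exact: measurable_qfun.
- by move=> n x; have /andP[q0 q1] := qfun_bound (u n) x; rewrite ger0_norm.
- by move=> x; have /andP[q0 q1] := qfun_bound t x; rewrite ger0_norm.
- by move=> x; apply: (cvg_comp u (fun t : R => qfun t x) ut); exact: continuous_qfun.
Qed.

Lemma densZ (a : R) (f : L2 mu) x t : dens (a%:C *: f) x t = ((a ^+ 2)%:E * dens f x t)%E.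
Proof. by rewrite /dens massLZ ?muleA//; exact: (measurable_cball homog). Qed.

Lemma densD (e : R) (f g : L2 mu) x t : 0 < e ->
  (dens (f + g)%R x t <= (1 + e)%:E * dens f x t + (1 + e^-1)%:E * dens g x t)%E.
Proof.
move=> e0; rewrite /dens !muleA -ge0_muleDl.
- apply: lee_wpmul2r; first by rewrite lee_fin invr_ge0 vol_t_ge0.
  by apply: massLD => //; exact: (measurable_cball homog).
- by apply: mule_ge0; [rewrite lee_fin addr_ge0// ltW|exact: massL_ge0].
- by apply: mule_ge0; [rewrite lee_fin addr_ge0// invr_ge0 ltW|exact: massL_ge0].
Qed.

(* The square of S_h f, with the cone restricted to the heights in J. *)
Definition cone_sq (J : set MR) (f : L2 mu) (x : Omega) : \bar R :=
  (\int[leb]_(t in J) dens (fcalc E (qfun t) f) x t)%E.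

Definition cone_norm (J : set MR) (f : L2 mu) : \bar R :=
  (\int[mu]_x sqrte (cone_sq J f x))%E.

Lemma cone_sq_ge0 J f x : (0 <= cone_sq J f x)%E.
Proof. by apply: integral_ge0 => t _; exact: dens_ge0. Qed.

Lemma cone_norm_ge0 J f : (0 <= cone_norm J f)%E.
Proof. by apply: integral_ge0 => x _; exact: sqrte_ge0. Qed.

Lemma measurable_dens_qfun f :
  measurable_fun setT (fun p : Omega * MR => dens (fcalc E (qfun p.2) f) p.1 p.2).
Proof.
exact: (@measurable_dens_family _ _ _ _ homog (fun t => fcalc E (qfun t) f)
  (fcalc_qfun_cvg f)).
Qed.

Lemma measurable_dens_qfun1 f x :
  measurable_fun setT (fun t : MR => dens (fcalc E (qfun t) f) x t).
Proof. exact: (measurable_fun_pair2 x (measurable_dens_qfun f)). Qed.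

Section Window.
Variable J : set MR.
Hypothesis mJ : measurable J.

Lemma measurable_cone_sq f : measurable_fun setT (cone_sq J f).
Proof.
by apply: measurable_window => //; [move=> x t; exact: dens_ge0|exact: measurable_dens_qfun].
Qed.

Lemma measurable_sqrt_cone f : measurable_fun setT (fun x => sqrte (cone_sq J f x)).
Proof. by apply: measurable_sqrte; [exact: cone_sq_ge0|exact: measurable_cone_sq]. Qed.

Lemma cone_sqD (e : R) f g x : 0 < e ->
  (cone_sq J (f + g)%R x <= (1 + e)%:E * cone_sq J f x + (1 + e^-1)%:E * cone_sq J g x)%E.
Proof.
move=> e0; have d0 h t := dens_ge0 (fcalc E (qfun t) h) x t.
have e1 : 0 <= 1 + e by rewrite addr_ge0// ltW.
have e2 : 0 <= 1 + e^-1 by rewrite addr_ge0// invr_ge0 ltW.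
have md h := measurable_funTS (D := J) (measurable_dens_qfun1 h x).
rewrite -!ge0_integralZl//; try by move=> t _; exact: d0.
rewrite -ge0_integralD//; first last.
- exact: measurable_funeM.
- by move=> t _; apply: mule_ge0; rewrite ?lee_fin.
- exact: measurable_funeM.
- by move=> t _; apply: mule_ge0; rewrite ?lee_fin.
apply: ge0_le_integral => //.
- by apply: emeasurable_funD; exact: measurable_funeM.
- move=> t _; rewrite fcalcD; first exact: densD.
  exact: bmf_qfun.
Qed.

Lemma cone_sqZ (a : R) f x : cone_sq J (a%:C *: f) x = ((a ^+ 2)%:E * cone_sq J f x)%E.
Proof.
rewrite -ge0_integralZl//; first last.
- by rewrite lee_fin sqr_ge0.
- by move=> t _; exact: dens_ge0.
- exact: (measurable_funTS (measurable_dens_qfun1 f x)).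
apply: eq_integral => t _.
by rewrite -densZ fcalcZ//; exact: bmf_qfun.
Qed.

Lemma cone_normD f g : (cone_norm J (f + g)%R <= cone_norm J f + cone_norm J g)%E.
Proof.
rewrite -ge0_integralD//; first last.
- exact: measurable_sqrt_cone.
- by move=> x _; exact: sqrte_ge0.
- exact: measurable_sqrt_cone.
- by move=> x _; exact: sqrte_ge0.
apply: ge0_le_integral => //.
- by move=> x _; exact: sqrte_ge0.
- exact: measurable_sqrt_cone.
- by apply: emeasurable_funD; exact: measurable_sqrt_cone.
- move=> x _; apply: sqrte_triangle; [exact: cone_sq_ge0..|].
  by move=> e e0; exact: cone_sqD.
Qed.

Lemma cone_normZ (a : R) f : cone_norm J (a%:C *: f) = (`|a|%:E * cone_norm J f)%E.
Proof.
rewrite -ge0_integralZl//; first last.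
- by move=> x _; exact: sqrte_ge0.
- exact: measurable_sqrt_cone.
apply: eq_integral => x _; rewrite cone_sqZ.
by rewrite -sqrte_scale// real_normK// num_real.
Qed.

Lemma cone_normB f g : (cone_norm J (f - g)%R <= cone_norm J f + cone_norm J g)%E.
Proof.
apply: (le_trans (cone_normD _ _)); rewrite -scaleN1r.
rewrite (_ : -1 = (-1)%:C :> R[i]); last by rewrite rmorphN.
by rewrite cone_normZ normrN1 mul1e.
Qed.

(** Lower semicontinuity for L2 convergence. At a fixed height the densities converge; Fatou's lemma
    is applied in the height and then, after the square root, in the position. *)
Lemma cone_norm_lim (f_ : nat -> L2 mu) f (c : \bar R) : L2_lim f_ f ->
  (\forall n \near \oo, (cone_norm J (f_ n) <= c)%E) -> (cone_norm J f <= c)%E.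
Proof.
move=> f_f f_c.
have sqle x : (cone_sq J f x <= limn_einf (fun n => cone_sq J (f_ n) x))%E.
  have cvd t : dens (fcalc E (qfun t) (f_ n)) x t @[n --> \oo] --> dens (fcalc E (qfun t) f) x t.
    have cq : L2_lim (fun n => fcalc E (qfun t) (f_ n)) (fcalc E (qfun t) f).
      have bq : bmf (qfun t) by exact: bmf_qfun.
      apply: (squeeze_cvgr _ (cvg_cst 0) f_f); apply: nearW => n; rewrite nsq_ge0/=.
      rewrite -fcalc_subr//; apply: fcalc_nsq_le => // y.
      by have /andP[q0 q1] := qfun_bound t y; rewrite ger0_norm.
    have mc := measurable_cball homog x t.
    apply: cvgeZr => //; exact: massL_cvg.
  apply: (@le_trans _ _ (\int[leb]_(t in J) limn_einf (fun n => dens (fcalc E (qfun t) (f_ n)) x t))%E).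
    rewrite le_eqVlt; apply/orP; left; apply/eqP; apply: eq_integral => t _.
    by have [-> _] := cvg_limn_einf_sup (cvd t).
  apply: fatou => //.
  - by move=> n; exact: (measurable_funTS (measurable_dens_qfun1 (f_ n) x)).
  - by move=> n t _; exact: dens_ge0.
apply: (@le_trans _ _ (\int[mu]_x limn_einf (fun n => sqrte (cone_sq J (f_ n) x)))%E).
  apply: ge0_le_integral => //.
  - by move=> x _; exact: sqrte_ge0.
  - exact: measurable_sqrt_cone.
  - rewrite /limn_einf; apply: measurableT_comp => //.
    apply: measurable_fun_limn_esup => n; apply: measurableT_comp => //.
    exact: measurable_sqrt_cone.
  - move=> x _; apply: le_trans (limn_einf_sqrte _); last by move=> n; exact: cone_sq_ge0.
    by rewrite lee_sqrt ?sqle//; apply: le_trans (sqle x); exact: cone_sq_ge0.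
apply: le_trans (limn_einf_le_near f_c).
apply: fatou => //.
- by move=> n; exact: measurable_sqrt_cone.
- by move=> n x _; exact: sqrte_ge0.
Qed.

End Window.

Lemma fcalc_qfun_heat (s t : R) (f : L2 mu) : 0 < s -> 0 < t ->
  fcalc E (qfun t) (fcalc E (hfun s) f) =
  ((t / tau s t) ^+ 2)%:C *: fcalc E (qfun (tau s t)) f.
Proof.
move=> s0 t0; have bq u : bmf (qfun u : MR -> R) by exact: bmf_qfun.
have bh : bmf (hfun s : MR -> R) by apply: bmf_hfun; exact: ltW.
rewrite fcalc_comp// -fcalc_scale//.
congr (fcalc E _ f); apply/funext => y; rewrite /qfun tau2//.
have -> : hfun (t ^+ 2 + s) y = hfun (t ^+ 2) y * hfun s y.
  by rewrite /hfun -expRD; congr expR; ring.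
rewrite expr_div_n tau2// !mulrA; congr (_ * _ * _ * _).
by rewrite divfK// gt_eqF// addr_gt0// exprn_gt0.
Qed.

Lemma dens_heat (rho t : R) f x : 0 < rho -> 0 < t ->
  dens (fcalc E (qfun t) (fcalc E (hfun (16 * rho ^+ 2)) f)) x t =
  shift_dens (fun t => fcalc E (qfun t) f) rho x t.
Proof.
move=> rho0 t0; have s0 : 0 < 16 * rho ^+ 2 by rewrite mulr_gt0// exprn_gt0.
by rewrite fcalc_qfun_heat// densZ /shift_dens -exprM.
Qed.

(** Two windows are allowed because the shift raises heights: taking both to be all positive heights
    gives the uniform bound, and taking them away from a compact range controls the tails in
    [cone_norm_heat_cvg]. *)
Lemma cone_norm_heat : exists2 K : R, 1 <= K & forall (s : R) (J J' : set MR) (f : L2 mu),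
  0 < s -> measurable J -> measurable J' ->
  (forall t, J' t -> 0 < t /\ J (tau s t)) ->
  (cone_norm J' (fcalc E (hfun s) f) <= K%:E * cone_norm J f)%E.
Proof.
have [D D1 dbl] := doubling_constant.
exists (D ^+ 3 + D * (1 + D ^+ 5)).
  have p3 : 1 <= D ^+ 3 by exact: exprn_ege1.
  have p5 : 1 <= D ^+ 5 by exact: exprn_ege1.
  by move: D1 p3 p5; nra.
move=> s J J' f s0 mJ mJ' J'J.
pose rho := Num.sqrt s / 4.
have rho0 : 0 < rho by rewrite divr_gt0// sqrtr_gt0.
have sE : s = 16 * rho ^+ 2.
  by rewrite /rho expr_div_n sqr_sqrtr ?(ltW s0)//; field.
have Fc := fcalc_qfun_cvg f.
apply: le_trans (shift_window_le homog D1 dbl Fc rho0 mJ).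
apply: ge0_le_integral => //.
- by move=> x _; exact: sqrte_ge0.
- exact: measurable_sqrt_cone.
- apply: measurable_sqrte.
    by move=> x; apply: integral_ge0 => t _; exact: shift_dens_ge0.
  apply: measurable_window; [exact: measurable_shift_window|exact: shift_dens_ge0|].
  exact: (measurable_shift_dens homog Fc rho0).
move=> x _; rewrite lee_sqrt; last by apply: integral_ge0 => t _; exact: shift_dens_ge0.
rewrite /cone_sq sE.
rewrite (_ : (\int[leb]_(t in J') _)%E =
    (\int[leb]_(t in J') shift_dens (fun t => fcalc E (qfun t) f) rho x t)%E); last first.
  by apply: eq_integral => t; rewrite inE => /J'J[t0 _]; exact: dens_heat.
apply: ge0_subset_integral => //.
- exact: measurable_shift_window.
- apply: measurable_funTS.
  exact: (measurable_fun_pair2 x (measurable_shift_dens homog Fc rho0)).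
- by move=> t _; exact: shift_dens_ge0.
- by move=> t /J'J; rewrite sE.
Qed.

End HardyFunctional.

Lemma dominated_cvg0 {d : measure_display} {S : measurableType d} {R : realType}
    (m : {measure set S -> \bar R})
    (D : set S) (f_ : nat -> S -> \bar R) (g : S -> \bar R) :
  measurable D -> (forall n, measurable_fun D (f_ n)) ->
  measurable_fun D g -> (\int[m]_(x in D) g x < +oo)%E ->
  (forall n x, D x -> 0 <= f_ n x <= g x)%E ->
  (forall x, D x -> g x < +oo -> f_ n x @[n --> \oo] --> 0)%E ->
  (\int[m]_(x in D) f_ n x)%E @[n --> \oo] --> 0%E.
Proof.
move=> mD mf mg ig fg f0.
have g0 x : D x -> (0 <= g x)%E by move=> Dx; have /andP[a b] := fg 0%N x Dx; exact: le_trans b.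
have Ig : m.-integrable D g.
  apply/integrableP; split=> //; apply: le_lt_trans ig; rewrite le_eqVlt; apply/orP; left.
  by apply/eqP/eq_integral => x; rewrite inE => /g0/gee0_abs.
have a1 : {ae m, forall x, D x -> f_ n x @[n --> \oo] --> 0%E}.
  have := integrable_ae mD Ig; apply: filterS => x gx Dx; apply: f0 => //.
  by rewrite ltey_eq gx.
have a2 : {ae m, forall x n, D x -> (`|f_ n x| <= g x)%E}.
  by apply: aeW => x n Dx; have /andP[a b] := fg n x Dx; rewrite gee0_abs.
have [_ _] := dominated_convergence mD mf (measurable_cst _) a1 Ig a2.
by rewrite integral0.
Qed.

Lemma cvge0P {R : realType} (u : (\bar R)^nat) : (forall n, 0 <= u n)%E ->
  (u n @[n --> \oo] --> 0%E) <->
  (forall e : R, 0 < e -> \forall n \near \oo, (u n <= e%:E)%E).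
Proof.
move=> u0; split=> [/fine_cvgP[fu /cvgrPdist_le h] e e0|h].
  near=> n; have fun_ : u n \is a fin_num by near: n.
  rewrite -(fineK fun_) lee_fin.
  have : `|0 - fine (u n)| <= e by near: n; exact: h.
  by rewrite sub0r normrN ger0_norm// fine_ge0.
apply/fine_cvgP; split.
  by apply: filterS (h 1 ltr01) => n un; rewrite ge0_fin_numE// (le_lt_trans un)// ltry.
apply/cvgrPdist_le => e e0; apply: filterS (h e e0) => n un /=.
rewrite sub0r normrN ger0_norm ?fine_ge0// -lee_fin fineK//.
by rewrite ge0_fin_numE// (le_lt_trans un)// ltry.
Unshelve. all: by end_near. Qed.

Lemma sqrte_cvg0 {R : realType} (u : (\bar R)^nat) : (forall n, 0 <= u n)%E ->
  u n @[n --> \oo] --> 0%E -> sqrte (u n) @[n --> \oo] --> 0%E.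
Proof.
move=> u0 /(cvge0P u0) h; apply/cvge0P; first by move=> n; exact: sqrte_ge0.
move=> e e0; apply: filterS (h _ (exprn_gt0 2 e0)) => n un.
rewrite (_ : e%:E = sqrte (e ^+ 2)%:E); last by rewrite /= sqrtr_sqr gtr0_norm.
by rewrite lee_sqrt// lee_fin exprn_ge0// ltW.
Qed.

(** * Strong continuity of the heat semigroup on the dense subspace *)

Section HeatContinuity.
Context {d : measure_display} {R : realType} {Omega : measurableMetricType d R}.
Variable mu : {measure set Omega -> \bar R}.
Hypothesis homog : homogeneous_type mu.
Variable E : spectral_measure mu.
Local Notation MR := (measurableTypeR R).
Local Notation leb := (@lebesgue_measure R).
Local Notation T := (`]0%R, +oo[%classic : set MR).

(** The passage from L and the square function to bounded symbols; the estimates are all carried out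
    on [cone_norm]. *)
Lemma hardy_enormE (L : unbounded_operator mu) : self_adjoint L -> nonnegative_operator L ->
  is_spectral_resolution E L -> forall f, hardy_enorm L E f = cone_norm E T f.
Proof.
move=> L_sa L_ge0 E_L f; apply: eq_integral => x _; congr sqrte.
apply: eq_integral => t; rewrite inE /= in_itv/= andbT => t0.
have mc := measurable_cball homog x t.
rewrite /dens muleC massLZl//; last by rewrite invr_ge0 vol_t_ge0.
apply: eq_integral => y _; rewrite (L_heatE L_sa L_ge0 E_L)// cabs2E.
by rewrite mulrC.
Qed.

(** The numerator 2 leaves room for the shift. If t < 1 / (m + 1) and s <= 1 / (m + 1)^2, then tau^2
    < (2 / (m + 1))^2, so heights outside [1 / (m + 1), m + 1] are moved into [far m]. *)
Definition far (m : nat) : set MR := T `\` `[2 / m.+1%:R, m.+1%:R]%classic.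

Lemma measurable_far m : measurable (far m).
Proof. by apply: measurableD; exact: measurable_itv. Qed.

Lemma cone_sq_subset (J J' : set MR) f x : measurable J -> measurable J' -> J `<=` J' ->
  (cone_sq E J f x <= cone_sq E J' f x)%E.
Proof.
move=> mJ mJ' JJ'; apply: ge0_subset_integral => //.
  exact: (measurable_funTS (measurable_dens_qfun1 homog E f x)).
by move=> t _; exact: dens_ge0.
Qed.

Lemma cone_norm_subset (J J' : set MR) f : measurable J -> measurable J' -> J `<=` J' ->
  (cone_norm E J f <= cone_norm E J' f)%E.
Proof.
move=> mJ mJ' JJ'; apply: ge0_le_integral => //.
- by move=> x _; exact: sqrte_ge0.
- exact: measurable_sqrt_cone.
- exact: measurable_sqrt_cone.
- by move=> x _; rewrite lee_sqrt ?cone_sq_ge0//; exact: cone_sq_subset.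
Qed.

(** Dominated convergence in the position, and inside it in the height: finiteness of the norm makes
    the square function finite almost everywhere. *)
Lemma cone_norm_far f : (cone_norm E T f < +oo)%E ->
  cone_norm E (far m) f @[m --> \oo] --> 0%E.
Proof.
move=> fT; have mT : measurable T by exact: measurable_itv.
have md x := measurable_dens_qfun1 homog E f x.
have farT m : far m `<=` T by move=> t [].
apply: (@dominated_cvg0 _ _ _ mu setT (fun m x => sqrte (cone_sq E (far m) f x))
  (fun x => sqrte (cone_sq E T f x))) => //.
- by move=> m; apply: measurable_sqrt_cone => //; exact: measurable_far.
- exact: measurable_sqrt_cone.
- move=> m x _; rewrite sqrte_ge0 lee_sqrt ?cone_sq_ge0//.
  by apply: cone_sq_subset => //; exact: measurable_far.
move=> x _ Qx; apply: sqrte_cvg0; first by move=> m; exact: cone_sq_ge0.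
have {Qx}Qx : (cone_sq E T f x < +oo)%E.
  have := cone_sq_ge0 E T f x; rewrite ltey.
  by case: (cone_sq E T f x) Qx.
pose q (t : MR) := dens (fcalc E (qfun t) f) x t.
have -> : (fun m => cone_sq E (far m) f x) = (fun m => \int[leb]_(t in T) (q \_ (far m)) t)%E.
  apply/funext => m; rewrite /cone_sq integral_mkcond [RHS]integral_mkcond.
  apply: eq_integral => t _; rewrite !patchE.
  case: ifPn => [|//]; first by rewrite inE => /farT/mem_set ->.
  by case: ifPn.
apply: (@dominated_cvg0 _ _ _ leb T (fun m => q \_ (far m)) q) => //.
- move=> m; apply: measurable_funTS.
  exact: ((measurable_restrictT _ (measurable_far m)).1 (measurable_funTS (md x))).
- exact: (measurable_funTS (md x)).
- move=> m t _; rewrite patchE; case: ifPn => _; rewrite ?lexx ?andbT; exact: dens_ge0.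
move=> t; rewrite /= in_itv/= andbT => t0 _.
apply: cvg_near_cst; near=> m; rewrite patchE memNset// => -[_]; apply.
rewrite /= in_itv/= ler_pdivrMr ?ltr0n//; apply/andP; split.
  rewrite mulrC -ler_pdivrMr//; apply: (@le_trans _ _ (m%:R : R)); last by rewrite ler_nat.
  by near: m; exact: nbhs_infty_ger.
apply: (@le_trans _ _ (m%:R : R)); last by rewrite ler_nat.
by near: m; exact: nbhs_infty_ger.
Unshelve. all: by end_near. Qed.

Lemma heat_cvg (f : L2 mu) (u : nat -> R) : (forall n, 0 < u n) -> u n @[n --> \oo] --> 0 ->
  nsq (fcalc E (hfun (u n)) f - f) @[n --> \oo] --> 0.
Proof.
move=> u0 ucv.
suff : L2_lim (fun n => fcalc E (hfun (u n)) f) (fcalc E (fun=> 1) f) by rewrite fcalc1.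
apply: (@fcalc_cvg _ _ _ _ E _ _ 1).
- by move=> n; exact: measurable_hfun.
- exact: measurable_cst.
- by move=> n x; have /andP[a b] := hfun_bound x (ltW (u0 n)); rewrite ger0_norm.
- by move=> x; rewrite normr1.
- move=> x; rewrite -[X in _ --> X]expR0 /hfun.
  apply: continuous_cvg; first exact: continuous_expR.
  rewrite -[X in _ --> X](mul0r (Num.max x 0)) -[X in X * _]oppr0.
  by apply: cvgMr_tmp; exact: cvgN.
Qed.

(* On heights in [a, b] the mass in the cone is at most the full L2 norm. *)
Lemma cone_sq_bounded (a b : R) g x : 0 < a -> a <= b ->
  (cone_sq E `[a, b] g x <= ((nsq g) * ((b - a) / (vol mu x a * a)))%:E)%E.
Proof.
move=> a0 ab.
have va : 0 < vol mu x a * a by rewrite mulr_gt0// vol_gt0.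
apply: (@le_trans _ _ (\int[leb]_(t in `[a, b]) (nsq g / (vol mu x a * a))%:E)%E).
  apply: ge0_le_integral => //.
  - by move=> t _; exact: dens_ge0.
  - exact: (measurable_funTS (measurable_dens_qfun1 homog E g x)).
  - move=> t; rewrite /= in_itv/= => /andP[at_ tb].
    have t0 : 0 < t by exact: lt_le_trans at_.
    rewrite /dens EFinM; apply: lee_pmul.
    + exact: massL_ge0.
    + by rewrite lee_fin invr_ge0 vol_t_ge0.
    + apply: (le_trans (massL_le _ _)); first exact: (measurable_cball homog).
      rewrite lee_fin; apply: fcalc_nsq_le; first exact: bmf_qfun.
      by move=> y; have /andP[q0 q1] := qfun_bound t y; rewrite ger0_norm.
    + rewrite lee_fin lef_pV2 ?posrE//; last by rewrite mulr_gt0// vol_gt0.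
      rewrite ler_pM ?vol_ge0 ?(ltW a0)//.
      by apply: (vol_le homog); rewrite mdistxx add0r.
rewrite integral_cst//= lebesgue_measure_itv/= lte_fin.
case: ltP => [_|ba]; first by rewrite -EFinD -EFinM lee_fin mulrAC -mulrA.
rewrite mule0 lee_fin mulr_ge0 ?nsq_ge0// divr_ge0 ?subr_ge0// ltW//.
Qed.

(** The bound [u n <= a ^+ 2] gives [rho < a], so on [a, b] the pointwise estimate for large heights
    applies and provides a dominating function independent of [n]. Pointwise convergence follows
    from L2 convergence by [cone_sq_bounded]. *)
Lemma cone_norm_middle (a b : R) (f : L2 mu) (u : nat -> R) : 0 < a -> a <= b ->
  (cone_norm E T f < +oo)%E ->
  (forall n, 0 < u n <= a ^+ 2) -> u n @[n --> \oo] --> 0 ->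
  cone_norm E `[a, b] (fcalc E (hfun (u n)) f - f) @[n --> \oo] --> 0%E.
Proof.
move=> a0 ab fT ub ucv.
have u0 n : 0 < u n by have /andP[] := ub n.
have [D D1 dbl] := doubling_constant homog.
have Fc := fcalc_qfun_cvg E f.
(* From [cone_sqD] with weight 1: twice the bound D^3 for the shifted term and twice the original
   term. *)
pose C := 2 * D ^+ 3 + 2.
have C1 : 1 <= C.
  have p3 : 1 <= D ^+ 3 by exact: exprn_ege1.
  by rewrite /C; move: p3; lra.
have mT : measurable T by exact: measurable_itv.
have mab : measurable (`[a, b]%classic : set MR) by exact: measurable_itv.
apply: (@dominated_cvg0 _ _ _ mu setT
  (fun n x => sqrte (cone_sq E `[a, b] (fcalc E (hfun (u n)) f - f) x))
  (fun x => C%:E * sqrte (cone_sq E T f x))%E) => //.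
- by move=> n; exact: measurable_sqrt_cone.
- by apply: measurable_funeM; exact: measurable_sqrt_cone.
- rewrite ge0_integralZl//; first last.
  + by rewrite lee_fin (le_trans _ C1).
  + by move=> x _; exact: sqrte_ge0.
  + exact: measurable_sqrt_cone.
  by apply: lte_mul_pinfty => //; rewrite lee_fin (le_trans _ C1).
- move=> n x _; rewrite sqrte_ge0/=.
  apply: le_trans (sqrte_scale_le C1 (cone_sq_ge0 _ _ _ _)).
  rewrite lee_sqrt; last by apply: mule_ge0; [rewrite lee_fin (le_trans _ C1)|exact: cone_sq_ge0].
  pose rho := Num.sqrt (u n) / 4.
  have rho0 : 0 < rho by rewrite divr_gt0// sqrtr_gt0.
  have sE : u n = 16 * rho ^+ 2.
    by rewrite /rho expr_div_n sqr_sqrtr ?(ltW (u0 n))//; field.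
  have rhoa : rho < a.
    have /andP[_ ua] := ub n.
    have sa : Num.sqrt (u n) <= a.
      by rewrite -(ger0_norm (ltW a0)) -sqrtr_sqr ler_wsqrtr.
    by rewrite /rho ltr_pdivrMr//; move: sa a0; lra.
  have h1 : (cone_sq E `[a, b] (fcalc E (hfun (u n)) f) x <= (D ^+ 3)%:E * cone_sq E T f x)%E.
    apply: le_trans (shift_up homog D1 dbl Fc rho0 mT x).
    rewrite /cone_sq sE (_ : (\int[leb]_(t in `[a, b]) _)%E =
        (\int[leb]_(t in `[a, b]) shift_dens (fun t => fcalc E (qfun t) f) rho x t)%E); last first.
      apply: eq_integral => t; rewrite inE /= in_itv/= => /andP[at_ _].
      by apply: dens_heat => //; exact: lt_le_trans at_.
    apply: ge0_subset_integral => //.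
    + by apply: measurableI; [exact: measurable_shift_window|exact: measurable_itv].
    + apply: measurable_funTS.
      exact: (measurable_fun_pair2 x (measurable_shift_dens homog Fc rho0)).
    + by move=> t _; exact: shift_dens_ge0.
    + move=> t /=; rewrite !in_itv/= => /andP[at_ _]; rewrite !andbT; split.
        split; first exact: lt_le_trans at_.
        by rewrite /= in_itv/= andbT; apply: tau_gt0; rewrite -sE.
        exact: lt_le_trans at_.
  have h2 : (cone_sq E `[a, b] f x <= cone_sq E T f x)%E.
    apply: cone_sq_subset => // t /=.
    by rewrite !in_itv/= => /andP[at_ _]; rewrite andbT (lt_le_trans a0).
  apply: (le_trans (cone_sqD homog _ mab _ _ _ ltr01)); rewrite invr1.
  have n1 : (-1)%:C = -1 :> R[i] by rewrite rmorphN.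
  rewrite -[(- f)%R]scaleN1r -n1 cone_sqZ// sqrrN expr1n mul1e.
  rewrite (_ : C%:E * _ = 2%:E * ((D ^+ 3)%:E * cone_sq E T f x) + 2%:E * cone_sq E T f x)%E.
    by apply: leeD; apply: lee_wpmul2l => //; rewrite lee_fin.
  rewrite muleA -EFinM -ge0_muleDl ?lee_fin//.
  by rewrite mulr_ge0// exprn_ge0// (le_trans _ D1).
- move=> x _ _; apply: sqrte_cvg0; first by move=> n; exact: cone_sq_ge0.
  have /cvgrPdist_le h := heat_cvg f u0 ucv.
  apply/cvge0P; first by move=> n; exact: cone_sq_ge0.
  move=> e e0.
  pose c := (b - a) / (vol mu x a * a) + 1.
  have c0 : 0 < c by rewrite ltr_wpDl// divr_ge0 ?subr_ge0// vol_t_ge0.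
  apply: filterS (h _ (divr_gt0 e0 c0)) => n.
  rewrite sub0r normrN ger0_norm ?nsq_ge0// ler_pdivlMr// => hn.
  apply: (le_trans (cone_sq_bounded _ _ a0 ab)); rewrite lee_fin.
  apply: le_trans hn; apply: ler_wpM2l; first exact: nsq_ge0.
  by rewrite lerDl.
Qed.

Lemma cone_norm_heat_cvg (f : L2 mu) (u : nat -> R) : (cone_norm E T f < +oo)%E ->
  (forall n, 0 < u n) -> u n @[n --> \oo] --> 0 ->
  cone_norm E T (fcalc E (hfun (u n)) f - f) @[n --> \oo] --> 0%E.
Proof.
move=> fT u0 ucv; apply/cvge0P; first by move=> n; exact: cone_norm_ge0.
move=> e e0.
have [K K1 hK] := cone_norm_heat homog E.
have mT : measurable T by exact: measurable_itv.
have Kp : 0 < K + 1 by rewrite addr_gt0// (lt_le_trans _ K1).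
have e2 : 0 < e / 2 / (K + 1) by rewrite !divr_gt0.
have /cvge0P := cone_norm_far fT => /(_ (fun m => cone_norm_ge0 _ _ _) _ e2)[m _ /(_ m (leqnn m)) hm].
pose a : R := m.+1%:R^-1; pose b : R := m.+1%:R.
have a0 : 0 < a by rewrite invr_gt0 ltr0n.
have b1 : 1 <= b by rewrite ler1n.
have ab : a <= b by apply: le_trans b1; rewrite invf_le1 ?ltr0n// ler1n.
pose A := `[a, b]%classic : set MR.
have mA : measurable A by exact: measurable_itv.
have mTA : measurable (T `\` A) by exact: measurableD.
have [N _ hN] : \forall n \near \oo, u n <= a ^+ 2.
  have /cvgrPdist_le/(_ _ (exprn_gt0 2 a0)) := ucv.
  by apply: filterS => n; rewrite sub0r normrN ger0_norm// ltW.
(* The first [N] terms are dropped so that the bound by [a ^+ 2] holds at every index. *)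
have ucv' : u (n + N)%N @[n --> \oo] --> 0 by rewrite cvg_shiftn.
have ub n : 0 < u (n + N)%N <= a ^+ 2 by rewrite u0 hN//= leq_addl.
have := cone_norm_middle a0 ab fT ub ucv'.
move=> /cvge0P => /(_ (fun n => cone_norm_ge0 _ _ _) (e / 2) (divr_gt0 e0 (ltr0Sn _ _))).
case=> M _ hM; exists (M + N)%N => // n /= MNn.
have Nn : (N <= n)%N by apply: leq_trans MNn; exact: leq_addl.
have := hM (n - N)%N; rewrite /= leq_subRL// addnC MNn subnK// => /(_ isT) mid.
have un := hN n Nn.
pose g := (fcalc E (hfun (u n)) f - f)%R.
rewrite -/g in mid *.
apply: (@le_trans _ _ (cone_norm E (T `\` A) g + cone_norm E A g)%E).
  have AT : T = (T `\` A) `|` A.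
    rewrite setUDl setDv setD0 ; apply/esym/setUidl => t /=.
    by rewrite !in_itv/= => /andP[at_ _]; rewrite andbT (lt_le_trans a0).
  rewrite /cone_norm -ge0_integralD//; first last.
  - exact: measurable_sqrt_cone.
  - by move=> x _; exact: sqrte_ge0.
  - exact: measurable_sqrt_cone.
  - by move=> x _; exact: sqrte_ge0.
  apply: ge0_le_integral => //.
  - by move=> x _; exact: sqrte_ge0.
  - exact: measurable_sqrt_cone.
  - by apply: emeasurable_funD; exact: measurable_sqrt_cone.
  - move=> x _; apply: le_trans (sqrteD_le (cone_sq_ge0 _ _ _ _) (cone_sq_ge0 _ _ _ _)).
    rewrite {1}AT [X in sqrte X]ge0_integral_setU//.
    + rewrite -AT; exact: (measurable_funTS (measurable_dens_qfun1 homog E g x)).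
    + by move=> t _; exact: dens_ge0.
    + by rewrite disj_set2E setDE -setIA setICl setI0.
rewrite (_ : e%:E = (e / 2)%:E + (e / 2)%:E)%E; last by rewrite -EFinD -splitr.
apply: leeD; last exact: mid.
apply: (le_trans (cone_normB homog E mTA _ _)).
apply: (@le_trans _ _ ((K + 1)%:E * cone_norm E (far m) f)%E).
  rewrite EFinD ge0_muleDl// ?lee_fin ?(le_trans _ K1)// mul1e; apply: leeD.
    apply: hK => //; [exact: measurable_far|move=> t [/=]].
    rewrite !in_itv/= !andbT => t0 /negP tA; split => //; split; first by rewrite /= in_itv/= andbT tau_gt0.
    have tt := tau_ge (u0 n) t; have t2 := tau2 (u0 n) t.
    rewrite /= in_itv/=; apply/negP; move: tA; rewrite in_itv/= negb_and -!ltNge => /orP[ta|bt].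
      rewrite negb_and -!ltNge; apply/orP; left.
      rewrite -/a -ltr_sqr ?nnegrE ?mulr_ge0 ?(ltW a0) ?(ltW (tau_gt0 _ _))// t2.
      have t2a : t ^+ 2 < a ^+ 2 by rewrite ltr_sqr ?nnegrE ?(ltW t0) ?(ltW a0).
      by move: un t2a (exprn_gt0 2 a0); rewrite exprMn; clear; lra.
    by rewrite negb_and -!ltNge (lt_le_trans bt tt) orbT.
  apply: cone_norm_subset => //; first exact: measurable_far.
  move=> t [tT tA]; split => // tf; apply: tA; move: tf; rewrite /= !in_itv/= => /andP[h1 h2].
  rewrite /A/= in_itv/= h2 andbT; apply: le_trans h1; rewrite -/a; by rewrite ler_peMl ?(ltW a0)// ler1n.
have := lee_wpmul2l (_ : (0 <= (K + 1)%:E)%E) hm; rewrite lee_fin (ltW Kp) => /(_ isT).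
move=> /le_trans; apply.
by rewrite -EFinM lee_fin [X in (X <= _)%R]mulrC divfK ?gt_eqF// mulrC.
Qed.

End HeatContinuity.

(** * Passage to the Poisson semigroup *)

Section StrongContinuity.
Context {d : measure_display} {R : realType} {Omega : measurableMetricType d R}.
Variable mu : {measure set Omega -> \bar R}.
Hypothesis homog : homogeneous_type mu.
Variable E : spectral_measure mu.
Local Notation MR := (measurableTypeR R).
Local Notation T := (`]0%R, +oo[%classic : set MR).
Local Notation N := (cone_norm E T).

Let mT : measurable T. Proof. exact: measurable_itv. Qed.

Lemma cone_norm_half (f : L2 mu) : N ((2^-1)%:C *: f) = ((2^-1)%:E * N f)%E.
Proof.
have h : `|2^-1| = 2^-1 :> R by rewrite gtr0_norm// invr_gt0.
by rewrite (cone_normZ homog E mT) h.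
Qed.

Lemma cone_norm0 : N 0 = 0%E.
Proof. by rewrite -(scale0r (0 : L2 mu)) (cone_normZ homog E mT 0) normr0 mul0e. Qed.

Lemma expmix_fcalc_cvg (phi_ : nat -> MR -> R) (phi : MR -> R) (f : L2 mu) :
  (forall n, expmix (phi_ n)) -> (forall x, phi_ n x @[n --> \oo] --> phi x) ->
  L2_lim (fun n => fcalc E (phi_ n) f) (fcalc E phi f).
Proof.
move=> e_ hc; have [m b] := expmix_bound (expmix_lim e_ hc).
apply: (@fcalc_cvg _ _ _ _ E _ _ 1) => //.
- by move=> n; exact: (expmix_bound (e_ n)).1.
- by move=> n x; have /andP[p0 p1] := (expmix_bound (e_ n)).2 x; rewrite ger0_norm.
- by move=> x; have /andP[p0 p1] := b x; rewrite ger0_norm.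
Qed.

Lemma expmix_cone_norm : exists2 K : R, 1 <= K & forall phi (f : L2 mu), expmix phi ->
  (N (fcalc E phi f) <= K%:E * N f)%E.
Proof.
have [K K1 hK] := cone_norm_heat homog E; exists K => // phi f.
have K0 : 0 <= K by exact: le_trans K1.
elim=> [u|p1 p2 e1 h1 e2 h2|p_ p e_ ih hc].
- rewrite le_eqVlt => /predU1P[<-|u0].
    rewrite (_ : hfun 0 = fun=> 1).
      by rewrite fcalc1 -[leLHS]mul1e lee_wpmul2r ?cone_norm_ge0// lee_fin.
    by apply/funext => x; rewrite /hfun oppr0 mul0r expR0.
  apply: hK => // t /=; rewrite !in_itv/= !andbT => t0; split => //; exact: tau_gt0.
- rewrite fcalc_avg; [|exact: bmf_expmix..].
  rewrite cone_norm_half.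
  apply: (@le_trans _ _ ((2^-1)%:E * (K%:E * N f + K%:E * N f))%E).
    apply: lee_wpmul2l; first by rewrite lee_fin invr_ge0.
    by apply: le_trans (leeD h1 h2); exact: cone_normD.
  rewrite -ge0_muleDl ?lee_fin// muleA -EFinD -EFinM (_ : 2^-1 * (K + K) = K)//.
  by field.
- apply: (cone_norm_lim homog mT (expmix_fcalc_cvg f e_ hc)).
  by apply: nearW => n; exact: ih.
Qed.

(** Dominated convergence was applied along sequences; a contradiction argument extracts a modulus
    uniform in [u]. *)
Lemma heat_modulus (f : L2 mu) (e : R) : (N f < +oo)%E -> 0 < e ->
  exists2 dl : R, 0 < dl & forall u, 0 < u -> u <= dl ->
    (N (fcalc E (hfun u) f - f)%R <= e%:E)%E.
Proof.
move=> fT e0; apply: contrapT => h.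
have {}h n : exists u : R, [/\ 0 < u, u <= n.+1%:R^-1 &
    (e%:E < N (fcalc E (hfun u) f - f)%R)%E].
  apply: contrapT => hn; apply: h; exists n.+1%:R^-1; first by rewrite invr_gt0 ltr0n.
  move=> u u0 un; rewrite leNgt; apply/negP => eu; apply: hn; exists u; split => //.
have [u hu] := choice h.
have u0 n : 0 < u n by have [] := hu n.
have ucv : u n @[n --> \oo] --> 0.
  apply: (squeeze_cvgr _ (cvg_cst 0) cvg_harmonic).
  by apply: nearW => n; have [a b _] := hu n; rewrite (ltW a).
have /cvge0P := cone_norm_heat_cvg homog fT u0 ucv.
move=> /(_ (fun n => cone_norm_ge0 _ _ _) _ e0)[M _ /(_ M (leqnn M))].
by rewrite /= leNgt; have [_ _ ->] := hu M.
Qed.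

(* The bound is affine in phi, so that it passes to averages. *)
Lemma expmix_modulus (f : L2 mu) (e : R) : (N f < +oo)%E -> 0 < e ->
  exists (C : R) (y : MR), [/\ 0 <= C, 0 < y & forall phi, expmix phi ->
    (N (fcalc E phi f - f)%R <= (e + C * (1 - phi y))%:E)%E].
Proof.
move=> fT e0; have [dl dl0 hdl] := heat_modulus fT e0.
have [K K1 hK] := expmix_cone_norm.
have Nf : N f = (fine (N f))%:E by rewrite fineK// ge0_fin_numE// cone_norm_ge0.
have N0 : 0 <= fine (N f) by rewrite fine_ge0// cone_norm_ge0.
(* At y = 1 / dl, a heat symbol with u > dl satisfies 1 - e^{-uy} >= z. The crude bound (K + 1) N f
   is then absorbed by C (1 - phi y), with C = (K + 1) N f / z. *)
pose z := 1 - expR (-1) : R.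
have z0 : 0 < z by rewrite subr_gt0 -[ltRHS]expR0 ltr_expR ltrN10.
have K0 : 0 <= K by exact: le_trans K1.
exists ((K + 1) * fine (N f) / z), dl^-1; split.
- by rewrite divr_ge0 ?(ltW z0)// mulr_ge0// addr_ge0.
- by rewrite invr_gt0.
have C0 : 0 <= (K + 1) * fine (N f) / z by rewrite divr_ge0 ?(ltW z0)// mulr_ge0// addr_ge0.
have Cz : (K + 1) * fine (N f) / z * z = (K + 1) * fine (N f) by rewrite divfK// gt_eqF.
move: (_ / z) C0 Cz => C C0 Cz.
move=> phi; elim=> [u|p1 p2 e1 h1 e2 h2|p_ p e_ ih hc].
- move=> u0; have /andP[b0 b1] := hfun_bound (dl^-1 : MR) u0.
  move: u0; rewrite le_eqVlt => /predU1P[uE|u0].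
    rewrite (_ : hfun u = fun=> 1); last first.
      by apply/funext => x; rewrite /hfun -uE oppr0 mul0r expR0.
    by rewrite fcalc1 !subrr mulr0 addr0 cone_norm0 lee_fin ltW.
  have [udl|dlu] := leP u dl.
    by apply: le_trans (hdl _ u0 udl) _; rewrite lee_fin lerDl mulr_ge0// subr_ge0.
  apply: (le_trans (cone_normB homog E mT _ _)).
  apply: (le_trans (leeD (hK _ _ (expmix_hfun (ltW u0))) (lexx _))).
  rewrite Nf -EFinM -EFinD lee_fin.
  have zle : z <= 1 - hfun u (dl^-1 : MR).
    rewrite /z lerB// /hfun ler_expR max_l ?invr_ge0 ?(ltW dl0)// mulNr lerN2.
    by rewrite ler_pdivlMr// mul1r ltW.
  apply: (@le_trans _ _ (C * z)); last first.
    apply: (@le_trans _ _ (C * (1 - hfun u (dl^-1 : MR)))); first exact: ler_wpM2l.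
    by rewrite lerDr ltW.
  by rewrite Cz mulrDl mul1r.
- rewrite fcalc_avg; [|exact: bmf_expmix..].
  have -> : (2^-1)%:C *: (fcalc E p1 f + fcalc E p2 f) - f =
      (2^-1)%:C *: ((fcalc E p1 f - f) + (fcalc E p2 f - f)).
    rewrite addrACA -opprD scalerBr; congr (_ - _).
    rewrite -[X in _ *: (X + X)]scale1r -scalerDl scalerA -(rmorph1 (real_complex R)).
    rewrite -rmorphD -rmorphM (_ : 2^-1 * (1 + 1) = 1 :> R) ?rmorph1 ?scale1r//.
    by field.
  rewrite cone_norm_half.
  apply: (@le_trans _ _ ((2^-1)%:E * ((e + C * (1 - p1 dl^-1))%:E + (e + C * (1 - p2 dl^-1))%:E))%E).
    apply: lee_wpmul2l; first by rewrite lee_fin invr_ge0.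
    by apply: le_trans (leeD h1 h2); exact: cone_normD.
  rewrite -EFinD -EFinM lee_fin le_eqVlt; apply/orP; left; apply/eqP.
  by field.
- apply/lee_addgt0Pr => eta eta0.
  have lim : L2_lim (fun n => fcalc E (p_ n) f - f) (fcalc E p f - f).
    rewrite /L2_lim; under eq_fun do rewrite opprB addrA subrK.
    exact: expmix_fcalc_cvg.
  apply: (cone_norm_lim homog mT lim).
  have cv : e + C * (1 - p_ n dl^-1) @[n --> \oo] --> e + C * (1 - p dl^-1).
    apply: cvgD; first exact: cvg_cst.
    apply: cvgM; first exact: cvg_cst.
    by apply: cvgB; [exact: cvg_cst|exact: hc].
  have /cvgrPdist_le/(_ _ eta0) := cv; apply: filterS => n hn.
  apply: (le_trans (ih n)); rewrite -EFinD lee_fin -lerBlDl.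
  by apply: le_trans hn; rewrite distrC ler_norm.
Qed.

(** [expmix_modulus] reduces convergence in norm to convergence of the symbols at a single spectral
    point [y], which depends on [f] and [e] but not on [t]. *)
Lemma expmix_strong_continuity (phi : R -> MR -> R) (f : L2 mu) (e : R) :
  (forall t, 0 < t -> expmix (phi t)) ->
  (forall y, 0 < y -> phi t y @[t --> 0^'+] --> (1 : R)) ->
  (N f < +oo)%E -> 0 < e ->
  \forall t \near 0^'+, (N (fcalc E (phi t) f - f)%R <= e%:E)%E.
Proof.
move=> ephi phi1 fT e0.
have e2 : 0 < e / 2 by rewrite divr_gt0.
have [C [y [C0 y0 h]]] := expmix_modulus fT e2.
have C1 : 0 < C + 1 by rewrite ltr_wpDl.
have /cvgrPdist_le/(_ _ (divr_gt0 e2 C1)) hc := phi1 y y0.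
near=> t.
have t0 : 0 < t by [].
apply: (le_trans (h _ (ephi _ t0))); rewrite lee_fin {2}(splitr e) lerD2l.
have : `|1 - phi t y| <= e / 2 / (C + 1) by near: t; exact: hc.
rewrite ler_pdivlMr// => h1; apply: le_trans h1.
have /andP[_ p1] := (expmix_bound (ephi _ t0)).2 y.
by rewrite ger0_norm ?subr_ge0// mulrC ler_wpM2l ?subr_ge0// lerDl.
Unshelve. all: by end_near. Qed.

End StrongContinuity.

(** * Bounded extensions to the completion *)

Section RealNorm.
Context {R : realType} {H : completeNormedModType R[i]}.
Implicit Types h k : H.

(** The norm of [H] takes values in [R[i]]; this is the same number in [R], where real arithmetic
    and limits can be used. *)
Definition rnorm h : R := complex.Re `|h|.

Lemma rnormE h : `|h| = (rnorm h)%:C.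
Proof. by rewrite /rnorm RRe_real// normr_real. Qed.

Lemma rnorm_ge0 h : 0 <= rnorm h.
Proof. by rewrite -lecR -rnormE normr_ge0. Qed.

Lemma rnormD h k : rnorm (h + k) <= rnorm h + rnorm k.
Proof. by rewrite -lecR rmorphD/= -!rnormE ler_normD. Qed.

Lemma rnormB h k : rnorm (h - k) = rnorm (k - h).
Proof. by rewrite /rnorm distrC. Qed.

Lemma rnorm_tri h k l : rnorm (h - k) <= rnorm (h - l) + rnorm (l - k).
Proof. by apply: le_trans (rnormD _ _); rewrite addrA subrK. Qed.

Lemma rnormZ a h : rnorm (a *: h) = complex.Re `|a| * rnorm h.
Proof.
apply: complexI; rewrite rmorphM/= -!rnormE normrZ; congr (_ * _).
Qed.

Lemma rnorm_eq0 h : rnorm h <= 0 -> h = 0.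
Proof.
move=> h0; apply/eqP; rewrite -normr_eq0 rnormE; apply/eqP; congr (_%:C).
by apply/eqP; rewrite eq_le h0 rnorm_ge0.
Qed.

Lemma rnorm_cvgP {S : Type} {F : set_system S} {FF : Filter F} (f : S -> H) h :
  (forall e : R, 0 < e -> \forall t \near F, rnorm (h - f t) <= e) -> f @ F --> h.
Proof.
move=> hf; apply/cvgrPdist_le => e e0.
have eE : e = (complex.Re e)%:C by rewrite RRe_real// gtr0_real.
have re0 : 0 < complex.Re e by rewrite -ltcR -eE.
by apply: filterS (hf _ re0) => t ht; rewrite rnormE eE lecR.
Qed.

Lemma dense_rnorm (S : set H) h (e : R) : dense S -> 0 < e ->
  exists2 k, S k & rnorm (h - k) < e.
Proof.
move=> dS e0; have ec : 0 < e%:C by rewrite ltcR.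
have hn : nbhs h (ball h e%:C) by exact: nbhsx_ballx.
have [k [/interior_subset kb Sk]] := dS _ (ex_intro _ h hn) (open_interior _).
by exists k => //; rewrite -ltcR -rnormE; move: kb; rewrite -ball_normE.
Qed.

End RealNorm.

Section BoundedExtension.
Context {d : measure_display} {T : measurableType d} {R : realType}.
Context {mu : {measure set T -> \bar R}} {H : completeNormedModType R[i]}.
Variables (D : set (L2 mu)) (N : L2 mu -> R) (iota : L2 mu -> H).
Hypothesis complD : is_completion D N iota.
Hypothesis D0 : D 0.
Hypothesis DP : forall a f g, D f -> D g -> D (a *: f + g).

Lemma dom_subr f g : D f -> D g -> D (f - g).
Proof. by move=> Df Dg; rewrite addrC -scaleN1r; exact: DP. Qed.

Lemma iota_subr f g : D f -> D g -> iota (f - g) = iota f - iota g.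
Proof.
move=> Df Dg; rewrite addrC -scaleN1r (completion_linear complD)//.
by rewrite scaleN1r addrC.
Qed.

Lemma iota0 : iota 0 = 0.
Proof. by rewrite -(subrr (0 : L2 mu)) iota_subr// subrr. Qed.

Lemma rnorm_iota f : D f -> rnorm (iota f) = N f.
Proof. by move=> Df; rewrite /rnorm (completion_norm complD). Qed.

Lemma iota_dense h (e : R) : 0 < e -> exists2 f, D f & rnorm (h - iota f) < e.
Proof.
move=> e0; have [_ [f Df <-] he] := dense_rnorm h (completion_dense complD) e0.
by exists f.
Qed.

Definition bounded_on (P : L2 mu -> L2 mu) (K : R) :=
  [/\ linear P, 0 <= K & forall f, D f -> D (P f) /\ N (P f) <= K * N f].

Section OneOperator.
Variables (P : L2 mu -> L2 mu) (K : R).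
Hypothesis PK : bounded_on P K.

Lemma bounded_on_le f g : D f -> D g ->
  rnorm (iota (P f) - iota (P g)) <= K * rnorm (iota f - iota g).
Proof.
have [Pl K0 Pb] := PK; move=> Df Dg.
have [Df' Dg'] := (Pb f Df, Pb g Dg).
have PB : P (f - g) = P f - P g.
  by rewrite addrC -scaleN1r Pl scaleN1r addrC.
have [Dfg hfg] := Pb _ (dom_subr Df Dg).
rewrite -(iota_subr Df'.1 Dg'.1) -(iota_subr Df Dg) -PB.
by rewrite (rnorm_iota Dfg) (rnorm_iota (dom_subr Df Dg)).
Qed.

(** The point [k] is the limit of [iota (P (f_ n))] for [iota (f_ n)] tending to [h]. The inequality
    determines it by density and no longer mentions the sequence, so linearity and the bound are
    read off from it. *)
Lemma bounded_on_point h : exists k, forall f, D f ->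
  rnorm (k - iota (P f)) <= K * rnorm (h - iota f).
Proof.
have [Pl K0 Pb] := PK.
have /choice[f_ hf] n : exists f, D f /\ rnorm (h - iota f) < n.+1%:R^-1.
  have [|f Df hf] := @iota_dense h n.+1%:R^-1; first by rewrite invr_gt0 ltr0n.
  by exists f.
pose v n := iota (P (f_ n)).
have far_v f n : D f -> rnorm (v n - iota (P f)) <= K * (n.+1%:R^-1 + rnorm (h - iota f)).
  move=> Df; apply: (le_trans (bounded_on_le (hf n).1 Df)).
  apply: ler_wpM2l => //; apply: (le_trans (rnorm_tri _ _ h)).
  by rewrite lerD2r rnormB ltW// (hf n).2.
have small (e : R) : 0 < e -> \forall n \near \oo, K * n.+1%:R^-1 <= e.
  move=> e0; have : K * n.+1%:R^-1 @[n --> \oo] --> K * 0.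
    by apply: cvgM; [exact: cvg_cst|exact: cvg_harmonic].
  rewrite mulr0 => /cvgrPdist_le/(_ _ e0); apply: filterS => n.
  by rewrite sub0r normrN; apply: le_trans; exact: ler_norm.
have cv : cvg (v @ \oo).
  apply: cauchy_cvg; apply: cauchy_exP => e e0.
  have eE : e = (complex.Re e)%:C by rewrite RRe_real// gtr0_real.
  have re0 : 0 < complex.Re e by rewrite -ltcR -eE.
  have [M _ hM] := small _ (divr_gt0 re0 (ltr0Sn R 2)).
  exists (v M); exists M => // n /= Mn.
  rewrite -ball_normE /= rnormE eE ltcR rnormB.
  apply: (le_lt_trans (far_v _ n (hf M).1)); rewrite mulrDr.
  apply: (@le_lt_trans _ _ (complex.Re e / 3 + complex.Re e / 3)).
    apply: lerD; first exact: hM.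
    apply: le_trans (hM _ (leqnn M)); apply: ler_wpM2l => //.
    by rewrite ltW// (hf M).2.
  by move: re0; lra.
exists (lim (v @ \oo)) => f Df; apply/ler_addgt0Pr => e e0.
have e2 : 0 < e / 2 by rewrite divr_gt0.
have /cvgrPdist_le/(_ (e / 2)%:C) := cv; rewrite ltcR => /(_ e2)[M1 _ h1].
have [M2 _ h2] := small _ e2.
pose n := maxn M1 M2.
have := h1 n (leq_maxl _ _); rewrite /= rnormE lecR => l1.
have l2 := h2 n (leq_maxr _ _).
apply: (le_trans (rnorm_tri _ _ (v n))).
have := far_v f n Df; rewrite mulrDr => l3.
apply: (le_trans (lerD l1 (le_trans l3 (lerD l2 (lexx _))))).
by rewrite addrA -splitr addrC.
Qed.

Lemma bounded_on_ext : exists A : H -> H, [/\ linear A,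
  (forall h, rnorm (A h) <= K * rnorm h) &
  forall f, D f -> D (P f) /\ A (iota f) = iota (P f)].
Proof.
have [Pl K0 Pb] := PK.
have [A hA] := choice bounded_on_point.
exists A; split.
- move=> a h1 h2; apply/eqP; rewrite -subr_eq0; apply/eqP/rnorm_eq0.
  set c := complex.Re `|a|.
  have c0 : 0 <= c by rewrite -lecR RRe_real ?normr_real// normr_ge0.
  apply/ler_addgt0Pr => e e0; rewrite add0r.
  (* The errors add up to [2 * K * (c + 1) * e']; the summand 1 next to [K] keeps the divisor
     positive. *)
  pose e' := e / (2 * (K + 1) * (c + 1)).
  have p0 : 0 < 2 * (K + 1) * (c + 1) by rewrite !mulr_gt0// ltr_wpDl.
  have e'0 : 0 < e' by rewrite divr_gt0.
  have [f1 Df1 /ltW n1] := iota_dense h1 e'0.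
  have [f2 Df2 /ltW n2] := iota_dense h2 e'0.
  have Df := DP a Df1 Df2.
  have a1 := hA h1 _ Df1; have a2 := hA h2 _ Df2; have a3 := hA (a *: h1 + h2) _ Df.
  have [Df1' _] := Pb _ Df1; have [Df2' _] := Pb _ Df2.
  rewrite Pl (completion_linear complD a Df1' Df2') (completion_linear complD a Df1 Df2) in a3.
  have i1 : rnorm (a *: h1 + h2 - (a *: iota f1 + iota f2)) <= c * e' + e'.
    rewrite opprD addrACA -scalerBr; apply: (le_trans (rnormD _ _)).
    by rewrite rnormZ lerD// ler_wpM2l.
  have i2 : rnorm (a *: iota (P f1) + iota (P f2) - (a *: A h1 + A h2)) <= c * (K * e') + K * e'.
    rewrite opprD addrACA -scalerBr; apply: (le_trans (rnormD _ _)).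
    rewrite rnormZ rnormB [X in _ + X <= _]rnormB lerD//; last first.
      by apply: (le_trans a2); exact: ler_wpM2l.
    by apply: ler_wpM2l => //; apply: (le_trans a1); exact: ler_wpM2l.
  apply: (le_trans (rnorm_tri _ _ (a *: iota (P f1) + iota (P f2)))).
  apply: (@le_trans _ _ (K * (c * e' + e') + (c * (K * e') + K * e'))).
    by apply: lerD => //; apply: (le_trans a3); exact: ler_wpM2l.
  have -> : e = e' * (2 * (K + 1) * (c + 1)) by rewrite divfK// gt_eqF.
  have q : 0 <= e' * (c + 1) by rewrite mulr_ge0 ?addr_ge0// ltW.
  by move: q; nra.
- move=> h; have := hA h _ D0.
  have P0 : P 0 = 0.
    have := Pl 0 0 0; rewrite scale0r add0r => ->.
    by rewrite scale0r add0r; apply: (@addrI _ (P 0)); rewrite addr0 -{1}[P 0]scale1r -Pl scale1r addr0.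
  by rewrite P0 iota0 !subr0.
- move=> f Df; split; first by case: (Pb f Df).
  apply/eqP; rewrite -subr_eq0; apply/eqP/rnorm_eq0.
  apply: (le_trans (hA _ _ Df)); rewrite subrr (_ : rnorm 0 = 0) ?mulr0//.
  by rewrite /rnorm normr0.
Qed.

(** [xget] returns some bounded extension, whose bound [M] is unrelated to [K]. Comparing [h] with
    nearby elements of the image of [D] recovers the bound [K]. *)
Lemma bounded_extensionP (A := bounded_extension D iota P) : [/\ linear A,
  (forall h, rnorm (A h) <= K * rnorm h) &
  forall f, D f -> A (iota f) = iota (P f)].
Proof.
have [Pl K0 Pb] := PK.
have [Al [M Mb] Ai] : [/\ linear A, (exists M : R, forall h, `|A h| <= M%:C * `|h|) &
    forall f, D f -> D (P f) /\ A (iota f) = iota (P f)].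
  have [B [Bl Bb Bi]] := bounded_on_ext.
  rewrite /A /bounded_extension; case: xgetP => [C _ //|/(_ B)/= nB].
  exfalso; apply: nB; split => //; exists K => h.
  by rewrite !rnormE -rmorphM lecR.
split => //; last by move=> f /Ai[].
move=> h; apply/ler_addgt0Pr => e e0.
have M0 : 0 <= `|M| by [].
have {}Mb k : rnorm (A k) <= `|M| * rnorm k.
  apply: (@le_trans _ _ (M * rnorm k)); first by rewrite -lecR rmorphM/= -!rnormE.
  by rewrite ler_wpM2r ?rnorm_ge0// ler_norm.
have p0 : 0 < `|M| + K + 1 by rewrite ltr_wpDl// addr_ge0.
have [f Df /ltW n] := iota_dense h (divr_gt0 e0 p0).
have AB k l : A (k - l) = A k - A l.
  by rewrite addrC -scaleN1r Al scaleN1r addrC.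
have a1 : rnorm (A (iota f)) <= K * rnorm (iota f).
  by have [Df' Nf] := Pb f Df; rewrite (Ai f Df).2 !rnorm_iota.
have a2 : rnorm (A h) <= rnorm (A (h - iota f)) + rnorm (A (iota f)).
  by apply: le_trans (rnormD _ _); rewrite AB subrK.
have a3 : rnorm (iota f) <= rnorm (h - iota f) + rnorm h.
  have := rnormD (iota f - h) h; rewrite subrK rnormB//.
have a4 := Mb (h - iota f).
apply: (le_trans a2); apply: (le_trans (lerD a4 a1)).
have h5 : `|M| * rnorm (h - iota f) + K * rnorm (iota f) <=
   (`|M| + K + 1) * rnorm (h - iota f) + K * rnorm h.
  have := ler_wpM2l K0 a3; have := rnorm_ge0 (h - iota f).
  by rewrite !mulrDl mulrDr mul1r; lra.
apply: (le_trans h5); rewrite addrC lerD2l.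
by rewrite mulrC -ler_pdivlMr.
Qed.

End OneOperator.

(** The usual density argument: approximate [h] from the dense subspace, use convergence there, and
    control both remainders by the bound [K], uniform in [t]. *)
Lemma bounded_extension_cvg {S : Type} {F : set_system S} {FF : Filter F}
    (P_ : S -> L2 mu -> L2 mu) (K : R) h :
  (\forall t \near F, bounded_on (P_ t) K) ->
  (forall f, D f -> forall e, 0 < e -> \forall t \near F, N (P_ t f - f) <= e) ->
  bounded_extension D iota (P_ t) h @[t --> F] --> h.
Proof.
move=> Pb Pc; apply: rnorm_cvgP => e e0.
(* The sign of [K] is known only where [bounded_on] holds, hence the absolute value. The three
   errors add up to [(K' + 2)] times [e / (K' + 2)]. *)
pose K' := `|K|.
have K'0 : 0 <= K' by exact: normr_ge0.
have p0 : 0 < K' + 2 by rewrite ltr_wpDl.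
have e'0 := divr_gt0 e0 p0.
have [f Df /ltW n] := iota_dense h e'0.
apply: filterS2 Pb (Pc f Df _ e'0) => t Pt ct.
have [Al Ab Ai] := bounded_extensionP Pt.
set A := bounded_extension D iota (P_ t) in Al Ab Ai *.
have [_ K0 Pb'] := Pt; have [DPf _] := Pb' f Df.
have AB k l : A (k - l) = A k - A l.
  by rewrite addrC -scaleN1r Al scaleN1r addrC.
have b1 := Ab (iota f - h); rewrite AB [rnorm (iota f - h)]rnormB Ai// in b1.
have b2 : rnorm (iota f - iota (P_ t f)) <= e / (K' + 2).
  by rewrite rnormB -iota_subr// rnorm_iota//; exact: dom_subr.
have b3 := rnorm_tri h (A h) (iota f).
have b4 := rnorm_tri (iota f) (A h) (iota (P_ t f)).
have eE : e / (K' + 2) * (K' + 2) = e by rewrite divfK// gt_eqF.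
have b5 : K * rnorm (h - iota f) <= K' * (e / (K' + 2)).
  by rewrite ler_pM ?rnorm_ge0// ler_norm.
by rewrite -[leRHS]eE mulrDr [_ * K']mulrC; move: b1 b2 b3 b4 b5 n; lra.
Qed.

End BoundedExtension.

Section SymbolLimits.
Context {R : realType}.

Lemma cvg_expR_mulN (c : R) : expR (- t * c) @[t --> (0 : R)^'+] --> (1 : R).
Proof.
apply: cvg_at_right_filter; rewrite -[X in _ --> X]expR0.
apply: continuous_cvg; first exact: continuous_expR.
rewrite -[X in _ --> X](mul0r c) -[X in X * _]oppr0.
by apply: cvgM; [apply: cvgN; exact: cvg_id|exact: cvg_cst].
Qed.

End SymbolLimits.

(** * The two semigroups on the completed Hardy space *)

Section HardyStrongContinuity.
Context {d : measure_display} {R : realType} {Omega : measurableMetricType d R}.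
Variable mu : {measure set Omega -> \bar R}.
Hypothesis homog : homogeneous_type mu.
Variables (L : unbounded_operator mu) (E : spectral_measure mu).
Hypothesis L_sa : self_adjoint L.
Hypothesis L_ge0 : nonnegative_operator L.
Hypothesis E_L : is_spectral_resolution E L.
Variables (H1 : completeNormedModType R[i]) (iota : L2 mu -> H1).
Hypothesis H1_L : is_completion (hardy_dom L E) (hardy_norm L E) iota.
Local Notation MR := (measurableTypeR R).
Local Notation T := (`]0%R, +oo[%classic : set MR).
Local Notation D := (hardy_dom L E).
Local Notation N := (cone_norm E T).

Let mT : measurable T. Proof. exact: measurable_itv. Qed.

Let NE f : hardy_enorm L E f = N f. Proof. exact: hardy_enormE. Qed.

(** [cone_normZ] concerns real scalars; with multiplication by i, the decomposition of a scalar into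
    real and imaginary parts shows that the domain is a complex subspace. *)
Lemma cone_norm_i f : N ('i%C *: f) = N f.
Proof.
apply: eq_integral => x _; congr sqrte; apply: eq_integral => t _.
rewrite fcalcZ; last exact: bmf_qfun.
by rewrite /dens massL_i//; exact: (measurable_cball homog).
Qed.

Lemma hardy_domZ a f : D f -> D (a *: f).
Proof.
rewrite /hardy_dom/= !NE => Df.
have rD (c : R) : (N (c%:C *: f) < +oo)%E.
  by rewrite (cone_normZ homog E mT); exact: lte_mul_pinfty.
have -> : a *: f = (complex.Re a)%:C *: f + 'i%C *: ((complex.Im a)%:C *: f).
  by rewrite scalerA -scalerDl -complexE.
apply: (le_lt_trans (cone_normD homog E mT _ _)); apply: lte_add_pinfty; first exact: rD.
by rewrite cone_norm_i; exact: rD.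
Qed.

Lemma hardy_domP a f g : D f -> D g -> D (a *: f + g).
Proof.
move=> /(hardy_domZ a); rewrite /hardy_dom/= !NE => Df Dg.
apply: (le_lt_trans (cone_normD homog E mT _ _)).
by apply: lte_add_pinfty; [exact: Df|exact: Dg].
Qed.

Lemma hardy_dom0 : D 0.
Proof. by rewrite /hardy_dom/= NE (cone_norm0 homog) ltry. Qed.

Lemma hardy_normE f : D f -> N f = (hardy_norm L E f)%:E.
Proof.
rewrite /hardy_dom/= /hardy_norm NE => Df.
by rewrite fineK// ge0_fin_numE// cone_norm_ge0.
Qed.

(** Serves both semigroups, since an operator enters only through its symbol: membership in [expmix]
    gives the uniform bound, and convergence of the symbols to 1 gives convergence on the dense
    subspace. *)
Lemma expmix_extension_cvg (P_ : R -> L2 mu -> L2 mu) (phi : R -> MR -> R) h :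
  (forall t f, 0 < t -> P_ t f = fcalc E (phi t) f) ->
  (forall t, 0 < t -> expmix (phi t)) ->
  (forall y, 0 < y -> phi t y @[t --> 0^'+] --> (1 : R)) ->
  bounded_extension D iota (P_ t) h @[t --> 0^'+] --> h.
Proof.
move=> PE ephi phi1.
have [K K1 hK] := expmix_cone_norm homog E.
have K0 : 0 <= K by exact: le_trans K1.
have Dfcalc psi f : expmix psi -> D f -> D (fcalc E psi f).
  move=> epsi; rewrite /hardy_dom/= !NE => Df.
  by apply: (le_lt_trans (hK psi f epsi)); apply: lte_mul_pinfty; first by rewrite lee_fin.
apply: (bounded_extension_cvg (K := K) H1_L hardy_dom0 hardy_domP).
  near=> t.
  have t0 : 0 < t by [].
  have et := ephi t t0.
  split; [|exact: K0|].
    by move=> a f g; rewrite !(PE _ _ t0) (fcalc_linear E (bmf_expmix et)).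
  move=> f Df; rewrite (PE _ _ t0); have Dpf := Dfcalc _ f et Df; split; first exact: Dpf.
  have := hK _ f et; rewrite (hardy_normE Dpf) (hardy_normE Df).
  by rewrite -EFinM lee_fin.
move=> f Df e e0; near=> t.
have t0 : 0 < t by [].
have Dpf := Dfcalc _ f (ephi t t0) Df.
have Db : D (fcalc E (phi t) f - f).
  by rewrite addrC -scaleN1r; exact: hardy_domP.
rewrite (PE _ _ t0) -lee_fin -(hardy_normE Db).
near: t; apply: (expmix_strong_continuity homog ephi phi1); last exact: e0.
by rewrite -NE; exact: Df.
Unshelve. all: by end_near. Qed.

End HardyStrongContinuity.

Theorem corollary3p2 (R : realType) (d : measure_display)
  (Omega : measurableMetricType d R) (mu : {measure set Omega -> \bar R})
  (homog : homogeneous_type mu)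
  (L : unbounded_operator mu) (L_sa : self_adjoint L)
  (L_ge0 : nonnegative_operator L) (L_inj : injective_operator L)
  (E : spectral_measure mu) (E_L : is_spectral_resolution E L)
  (DG : davies_gaffney (heat E))
  (H1 : completeNormedModType R[i]) (iota : L2 mu -> H1)
  (H1_L : is_completion (hardy_dom L E) (hardy_norm L E) iota) :
  forall f : H1,
    (bounded_extension (hardy_dom L E) iota (heat E t) f @[t --> 0^'+] --> f) /\
    (bounded_extension (hardy_dom L E) iota (poisson E t) f @[t --> 0^'+] --> f).
Proof.
move=> f; split.
- apply: (expmix_extension_cvg homog L_sa L_ge0 E_L H1_L (P_ := heat E) (phi := hfun)).
  + by move=> t g t0; exact: (heatE L_sa L_ge0 E_L g (ltW t0)).
  + by move=> t t0; apply: expmix_hfun; exact: ltW.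
  + by move=> y _; exact: cvg_expR_mulN.
- apply: (expmix_extension_cvg homog L_sa L_ge0 E_L H1_L (P_ := poisson E) (phi := pfun)).
  + by move=> t g t0; exact: (poissonE L_sa L_ge0 E_L g (ltW t0)).
  + by move=> t t0; apply: expmix_pfun; exact: ltW.
  + by move=> y _; exact: cvg_expR_mulN.
Qed.
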